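(* Assume (A1)–(A3) and (B1), that $\mathrm{Var}_\pi(g_j(X_0))>0$ for all $j$, and that $\boldsymbol\delta=(\delta_1,\dots,\delta_d)$ satisfies $0<\delta_i\le\Delta(F_{g_i})$ for $i=1,\dots,d$. Then for every $x\in\mathsf{X}$, $\hat\Sigma^{(\boldsymbol\delta)}_{psd}\to\Sigma$ as $M\to\infty$, $P_x$-almost surely.
   Context: Let $(\mathsf{X},\mathscr{X})$ be a complete separable metric space with Borel $\sigma$-algebra, $\pi$ a probability measure, $Q$ a Markov kernel, $X=(X_0,X_1,\dots)$ a Markov chain with kernel $Q$, and $P_x$ the law of the chain started at $X_0=x$. (A1): $X$ is $\psi$-irreducible, aperiodic and positive Harris recurrent. (A2): $Q$ is $\pi$-reversible. (A3): there exist $\rho<1$ and a nonnegative function $M(\cdot)$ with $\|Q^n(x,\cdot)-\pi\|_{TV}\le M(x)\rho^n$ for all $x,n$. $g=(g_1,\dots,g_d)$ satisfies (B1): $\int g_j^2d\pi<\infty$. For real $f_1,f_2\in L^2(\pi)$: $\gamma_{f_1f_2}(k)=\mathrm{Cov}_\pi(f_1(X_0),f_2(X_k))$ for $k\ge0$, $\mathrm{Cov}_\pi(f_1(X_{|k|}),f_2(X_0))$ for $k<0$ (stationary chain); $\gamma_f=\gamma_{ff}$. $\Sigma\in\mathbb{R}^{d\times d}$, $\Sigma_{ij}=\sum_{k\in\mathbb{Z}}\gamma_{g_ig_j}(k)$. $F_f$ is the unique positive measure on $[-1,1]$ with $\gamma_f(k)=\int\alpha^{|k|}F_f(d\alpha)$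 (convention $0^0=1$); $\Delta(F)=1-\max\{|x|:x\in\mathrm{Supp}F\}$. $\mathscr{M}_\infty(b)$: sequences $m(k)=\int x^{|k|}\mu(dx)$ with $\mu$ positive on $[-b,b]$; $\Pi_\delta(r)=\arg\min_{m\in\mathscr{M}_\infty(1-\delta)}\sum_k(r(k)-m(k))^2$; $\sigma^2(m)=\sum_{k\in\mathbb{Z}}m(k)$. For real $f$, $r_{M,f}(k)=\frac1M\sum_{t=0}^{M-1-|k|}(f(X_t)-\bar f_M)(f(X_{t+|k|})-\bar f_M)$ for $|k|<M$, $0$ otherwise. With $s_i=\sqrt{r_{M,g_i}(0)}$ and $\delta_{ij}=\min\{\delta_i,\delta_j\}$, the plug-in estimator $\hat\Sigma^{(\boldsymbol\delta)}_{pw}$ is the symmetric matrix with $\hat\Sigma^{(\boldsymbol\delta)}_{pw,ii}=\sum_k\Pi_{\delta_i}(r_{M,g_i})(k)$ and, for $i<j$, $\hat\Sigma^{(\boldsymbol\delta)}_{pw,ij}=\hat\Sigma^{(\boldsymbol\delta)}_{pw,ji}=\frac{s_is_j}{4}\{\sum_k\Pi_{\delta_{ij}}(r_{M,g_i/s_i+g_j/s_j})(k)-\sum_k\Pi_{\delta_{ij}}(r_{M,g_i/s_i-g_j/s_j})(k)\}$. Let $\hat{\mathbf U}_M=[\hat{\mathbf U}_{M1},\dots,\hat{\mathbf U}_{Md}]$ be an orthogonal matrix of eigenvectors of $\hat\Sigma^{(\boldsymbol\delta)}_{pw}$, $\underline\delta=\min_i\delta_i$, and $\hat{\boldsymbol\Lambda}_{\boldsymbol\delta}$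 the diagonal matrix with $j$th entry $\sigma^2(\Pi_{\underline\delta}(r_{M,\hat{\mathbf U}_{Mj}^\top g}))$ (here $r_{M,\hat{\mathbf U}_{Mj}^\top g}$ is the empirical autocovariance of $Y_t=\hat{\mathbf U}_{Mj}^\top g(X_t)$). Then $\hat\Sigma^{(\boldsymbol\delta)}_{psd}=\hat{\mathbf U}_M\hat{\boldsymbol\Lambda}_{\boldsymbol\delta}\hat{\mathbf U}_M^\top$. *)

(* Defs.v *)
From HB Require Import structures.
From Stdlib Require Import ClassicalEpsilon.
From mathcomp Require Import all_boot all_order all_algebra.
From mathcomp Require Import all_classical all_reals all_analysis.
Import Order.TTheory GRing.Theory Num.Theory numFieldNormedType.Exports.

Set Implicit Arguments.
Unset Strict Implicit.
Unset Printing Implicit Defensive.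

Local Open Scope classical_set_scope.
Local Open Scope ring_scope.

Definition Borel (R : realType) (T : completePseudoMetricType R) :=
  g_sigma_algebraType (@open T).

(* metric (points separated) and separable; completeness is in the type *)
Definition polish_metric (R : realType) (T : completePseudoMetricType R) :=
  hausdorff_space T /\ exists D : set T, countable D /\ dense D.

Fixpoint kiter d (X : measurableType d) (R : realType) (Q : R.-pker X ~> X)
    (n : nat) : X -> set X -> \bar R :=
  match n with
  | 0 => fun x A => (\1_A x)%:E
  | n'.+1 => fun x A => (\int[Q x]_y kiter Q n' y A)%E
  end.

Definition tv_dist d (X : measurableType d) (R : realType)
    (mu nu : set X -> \bar R) : \bar R :=
  ereal_sup [set (`| mu A - nu A |)%E | A in [set A : set X | measurable A]].

Definition reversible d (X : measurableType d) (R : realType)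
    (pi : probability X R) (Q : R.-pker X ~> X) :=
  forall A B : set X, measurable A -> measurable B ->
    (\int[pi]_(x in A) Q x B = \int[pi]_(x in B) Q x A)%E.

(* finite-dimensional distributions of the chain, after the initial point:
   fdd_tail Q n As y = int Q(y,dz1) 1_{As 0}(z1) int Q(z1,dz2) 1_{As 1}(z2) ... (n factors) *)
Fixpoint fdd_tail d (X : measurableType d) (R : realType) (Q : R.-pker X ~> X)
    (n : nat) (As : nat -> set X) (y : X) : \bar R :=
  match n with
  | 0 => 1%E
  | n'.+1 => (\int[Q y]_z ((\1_(As 0) z)%:E * fdd_tail Q n' (fun i => As i.+1) z))%E
  end.

(* Xs is a Markov chain with kernel Q started at X_0 = x on (Omega, P),
   i.e. its law is P_x *)
Definition is_markov_chain d (X : measurableType d) (R : realType)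
    (Q : R.-pker X ~> X) (x : X)
    dO (Omega : measurableType dO) (P : probability Omega R)
    (Xs : nat -> Omega -> X) :=
  (forall n, measurable_fun setT (Xs n)) /\
  forall (n : nat) (As : nat -> set X), (forall i, measurable (As i)) ->
    P [set w | forall i, (i <= n)%N -> As i (Xs i w)] =
      ((\1_(As 0) x)%:E * fdd_tail Q n (fun i => As i.+1) x)%E.

Definition irreducibility_measure d (X : measurableType d) (R : realType)
    (Q : R.-pker X ~> X) (psi : {measure set X -> \bar R}) :=
  sigma_finite setT psi /\ (0 < psi setT)%E /\
  forall A : set X, measurable A -> (0 < psi A)%E ->
    forall x, exists n, (0 < n)%N /\ (0 < kiter Q n x A)%E.

Definition has_cycle d (X : measurableType d) (R : realType)
    (Q : R.-pker X ~> X) (psi : {measure set X -> \bar R}) (dd : nat) :=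
  exists D : nat -> set X,
    (forall i, measurable (D i)) /\
    (forall i j, (i < dd)%N -> (j < dd)%N -> i <> j -> D i `&` D j = set0) /\
    (forall i, (i < dd)%N -> forall y, D i y -> Q y (D (i.+1 %% dd)%N) = 1%E) /\
    psi (~` \bigcup_(i in [set i | (i < dd)%N]) D i) = 0%E.

(* aperiodic: the period (largest dd admitting a dd-cycle) is 1 *)
Definition aperiodic d (X : measurableType d) (R : realType)
    (Q : R.-pker X ~> X) (psi : {measure set X -> \bar R}) :=
  forall dd, (2 <= dd)%N -> ~ has_cycle Q psi dd.

Definition harris_recurrent d (X : measurableType d) (R : realType)
    (Q : R.-pker X ~> X) (psi : {measure set X -> \bar R}) :=
  forall A : set X, measurable A -> (0 < psi A)%E ->
  forall (x : X) (dO : measure_display) (Omega : measurableType dO)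
    (P : probability Omega R) (Xs : nat -> Omega -> X),
    is_markov_chain Q x P Xs ->
    {ae P, forall w, forall N, exists n, (N <= n)%N /\ A (Xs n w)}.

Definition positive_chain d (X : measurableType d) (R : realType)
    (Q : R.-pker X ~> X) :=
  exists mu : probability X R, forall A : set X, measurable A ->
    mu A = (\int[mu]_y Q y A)%E.

Definition psi_irr_aperiodic_pos_harris d (X : measurableType d)
    (R : realType) (Q : R.-pker X ~> X) :=
  exists psi : {measure set X -> \bar R},
    irreducibility_measure Q psi /\ aperiodic Q psi /\
    harris_recurrent Q psi /\ positive_chain Q.

Fixpoint Qpow d (X : measurableType d) (R : realType) (Q : R.-pker X ~> X)
    (k : nat) (f : X -> R) : X -> R :=
  match k with
  | 0 => f
  | k'.+1 => fun x => Rintegral (Q x) setT (Qpow Q k' f)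
  end.

Definition pimean d (X : measurableType d) (R : realType)
    (pi : probability X R) (f : X -> R) : R := Rintegral pi setT f.

(* gamma_{f1 f2}(k) = Cov_pi(f1(X_0), f2(X_k)) for k >= 0,
   Cov_pi(f1(X_|k|), f2(X_0)) for k < 0, chain started from pi *)
Definition gamma d (X : measurableType d) (R : realType)
    (pi : probability X R) (Q : R.-pker X ~> X) (f1 f2 : X -> R) (k : int) : R :=
  if (0 <= k)%R then
    Rintegral pi setT (fun x => f1 x * Qpow Q `|k|%N f2 x) - pimean pi f1 * pimean pi f2
  else
    Rintegral pi setT (fun x => f2 x * Qpow Q `|k|%N f1 x) - pimean pi f1 * pimean pi f2.

Definition varpi d (X : measurableType d) (R : realType)
    (pi : probability X R) (f : X -> R) : R :=
  Rintegral pi setT (fun x => (f x - pimean pi f) ^+ 2).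

Definition sumZ (R : realType) (m : int -> R) : R :=
  limn (fun N : nat => \sum_(i < (N + N).+1) m (i%:Z - N%:Z)).

Definition Sigma d (X : measurableType d) (R : realType)
    (pi : probability X R) (Q : R.-pker X ~> X) (dim : nat)
    (g : 'I_dim -> X -> R) : 'M[R]_dim :=
  \matrix_(i, j) sumZ (gamma pi Q (g i) (g j)).

Definition spectral_rep d (X : measurableType d) (R : realType)
    (pi : probability X R) (Q : R.-pker X ~> X) (f : X -> R)
    (F : {measure set R -> \bar R}) :=
  F (~` `[-1, 1]) = 0%E /\
  forall k : int, (gamma pi Q f f k)%:E = (\int[F]_a (a ^+ `|k|%N)%:E)%E.

(* F_f: the (unique) such measure *)
Definition spectral_measure d (X : measurableType d) (R : realType)
    (pi : probability X R) (Q : R.-pker X ~> X) (f : X -> R)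
    : {measure set R -> \bar R} :=
  @epsilon {measure set R -> \bar R} (inhabits (mzero : {measure set R -> \bar R})) (spectral_rep pi Q f).

Definition msupp (R : realType) (F : {measure set R -> \bar R}) : set R :=
  [set x | forall U : set R, open U -> U x -> (0 < F U)%E].

Definition Delta (R : realType) (F : {measure set R -> \bar R}) : R :=
  1 - sup [set `|x| | x in msupp F].

Definition moment_seq (R : realType) (b : R) (m : int -> R) :=
  exists mu : {measure set R -> \bar R},
    mu (~` `[-b, b]) = 0%E /\
    forall k : int, (m k)%:E = (\int[mu]_x (x ^+ `|k|%N)%:E)%E.

Definition lsq_obj (R : realType) (r m : int -> R) : \bar R :=
  esum [set: int] (fun k => ((r k - m k) ^+ 2)%:E).

Definition Pi_proj (R : realType) (delta : R) (r : int -> R) : int -> R :=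
  epsilon (inhabits (fun _ : int => 0 : R))
    (fun m => moment_seq (1 - delta) m /\
       forall m', moment_seq (1 - delta) m' -> (lsq_obj r m <= lsq_obj r m')%E).

Definition sigma2 (R : realType) (m : int -> R) : R := sumZ m.

Definition emp_mean (R : realType) (X : Type) (M : nat) (f : X -> R)
    (xs : nat -> X) : R :=
  M%:R^-1 * \sum_(t < M) f (xs t).

Definition emp_acov (R : realType) (X : Type) (M : nat) (f : X -> R)
    (xs : nat -> X) (k : int) : R :=
  if (`|k|%N < M)%N then
    M%:R^-1 * \sum_(t < M - `|k|%N)
      ((f (xs t) - emp_mean M f xs) * (f (xs (t + `|k|%N)%N) - emp_mean M f xs))
  else 0.

Definition Sigma_pw_off (R : realType) (X : Type) (dim : nat)
    (delta : 'I_dim -> R) (g : 'I_dim -> X -> R) (M : nat) (xs : nat -> X)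
    (i j : 'I_dim) : R :=
  let si := Num.sqrt (emp_acov M (g i) xs 0) in
  let sj := Num.sqrt (emp_acov M (g j) xs 0) in
  let dij := Num.min (delta i) (delta j) in
  si * sj / 4 *
   (sigma2 (Pi_proj dij (emp_acov M (fun x => g i x / si + g j x / sj) xs))
    - sigma2 (Pi_proj dij (emp_acov M (fun x => g i x / si - g j x / sj) xs))).

Definition Sigma_pw (R : realType) (X : Type) (dim : nat)
    (delta : 'I_dim -> R) (g : 'I_dim -> X -> R) (M : nat) (xs : nat -> X)
    : 'M[R]_dim :=
  \matrix_(i, j)
    if i == j then sigma2 (Pi_proj (delta i) (emp_acov M (g i) xs))
    else if (i < j)%N then Sigma_pw_off delta g M xs i j
    else Sigma_pw_off delta g M xs j i.

Definition orth_eigenbasis (R : realType) (dim : nat) (S U : 'M[R]_dim) :=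
  U *m U^T = 1%:M /\
  forall j : 'I_dim, exists lam : R, S *m col j U = lam *: col j U.

Definition delta_min (R : realType) (dim : nat) (delta : 'I_dim -> R) : R :=
  \big[Num.min/1]_(i < dim) delta i.

(* hat Sigma_psd^(delta) = U Lambda U^T, U an orthogonal eigenvector matrix
   of hat Sigma_pw^(delta) *)
Definition Sigma_psd (R : realType) (X : Type) (dim : nat)
    (delta : 'I_dim -> R) (g : 'I_dim -> X -> R) (M : nat) (xs : nat -> X)
    (U : 'M[R]_dim) : 'M[R]_dim :=
  U *m diag_mx (\row_j sigma2 (Pi_proj (delta_min delta)
                   (emp_acov M (fun x => \sum_i U i j * g i x) xs))) *m U^T.

(* Main.v *)
(* The law of the chain started at x approaches, under time shifts, a shift
   invariant law L (the chain started from pi), uniformly over path events; hence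
   both laws agree on invariant events. A 0-1 law for these events and Garsia's
   maximal inequality give the strong law of large numbers under P_x, so that the
   empirical autocovariances converge almost surely at each lag.

   Reversibility makes gamma_f a Hausdorff moment sequence on [-1, 1], and the
   condition on delta_i localizes its measure in [-(1 - delta_i), 1 - delta_i];
   for f = sum_i u_i g_i the same holds with the smallest delta_i involved,
   because gamma_f (2n) = Var (Q^n f). The l^2 projection onto moment sequences is
   consistent on such f, uniformly for bounded u. By polarization Sigma_pw tends
   to Sigma. Since U^T Sigma_pw U is diagonal and the columns of U are bounded,
   the diagonal matrix Lambda differs from U^T Sigma U by o(1), so that
   U Lambda U^T tends to Sigma even though U itself need not converge. *)

Require Import Defs.
From HB Require Import structures.
From Stdlib Require ClassicalEpsilon.
From mathcomp Require Import all_boot all_order all_algebra.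
From mathcomp Require Import all_classical all_reals all_analysis.
From mathcomp Require Import measurable_realfun lebesgue_measure.
From mathcomp Require Import ring lra zify.
Import Order.TTheory GRing.Theory Num.Theory numFieldNormedType.Exports.

Local Open Scope classical_set_scope.
Local Open Scope ring_scope.
Set Implicit Arguments.
Unset Strict Implicit.
Unset Printing Implicit Defensive.

(** * Path space and the law of the chain *)

(** The path law [mu] of the given chain is the only measure on path space available at the outset,
    and the stationary law is built from it. This works because the conditional probability [u] of a
    path event given the present does not depend on time: the shifted probability of the event is
    the integral of [u] against the law of X_n, and the geometric bound on the distance from that
    law to pi is the same for all events, which makes the limit countably additive. Moment sequences
    are handled without their measures: a sequence is recognized by the positivity of a linear form
    on polynomials and a geometric bound. Both conditions survive sums and pointwise limits, and for
    autocovariances they are statements about variances of polynomials in the transition operator.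
    The sums over lags are infinite while convergence is known only lag by lag. One ratio [c] < 1
    dominates all admissible sequences and justifies each exchange of limit and sum. *)

Section nonneg_ind.
Local Open Scope ereal_scope.
Context d (T : measurableType d) (R : realType).
Import HBNNSimple.

(** The standard machine: simple functions are sums of nonnegative multiples of indicators, and
    every nonnegative measurable function is a monotone limit of simple ones. Identities between
    iterated integrals are reduced to sets by it. *)
Lemma nonneg_measurable_ind (Pr : (T -> \bar R) -> Prop) :
  (forall A, measurable A -> Pr (fun t => (\1_A t)%:E)) ->
  (forall (c : R) (f : T -> \bar R), (0 <= c)%R -> (forall t, 0 <= f t) -> measurable_fun setT f ->
     Pr f -> Pr (fun t => c%:E * f t)) ->
  (forall f g : T -> \bar R, (forall t, 0 <= f t) -> measurable_fun setT f ->
     (forall t, 0 <= g t) -> measurable_fun setT g ->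
     Pr f -> Pr g -> Pr (fun t => f t + g t)) ->
  (forall F : (T -> \bar R)^nat, (forall n t, 0 <= F n t) ->
     (forall n, measurable_fun setT (F n)) ->
     (forall t, {homo F^~ t : n m / (n <= m)%N >-> n <= m}) ->
     (forall n, Pr (F n)) -> Pr (fun t => limn (F^~ t))) ->
  forall f : T -> \bar R, (forall t, 0 <= f t) -> measurable_fun setT f -> Pr f.
Proof.
move=> Pind PZ PD Plim f f0 mf.
pose f_ := nnsfun_approx measurableT mf.
have -> : f = fun t => limn (fun n => (f_ n t)%:E).
  by apply/funext => t; apply/esym/cvg_lim => //; exact: cvg_nnsfun_approx.
apply: (Plim (fun n t => (f_ n t)%:E)) => [n t|n|t n m nm|n].
- by rewrite lee_fin.
- exact/measurable_EFinP.
- by rewrite lee_fin; exact/lefP/nd_nnsfun_approx.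
pose g y := fun t => y%:E * (\1_(f_ n @^-1` [set y]) t)%:E : \bar R.
(* A negative value [y] has empty preimage, so replacing its term by 0 changes nothing and makes all
   summands nonnegative. *)
have -> : (fun t => (f_ n t)%:E) =
    fun t => \sum_(y <- finmap.enum_fset (fset_set (range (f_ n)))) (if (0 <= y)%R then g y t else 0).
  apply/funext => t; rewrite fimfunE fsbig_finite//= -sumEFin.
  apply: eq_bigr => y _; rewrite /g; case: ifPn => [_|]; first by rewrite EFinM.
  by rewrite -ltNge => y0; rewrite preimage_nnfun0// indic0 mulr0.
have g0 y t : 0 <= (if (0 <= y)%R then g y t else 0).
  by case: ifP => // y0; rewrite /g -EFinM lee_fin mulr_ge0.
have mg y : measurable_fun setT (fun t => if (0 <= y)%R then g y t else 0).
  case: (boolP (0 <= y)%R) => y0 //; rewrite /g.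
  apply: measurable_funeM; exact/measurable_EFinP/measurable_indic.
have Pg y : Pr (fun t => if (0 <= y)%R then g y t else 0).
  case: (boolP (0 <= y)%R) => [y0|_].
    apply: PZ => //.
    - exact/measurable_EFinP/measurable_indic.
    - exact: Pind.
  have -> : (fun=> 0) = (fun t : T => (\1_set0 t)%:E) :> (T -> \bar R).
    by apply/funext => t; rewrite indic0.
  exact: Pind.
elim: (finmap.enum_fset _) => [|y s IH].
  under eq_fun do rewrite big_nil.
  have -> : (fun=> 0) = (fun t : T => (\1_set0 t)%:E) :> (T -> \bar R).
    by apply/funext => t; rewrite indic0.
  exact: Pind.
under eq_fun do rewrite big_cons.
apply: PD => //.
- by move=> t; apply: sume_ge0.
- by apply: emeasurable_sum.
Qed.

End nonneg_ind.

(** * Sequences of states: rectangles, product sigma-algebra, shifts *)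

Section paths.
Context d (X : measurableType d).

Definition rect (As : nat -> set X) (n : nat) : set (nat -> X) :=
  [set s | forall i, (i <= n)%N -> As i (s i)].

Definition rects : set (set (nat -> X)) :=
  [set B | exists n As, (forall i, measurable (As i)) /\ B = rect As n].

Definition path := g_sigma_algebraType rects.

Definition shift (n : nat) (s : path) : path := fun t => s (n + t)%N.

Lemma measurable_rect As n : (forall i, measurable (As i)) ->
  measurable (rect As n : set path).
Proof. by move=> mA; apply: sub_sigma_algebra; exists n, As. Qed.

(** Concatenation at the common time n, where both constraints apply; a past in a rectangle and a
    shifted future in a rectangle thereby form a single rectangle. *)
Definition cat_rect n (As Bs : nat -> set X) (i : nat) : set X :=
  if (i < n)%N then As i else
  if i == n then As n `&` Bs 0%N else Bs (i - n)%N.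

Lemma measurable_cat_rect n As Bs : (forall i, measurable (As i)) ->
  (forall i, measurable (Bs i)) -> forall i, measurable (cat_rect n As Bs i).
Proof.
move=> mA mB i; rewrite /cat_rect; case: ifP => // _; case: ifP => // _.
exact: measurableI.
Qed.

Lemma rect_cat n k As Bs :
  rect As n `&` shift n @^-1` rect Bs k = rect (cat_rect n As Bs) (n + k).
Proof.
rewrite /cat_rect; apply/seteqP; split => s /=.
  move=> [sA sB] i le_i; case: ltnP => [/ltnW/sA//|ni].
  case: eqP => [->|_]; first split.
  - exact: sA.
  - by have := sB 0%N (leq0n _); rewrite /shift addn0.
  - by have := sB (i - n)%N; rewrite leq_subLR /shift subnKC//; exact.
move=> H; split => i le_i.
  have := H i (leq_trans le_i (leq_addr _ _)).
  rewrite ltn_neqAle le_i andbT; case: eqP => [->|//] /= [].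
  by [].
have := H (n + i)%N; rewrite leq_add2l ltnNge leq_addr /= addKn => /(_ le_i).
rewrite /shift -[X in _ == X]addn0 eqn_add2l; case: eqP => [->|//].
by rewrite addn0 => -[].
Qed.

Lemma rects_setI : setI_closed rects.
Proof.
move=> _ _ [n [As [mA ->]]] [m [Bs [mB ->]]].
exists (maxn n m), (fun i => (if (i <= n)%N then As i else setT) `&`
                             (if (i <= m)%N then Bs i else setT)).
split.
  by move=> i; apply: measurableI; case: ifP.
apply/seteqP; split => s /=.
  move=> [sA sB] i _; split.
    by case: ifP => // /sA.
  by case: ifP => // /sB.
move=> H; split => i le_i.
  have /H[] : (i <= maxn n m)%N by rewrite leq_max le_i.
  by rewrite le_i.
have /H[_] : (i <= maxn n m)%N by rewrite leq_max le_i orbT.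
by rewrite le_i.
Qed.

Lemma rects_setT : rects setT.
Proof. by exists 0%N, (fun=> setT); split => //; apply/seteqP; split. Qed.

Lemma measurable_coord n : measurable_fun setT (fun s : path => s n).
Proof.
move=> _ B mB; rewrite setTI.
rewrite (_ : _ @^-1` _ = rect (fun i => if i == n then B else setT) n).
  by apply: measurable_rect => i; case: ifP.
apply/seteqP; split => s /=.
  by move=> Bs i _; case: eqP => // ->.
by move=> /(_ n (leqnn _)); rewrite eqxx.
Qed.

Lemma measurable_to_path d' (S : measurableType d') (f : S -> path) :
  (forall n, measurable_fun setT (fun s => f s n)) -> measurable_fun setT f.
Proof.
move=> mf; refine (@measurability _ _ S path setT f rects erefl _).
move=> _ [_ [n [As [mA ->]]] <-]; rewrite setTI.
rewrite (_ : _ @^-1` _ =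
    \bigcap_i ((fun s => f s i) @^-1` (if (i <= n)%N then As i else setT))).
  apply: bigcapT_measurable => i; rewrite -[_ @^-1` _]setTI.
  by apply: mf => //; case: ifP.
apply/seteqP; split => s /= H i.
  by move=> _ /=; case: ifP => // /H.
by move=> le_i; have := H i Logic.I; rewrite /= le_i.
Qed.

Lemma measurable_shift n : measurable_fun setT (shift n).
Proof. by apply: measurable_to_path => t; exact: measurable_coord. Qed.

Lemma shiftD m n s : shift m (shift n s) = shift (n + m) s.
Proof. by apply/funext => t; rewrite /shift addnA. Qed.

Definition coord (n : nat) (s : path) : X := s n.

HB.instance Definition _ n := @isMeasurableFun.Build _ _ path path (shift n) (measurable_shift n).
HB.instance Definition _ n := @isMeasurableFun.Build _ _ path X (coord n) (measurable_coord n).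

End paths.

(** * Iterated integrals of the kernel along a rectangle *)

Section chain_functional.
Local Open Scope ereal_scope.
Context d (X : measurableType d) (R : realType) (Q : R.-pker X ~> X).

(** The expectation of phi(X_n) for the chain started at [y], on the event that X_1, ..., X_n lie in
    the first n sets of [As]. The terminal function [phi], in place of the constant 1 of [fdd_tail],
    lets the Markov property be stated for functionals. *)
Fixpoint fdd_fun (n : nat) (As : nat -> set X) (phi : X -> \bar R) (y : X) : \bar R :=
  match n with
  | 0 => phi y
  | n'.+1 => \int[Q y]_z ((\1_(As 0%N) z)%:E * fdd_fun n' (fun i => As i.+1) phi z)
  end.

Lemma fdd_tailE n As y : fdd_tail Q n As y = fdd_fun n As (cst 1) y.
Proof. by elim: n As y => //= n IH As y; apply: eq_integral => z _; rewrite IH. Qed.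

Lemma fdd_fun_ge0 n As phi y : (forall z, 0 <= phi z) -> 0 <= fdd_fun n As phi y.
Proof.
move=> phi0; elim: n As y => //= n IH As y; apply: integral_ge0 => z _.
by rewrite mule_ge0// lee_fin.
Qed.

Lemma measurable_mul_indic (A : set X) (phi : X -> \bar R) : measurable A ->
  measurable_fun setT phi -> measurable_fun setT (fun z => (\1_A z)%:E * phi z).
Proof.
move=> mA mphi; apply: emeasurable_funM => //.
exact/measurable_EFinP/measurable_indic.
Qed.

Lemma mul_indic_ge0 (A : set X) (phi : X -> \bar R) : (forall z, 0 <= phi z) ->
  forall z, 0 <= (\1_A z)%:E * phi z.
Proof. by move=> phi0 z; rewrite mule_ge0// lee_fin. Qed.

Lemma measurable_fun_fdd n As phi : (forall i, measurable (As i)) ->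
  (forall z, 0 <= phi z) -> measurable_fun setT phi ->
  measurable_fun setT (fdd_fun n As phi).
Proof.
move=> mA phi0 mphi; elim: n As mA => //= n IH As mA.
apply: measurable_fun_integral_kernel.
- exact: measurable_kernel.
- by apply: mul_indic_ge0 => z; apply: fdd_fun_ge0.
- by apply: measurable_mul_indic => //; exact: IH.
Qed.

Lemma fdd_funD n As phi psi y : (forall i, measurable (As i)) ->
  (forall z, 0 <= phi z) -> measurable_fun setT phi ->
  (forall z, 0 <= psi z) -> measurable_fun setT psi ->
  fdd_fun n As (fun z => phi z + psi z) y = fdd_fun n As phi y + fdd_fun n As psi y.
Proof.
move=> mA phi0 mphi psi0 mpsi; elim: n As mA y => //= n IH As mA y.
under eq_integral.
  move=> z _; rewrite IH// ge0_muleDr; [|exact: fdd_fun_ge0..].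
  over.
rewrite ge0_integralD//.
- by move=> z _; apply: mul_indic_ge0 => ?; exact: fdd_fun_ge0.
- by apply: measurable_mul_indic => //; exact: measurable_fun_fdd.
- by move=> z _; apply: mul_indic_ge0 => ?; exact: fdd_fun_ge0.
- by apply: measurable_mul_indic => //; exact: measurable_fun_fdd.
Qed.

Lemma fdd_funZ n As (c : R) phi y : (forall i, measurable (As i)) -> (0 <= c)%R ->
  (forall z, 0 <= phi z) -> measurable_fun setT phi ->
  fdd_fun n As (fun z => c%:E * phi z) y = c%:E * fdd_fun n As phi y.
Proof.
move=> mA c0 phi0 mphi; elim: n As mA y => //= n IH As mA y.
under eq_integral.
  move=> z _; rewrite IH// muleCA.
  over.
rewrite ge0_integralZl//.
- by apply: measurable_mul_indic => //; exact: measurable_fun_fdd.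
- by move=> z _; apply: mul_indic_ge0 => ?; exact: fdd_fun_ge0.
Qed.

Lemma le_fdd_fun n As phi psi y : (forall i, measurable (As i)) ->
  (forall z, 0 <= phi z) -> measurable_fun setT phi ->
  measurable_fun setT psi ->
  (forall z, phi z <= psi z) ->
  fdd_fun n As phi y <= fdd_fun n As psi y.
Proof.
move=> mA phi0 mphi mpsi le; have psi0 z : 0 <= psi z by exact: le_trans (le z).
elim: n As mA y => //= n IH As mA y.
apply: ge0_le_integral => //.
- by move=> z _; apply: mul_indic_ge0 => ?; exact: fdd_fun_ge0.
- by apply: measurable_mul_indic => //; exact: measurable_fun_fdd.
- by apply: measurable_mul_indic => //; exact: measurable_fun_fdd.
- by move=> z _; apply: lee_wpmul2l; [rewrite lee_fin|exact: IH].
Qed.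

Lemma fdd_fun_lim n As (F : (X -> \bar R)^nat) y : (forall i, measurable (As i)) ->
  (forall n t, 0 <= F n t) -> (forall n, measurable_fun setT (F n)) ->
  (forall t, {homo F^~ t : n m / (n <= m)%N >-> n <= m}) ->
  fdd_fun n As (fun z => limn (F^~ z)) y = limn (fun k => fdd_fun n As (F k) y).
Proof.
move=> mA F0 mF ndF; elim: n As mA y => //= n IH As mA y.
rewrite -monotone_convergence//.
- apply: eq_integral => z _; rewrite IH// limeMl//.
  apply: ereal_nondecreasing_is_cvgn => a b ab.
  by apply: le_fdd_fun => // t; exact: ndF.
- by move=> k; apply: measurable_mul_indic => //; exact: measurable_fun_fdd.
- by move=> k z _; apply: mul_indic_ge0 => ?; exact: fdd_fun_ge0.
- move=> z _ a b ab; apply: lee_wpmul2l; first by rewrite lee_fin.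
  by apply: le_fdd_fun => // t; exact: ndF.
Qed.

(** Chapman-Kolmogorov for rectangles: the inner functional depends only on the state reached at
    time n, so nesting the two gives the functional of the concatenated rectangle. *)
Lemma fdd_fun_cat n k As Bs y :
  (\1_(As 0%N) y)%:E * fdd_fun n (fun i => As i.+1)
    (fun z => (\1_(Bs 0%N) z)%:E * fdd_fun k (fun i => Bs i.+1) (cst 1) z) y =
  (\1_(cat_rect n As Bs 0%N) y)%:E *
    fdd_fun (n + k) (fun i => cat_rect n As Bs i.+1) (cst 1) y.
Proof.
rewrite /cat_rect; elim: n As y => [|n IH] As y /=.
  by rewrite indicI muleA -EFinM; congr (_ * _).
congr (_ * _); apply: eq_integral => z _.
by rewrite (IH (fun i => As i.+1) z)/=.
Qed.

Lemma fdd_fun_last n As phi y :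
  fdd_fun n.+1 As phi y =
  fdd_fun n As (fun z => \int[Q z]_t ((\1_(As n) t)%:E * phi t)) y.
Proof.
elim: n As y => //= n IH As y; apply: eq_integral => z _.
by rewrite -(IH (fun i => As i.+1)).
Qed.

End chain_functional.

(** * The Markov property of the path law *)

Section chain_law.
Local Open Scope ereal_scope.
Context d (X : measurableType d) (R : realType) (Q : R.-pker X ~> X) (x : X).
Variable mu : probability (path X) R.
Hypothesis mu_rect : forall n As, (forall i, measurable (As i)) ->
  mu (rect As n) = (\1_(As 0%N) x)%:E * fdd_tail Q n (fun i => As i.+1) x.

Let measurable_at n (phi : X -> \bar R) (D : set (path X)) : measurable_fun setT phi ->
  measurable_fun D (fun s : path X => phi (s n)).
Proof.
move=> mphi; apply: (@measurable_funS _ _ _ _ setT) => //.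
exact: (measurableT_comp mphi (measurable_coord n)).
Qed.

(** For an indicator [phi] the left side is the probability of a concatenated rectangle; both sides
    are additive and monotone continuous in [phi]. *)
Lemma integral_rect n As phi : (forall i, measurable (As i)) ->
  (forall z, 0 <= phi z) -> measurable_fun setT phi ->
  \int[mu]_(s in rect As n) phi (s n) =
  (\1_(As 0%N) x)%:E * fdd_fun Q n (fun i => As i.+1) phi x.
Proof.
move=> mA phi0 mphi; have mr := measurable_rect n mA.
have mA' i : measurable (As i.+1) by exact: mA.
pose Pr phi := \int[mu]_(s in rect As n) phi (s n) =
  (\1_(As 0%N) x)%:E * fdd_fun Q n (fun i => As i.+1) phi x.
apply: (@nonneg_measurable_ind _ X R Pr) => //; rewrite /Pr.
- move=> C mC.
  have mC' : measurable ((fun s : path X => s n) @^-1` C).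
    by rewrite -[_ @^-1` _]setTI; exact: measurable_coord.
  rewrite [LHS](integral_indic mu mr mC').
  have := @fdd_fun_cat _ X R Q n 0 As (fun=> C) x; rewrite /= addn0.
  rewrite -fdd_tailE -mu_rect; last by apply: measurable_cat_rect.
  rewrite -[X in rect _ X]addn0 -rect_cat.
  rewrite (_ : shift n @^-1` _ = (fun s : path X => s n) @^-1` C); last first.
    apply/seteqP; split => s /=; first by move/(_ 0%N (leqnn _)); rewrite /shift addn0.
    by move=> Cs i; rewrite leqn0 => /eqP ->; rewrite /shift addn0.
  rewrite setIC => <-; congr (_ * fdd_fun _ _ _ _ _).
  by apply/funext => z; rewrite mule1.
- move=> c f c0 f0 mf IH.
  rewrite ge0_integralZl//; last exact: measurable_at.
  by rewrite IH fdd_funZ// muleCA.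
- move=> f g f0 mf g0 mg IHf IHg.
  rewrite ge0_integralD//; [|exact: measurable_at..].
  by rewrite IHf IHg fdd_funD// ge0_muleDr//; exact: fdd_fun_ge0.
- move=> F F0 mF ndF IH.
  rewrite [LHS](@monotone_convergence _ _ _ mu _ mr (fun k s => F k (s n)))//; last first.
    by move=> k; exact: measurable_at.
  under eq_fun do rewrite IH.
  rewrite fdd_fun_lim// limeMl//.
  apply: ereal_nondecreasing_is_cvgn => a b ab.
  by apply: le_fdd_fun => // t; exact: ndF.
Qed.

Lemma integral_rect_step n As phi : (forall i, measurable (As i)) ->
  (forall z, 0 <= phi z) -> measurable_fun setT phi ->
  \int[mu]_(s in rect As n) phi (s n.+1) =
  \int[mu]_(s in rect As n) (\int[Q (s n)]_z phi z).
Proof.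
move=> mA phi0 mphi.
(* Leaving the coordinate n + 1 free lets the same event be read as a rectangle up to time n + 1. *)
pose As' i := if (i <= n)%N then As i else setT.
have mA' i : measurable (As' i) by rewrite /As'; case: ifP.
have -> : rect As n = rect As' n.+1.
  apply/seteqP; rewrite /As'; split => s /= H i.
    by move=> _; case: ifP => // /H.
  by move=> le_i; have := H i (leqW le_i); rewrite le_i.
rewrite integral_rect// (fdd_fun_last Q n) [in LHS]/As' /= ltnn.
have -> : rect As' n.+1 = rect As' n.
  apply/seteqP; rewrite /As'; split => s /= H i le_i; first by apply: H; exact: leqW.
  by case: ifP => // h; have := H i h; rewrite h.
rewrite [RHS](@integral_rect n As' (fun y => \int[Q y]_z phi z))//; last 2 first.
- by move=> z; exact: integral_ge0.
- by apply: measurable_fun_integral_kernel => //; exact: measurable_kernel.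
congr (_ * fdd_fun _ _ _ _ _); apply/funext => z; apply: eq_integral => t _.
by rewrite indicT mul1e.
Qed.

(* the Markov property: given the past, the conditional probability of a path
   event is a function of the present, and this function does not depend on the
   time *)
Definition cond_prob (A : set (path X)) (u : X -> \bar R) :=
  [/\ measurable_fun setT u, (forall y, 0 <= u y <= 1) &
    forall n As, (forall i, measurable (As i)) ->
      mu (rect As n `&` shift n @^-1` A) = \int[mu]_(s in rect As n) u (s n)].

Let measurable_pre n (A : set (path X)) : measurable A -> measurable (shift n @^-1` A).
Proof. by move=> mA; rewrite -[_ @^-1` _]setTI; exact: measurable_shift. Qed.

(** Dynkin induction: on rectangles [u] is an explicit iterated integral, a complement gets 1 - u, a
    disjoint union the sum. The time n never enters [u] because the kernel is the same at each
    step. *)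
Lemma exists_cond_prob (A : set (path X)) : measurable A -> exists u, cond_prob A u.
Proof.
move=> mA; apply: (@dynkin_induction _ (path X) (@rects _ X) (fun A => exists u, cond_prob A u)) => //.
- exact: rects_setI.
- exists (cst 1); split => //; first by move=> y; rewrite lee_fin ler01 lexx.
  move=> n As mAs; rewrite preimage_setT setIT integral_cst ?mul1e//.
  exact: measurable_rect.
- move=> _ [k [Bs [mB ->]]].
  exists (fun z => (\1_(Bs 0%N) z)%:E * fdd_fun Q k (fun i => Bs i.+1) (cst 1) z).
  have mu0 : measurable_fun setT (fun z => (\1_(Bs 0%N) z)%:E * fdd_fun Q k (fun i => Bs i.+1) (cst 1) z).
    by apply: measurable_mul_indic => //; exact: measurable_fun_fdd.
  have ge0 z : 0 <= (\1_(Bs 0%N) z)%:E * fdd_fun Q k (fun i => Bs i.+1) (cst 1) z.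
    by apply: mul_indic_ge0 => ?; exact: fdd_fun_ge0.
  split => //.
  + move=> y; rewrite ge0 /=; apply: (@le_trans _ _ (1 * 1)); last by rewrite mule1.
    apply: lee_pmul => //; [exact: fdd_fun_ge0|by rewrite lee_fin indicE; case: (_ \in _)|].
    elim: k Bs mB {mu0 ge0} y => //= k IH Bs mB y.
    apply: (@le_trans _ _ (\int[Q y]_z 1)).
      apply: ge0_le_integral => //.
      * by move=> z _; apply: mul_indic_ge0 => ?; exact: fdd_fun_ge0.
      * by apply: measurable_mul_indic => //; apply: measurable_fun_fdd.
      * move=> z _; apply: (@le_trans _ _ (1 * 1)); last by rewrite mule1.
        apply: lee_pmul => //; [exact: fdd_fun_ge0|by rewrite lee_fin indicE; case: (_ \in _)|].
        by apply: (IH (fun i => Bs i.+1)).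
    by rewrite integral_cst// mul1e prob_kernel.
  + move=> n As mAs.
    rewrite [RHS](@integral_rect n As
      (fun z => (\1_(Bs 0%N) z)%:E * fdd_fun Q k (fun i => Bs i.+1) (cst 1) z))//.
    rewrite rect_cat mu_rect ?fdd_fun_cat ?fdd_tailE//.
    exact: measurable_cat_rect.
- move=> S mS [u [mu_ u01 uE]]; exists (fun y => 1 - u y); split.
  + exact: emeasurable_funB.
  + move=> y; have /andP[u0 u1] := u01 y.
    have uf : u y \is a fin_num by rewrite ge0_fin_numE// (le_lt_trans u1) ?ltry.
    by rewrite -(fineK uf) -EFinB !lee_fin in u0 u1 *; rewrite subr_ge0 u1 gerBl.
  + move=> n As mAs; have mr := measurable_rect n mAs.
    have ufin y : u y \is a fin_num.
      by have /andP[u0 u1] := u01 y; rewrite ge0_fin_numE// (le_lt_trans u1) ?ltry.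
    have -> : rect As n `&` shift n @^-1` (~` S) = rect As n `\` (rect As n `&` shift n @^-1` S).
      apply/seteqP; split => s /=; first by move=> [? ?]; split => // -[].
      by move=> [? h]; split => // ?; apply: h.
    have mrS : measurable ((rect As n : set (path X)) `&` shift n @^-1` S).
      by apply: measurableI => //; exact: measurable_pre.
    rewrite measureD//; last by rewrite (le_lt_trans (probability_le1 _ _)) ?ltry//.
    transitivity (mu (rect As n) - \int[mu]_(s in rect As n) u (s n)).
      by congr (_ - _); rewrite setIA setIid; exact: uE.
    rewrite [RHS](@integralB _ _ _ mu _ mr (cst 1) (fun s => u (s n))).
    - by rewrite integral_cst// mul1e.
    - exact: finite_measure_integrable_cst.
    - apply: (@le_integrable _ _ _ mu _ mr _ (cst 1)).
      + exact: measurable_at.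
      + by move=> s _; have /andP[u0 u1] := u01 (s n); rewrite gee0_abs// abse1.
      + exact: finite_measure_integrable_cst.
- move=> F mF tF /choice[u uP].
  pose v y := \sum_(k <oo) u k y.
  have u0 k y : 0 <= u k y by have [_ /(_ y)/andP[]] := uP k.
  have mu_ k : measurable_fun setT (u k) by have [] := uP k.
  have v0 y : 0 <= v y by exact: nneseries_ge0.
  have mv : measurable_fun setT v by apply: ge0_emeasurable_sum.
  have vE n As : (forall i, measurable (As i)) ->
      mu (rect As n `&` shift n @^-1` (\bigcup_k F k)) = \int[mu]_(s in rect As n) v (s n).
    move=> mAs; have mr := measurable_rect n mAs.
    rewrite preimage_bigcup setI_bigcupr measure_bigcup//; last 2 first.
      - by move=> k _; apply: measurableI => //; exact: measurable_pre.
      - apply/trivIsetP => i j _ _ ij; move/trivIsetP : tF => /(_ i j Logic.I Logic.I ij).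
        move=> Fij; apply/seteqP; split => // s [[_ Fi] [_ Fj]].
        by have : (F i `&` F j) (shift n s) by []; rewrite Fij.
    rewrite [RHS](@integral_nneseries _ _ _ mu _ mr (fun k s => u k (s n)))//; last first.
      by move=> k; exact: measurable_at.
    rewrite (@eq_eseriesl _ _ xpredT); last by move=> k; rewrite in_setT.
    by apply: eq_eseriesr => k _; have [_ _] := uP k; apply.
  (* The sum [v] may exceed 1 at some states. On the part of the rectangle where v > 1 its integral
     is a probability, hence at most the mass of that part, which is the integral of 1 there; so
     truncation at 1 leaves the integrals unchanged. *)
  exists (fun y => mine (v y) 1); split.
  + exact: measurable_mine.
  + by move=> y; rewrite le_min v0 lee01 ge_min lexx orbT.
  move=> n As mAs; rewrite vE//.
  pose C := [set y | 1 < v y].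
  have mC : measurable C by rewrite -[C]setTI; exact: emeasurable_fun_o_infty.
  pose As_ D i := if i == n then As n `&` D else As i.
  have mAs_ D : measurable D -> forall i, measurable (As_ D i).
    by move=> mD i; rewrite /As_; case: ifP => // _; exact: measurableI.
  have rE D s : rect (As_ D) n s <-> rect As n s /\ D (s n).
    split => [H|[H Ds] i le_i]; last first.
      by rewrite /As_; case: eqP => [->|_]; [split => //; exact: H|exact: H].
    split; last by have := H n (leqnn _); rewrite /As_ eqxx => -[].
    by move=> i le_i; have := H i le_i; rewrite /As_; case: eqP => [->[]|].
  have rU : rect As n = rect (As_ C) n `|` rect (As_ (~` C)) n.
    apply/seteqP; split => s.
      by move=> H; have [Cs|Cs] := pselect (C (s n)); [left|right]; apply/rE.
    by move=> [] /rE [].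
  have rD : [disjoint rect (As_ C) n & rect (As_ (~` C)) n].
    apply/disj_setPS => s [/rE[_ Cs] /rE[_]]; exact.
  have mrC : measurable (rect (As_ C) n : set (path X)) by apply: measurable_rect; exact: mAs_.
  have mrCC : measurable (rect (As_ (~` C)) n : set (path X)).
    by apply: measurable_rect; apply: mAs_; exact: measurableC.
  rewrite rU (@ge0_integral_setU _ _ _ mu _ _ mrC mrCC (fun s => v (s n)))//; last exact: measurable_at.
  rewrite (@ge0_integral_setU _ _ _ mu _ _ mrC mrCC (fun s => mine (v (s n)) 1))//; last 2 first.
  - by apply: (measurable_at n (phi := fun y => mine (v y) 1)); exact: measurable_mine.
  - by move=> s _; rewrite le_min v0 lee01.
  congr (_ + _).
    transitivity (\int[mu]_(s in rect (As_ C) n) 1); last first.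
      apply: eq_integral => s /set_mem /rE[_ Cs].
      by rewrite /mine ltNge (ltW Cs).
    apply/eqP; rewrite eq_le; apply/andP; split.
      rewrite -vE; last exact: mAs_.
      rewrite integral_cst// mul1e; apply: le_measure; rewrite ?inE//.
      by apply: measurableI => //; apply: measurable_pre; exact: bigcup_measurable.
    apply: ge0_le_integral => //; first exact: measurable_at.
    by move=> s /rE[_ /ltW].
  apply: eq_integral => s /set_mem /rE[_ /negP]; rewrite -leNgt => h.
  by rewrite /mine; move: h; rewrite le_eqVlt => /orP[/eqP ->|->//]; rewrite ltxx.
Qed.

End chain_law.

(** * Integrals of [0, 1]-valued functions, uniformly over measures *)

Section approx01.
Context d (S : measurableType d) (R : realType).
Implicit Types (nu : {measure set S -> \bar R}) (u : S -> \bar R).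

(** The sum is the integer part of [a], capped at [N]. *)
Lemma sum_threshold (a : R) (N : nat) : 0 <= a ->
  (\sum_(i < N) (i.+1%:R <= a)%R%:R <= a) /\
  (a <= N%:R -> a <= \sum_(i < N) (i.+1%:R <= a)%R%:R + 1).
Proof.
move=> a0; have full n : n%:R <= a -> \sum_(i < n) (i.+1%:R <= a)%R%:R = n%:R :> R.
  move=> na; rewrite -[RHS]mulr_natl mulr1.
  under eq_bigr => i _.
    have -> : i.+1%:R <= a by apply: le_trans na; rewrite ler_nat.
    over.
  by rewrite sumr_const card_ord.
elim: N => [|N [IH1 IH2]]; first by rewrite big_ord0 add0r; split => // /le_trans; apply; rewrite ler01.
have [Na|aN] := leP N.+1%:R a.
  rewrite full//; split => // /le_trans; apply; rewrite lerDl; exact: ler01.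
have -> : \sum_(i < N.+1) (i.+1%:R <= a)%R%:R = \sum_(i < N) (i.+1%:R <= a)%R%:R :> R.
  by rewrite big_ord_recr /= [_ <= a]leNgt aN addr0.
split => // _.
have [/IH2//|Na] := leP a N%:R.
by rewrite full ?(ltW Na)// natr1 ltW.
Qed.

Lemma mass_fin nu A : measurable A -> (nu setT <= 1)%E -> nu A \is a fin_num.
Proof.
move=> mA n1; rewrite ge0_fin_numE//; apply: (@le_lt_trans _ _ 1%E); last exact: ltry.
by apply: le_trans n1; apply: le_measure; rewrite ?inE.
Qed.

Lemma integral01_fin nu u : measurable_fun setT u -> (forall y, 0 <= u y <= 1)%E ->
  (nu setT <= 1)%E -> (\int[nu]_y u y)%E \is a fin_num.
Proof.
move=> mu u01 n1; rewrite ge0_fin_numE; last by apply: integral_ge0 => y _; have /andP[] := u01 y.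
apply: (@le_lt_trans _ _ (\int[nu]_y 1)%E).
  by apply: ge0_le_integral => // y _; have /andP[] := u01 y.
by rewrite integral_cst// mul1e (le_lt_trans n1)// ltry.
Qed.

(** The sets are the level sets {u >= (i+1)/N}; the average of their indicators is within 1/N of
    [u]. They are chosen before [nu], so bounds and limits known on sets transfer to integrals. *)
Lemma integral01_approx u (N : nat) : measurable_fun setT u ->
  (forall y, 0 <= u y <= 1)%E -> (0 < N)%N ->
  exists C : nat -> set S, (forall i, measurable (C i)) /\
    forall nu, (nu setT <= 1)%E ->
    `|fine (\int[nu]_y u y)%E - N%:R^-1 * \sum_(i < N) fine (nu (C i))| <= N%:R^-1.
Proof.
move=> mu u01 N0; have N0' : 0 < N%:R :> R by rewrite ltr0n.
pose C i := [set y | (i.+1%:R / N%:R)%:E <= u y]%E.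
have mC i : measurable (C i) by rewrite -[C i]setTI; exact: emeasurable_fun_c_infty.
exists C; split => // nu n1.
pose s y : \bar R := (\sum_(i < N) (N%:R^-1)%:E * (\1_(C i) y)%:E)%E.
have sE y : s y = (N%:R^-1 * \sum_(i < N) (i.+1%:R <= N%:R * fine (u y))%R%:R)%:E.
  rewrite /s mulr_sumr -sumEFin; apply: eq_bigr => i _; rewrite -EFinM; congr (_ * _)%:E.
  rewrite indicE; suff -> : (y \in C i) = (i.+1%:R <= N%:R * fine (u y))%R by [].
  apply/idP/idP.
    rewrite inE /C /= => h; have /andP[u0 u1] := u01 y.
    by rewrite -(@fineK _ (u y)) ?lee_fin ?ler_pdivrMr ?[_ * N%:R]mulrC// in h;
      rewrite ge0_fin_numE// (le_lt_trans u1)// ltry.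
  rewrite inE /C /= => h; have /andP[u0 u1] := u01 y.
  by rewrite -(@fineK _ (u y)) ?lee_fin ?ler_pdivrMr ?[_ * N%:R]mulrC//
    ge0_fin_numE// (le_lt_trans u1)// ltry.
have ms : measurable_fun setT s.
  apply: emeasurable_sum => i; apply: measurable_funeM.
  exact/measurable_EFinP/measurable_indic.
have s0 y : (0 <= s y)%E by rewrite sE lee_fin mulr_ge0 ?invr_ge0 ?sumr_ge0// ler0n.
have us y : (s y <= u y /\ u y <= s y + (N%:R^-1)%:E)%E.
  have /andP[u0 u1] := u01 y; have uf : u y \is a fin_num.
    by rewrite ge0_fin_numE// (le_lt_trans u1)// ltry.
  rewrite sE -(fineK uf) -EFinD !lee_fin in u0 u1 *.
  have [h1 h2] := @sum_threshold (N%:R * fine (u y)) N (mulr_ge0 (ltW N0') u0).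
  rewrite /= -{3}[N%:R^-1]mulr1 -mulrDr ler_pdivrMl// ler_pdivlMl//; split => //.
  by apply: h2; rewrite -[leRHS]mulr1 ler_wpM2l// ltW.
have sI : (\int[nu]_y s y)%E = (N%:R^-1 * \sum_(i < N) fine (nu (C i)))%:E.
  rewrite ge0_integral_sum//; last first.
    by move=> i; apply: measurable_funeM; exact/measurable_EFinP/measurable_indic.
  rewrite mulr_sumr -sumEFin; apply: eq_bigr => i _.
  rewrite ge0_integralZl//; last exact/measurable_EFinP/measurable_indic.
  by rewrite integral_indic// setIT EFinM fineK// mass_fin.
have If := integral01_fin mu u01 n1.
have h1 : (\int[nu]_y s y <= \int[nu]_y u y)%E.
  by apply: ge0_le_integral => // y _; have [] := us y.
have h2 : (\int[nu]_y u y <= \int[nu]_y s y + (N%:R^-1)%:E)%E.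
  apply: (@le_trans _ _ (\int[nu]_y (s y + (N%:R^-1)%:E))%E).
    apply: ge0_le_integral => //.
    - by move=> y _; have /andP[] := u01 y.
    - by apply: emeasurable_funD.
    - by move=> y _; have [] := us y.
  rewrite ge0_integralD//.
  apply: leeD2l => //; rewrite integral_cst//.
  by rewrite -[leRHS]mule1 lee_wpmul2l// lee_fin invr_ge0.
move: h1 h2; rewrite sI -(fineK If) -EFinD !lee_fin => h1 h2.
by rewrite ger0_norm ?subr_ge0// lerBlDl.
Qed.

(** No factor is lost in front of [e]: an average of N errors on sets is at most [e], and 1/N is
    arbitrarily small. *)
Lemma integral01_dist u (nu nu' : {measure set S -> \bar R}) (e : R) :
  measurable_fun setT u -> (forall y, 0 <= u y <= 1)%E ->
  (nu setT <= 1)%E -> (nu' setT <= 1)%E ->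
  (forall A, measurable A -> `|fine (nu A) - fine (nu' A)| <= e) ->
  `|fine (\int[nu]_y u y)%E - fine (\int[nu']_y u y)%E| <= e.
Proof.
move=> mu u01 n1 n1' H; apply/ler_addgt0Pr => e' e'0.
have [N N0 Ne] : exists2 N : nat, (0 < N)%N & N%:R^-1 <= e' / 2.
  exists (Num.truncn (e' / 2)^-1).+1 => //.
  rewrite invf_ple ?posrE ?divr_gt0//; exact/ltW/truncnS_gt.
have [C [mC CP]] := integral01_approx mu u01 N0.
have h := CP _ n1; have h' := CP _ n1'.
set a := fine _ in h *; set a' := fine _ in h' *.
set b := _ * _ in h; set b' := _ * _ in h'.
have hb : `|b - b'| <= e.
  rewrite /b /b' -mulrBr -sumrB normrM gtr0_norm ?invr_gt0 ?ltr0n//.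
  rewrite ler_pdivrMl ?ltr0n//; apply: le_trans (ler_norm_sum _ _ _) _.
  apply: (@le_trans _ _ (\sum_(i < N) e)); first by apply: ler_sum => i _; exact: H.
  by rewrite sumr_const card_ord mulr_natl.
have -> : a - a' = (a - b) + (b - b') + (b' - a') by ring.
apply: le_trans (ler_normD _ _) _; apply: le_trans (lerD (ler_normD _ _) (lexx _)) _.
rewrite distrC in h'; move: (le_trans h Ne) (le_trans h' Ne) => h1 h2; lra.
Qed.

Lemma cvg_integral01 u (nu_ : nat -> {measure set S -> \bar R}) nu :
  measurable_fun setT u -> (forall y, 0 <= u y <= 1)%E ->
  (forall n, nu_ n setT <= 1)%E -> (nu setT <= 1)%E ->
  (forall A, measurable A -> fine (nu_ n A) @[n --> \oo] --> fine (nu A)) ->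
  fine (\int[nu_ n]_y u y)%E @[n --> \oo] --> fine (\int[nu]_y u y)%E.
Proof.
move=> mu u01 n1 n1' H; apply/cvgrPdist_le => e e0.
have [N N0 Ne] : exists2 N : nat, (0 < N)%N & N%:R^-1 <= e / 3.
  exists (Num.truncn (e / 3)^-1).+1 => //.
  rewrite invf_ple ?posrE ?divr_gt0//; exact/ltW/truncnS_gt.
have [C [mC CP]] := integral01_approx mu u01 N0.
have cv : N%:R^-1 * \sum_(i < N) fine (nu_ n (C i)) @[n --> \oo] -->
          N%:R^-1 * \sum_(i < N) fine (nu (C i)).
  by apply: cvgMr; apply: cvg_big => // [|i _]; [exact: add_continuous|exact: H].
have /cvgrPdist_le /(_ _ (divr_gt0 e0 (ltr0n _ 3))) := cv.
apply: filterS => n hn; have h := CP _ (n1 n); have h' := CP _ n1'.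
move: h h' hn; set a := fine _; set a' := fine _; set b := _ * _; set b' := _ * _.
move=> /le_trans/(_ Ne) h /le_trans/(_ Ne) h' hn.
rewrite distrC in h.
have -> : a' - a = (a' - b') + (b' - b) + (b - a) by ring.
apply: le_trans (ler_normD _ _) _; apply: le_trans (lerD (ler_normD _ _) (lexx _)) _.
lra.
Qed.

End approx01.

(** * Uniform limits of probability measures *)

Section uniform_limit_of_probabilities.
Context d (S : measurableType d) (R : realType).
Variables (P_ : nat -> probability S R) (l : set S -> R) (e : nat -> R).
Hypothesis e0 : e @ \oo --> (0 : R).
Hypothesis P_l : forall n A, measurable A -> `|fine (P_ n A) - l A| <= e n.

Lemma cvg_unif_prob A : measurable A -> fine (P_ n A) @[n --> \oo] --> l A.
Proof.
move=> mA; apply/cvgrPdist_le => r r0.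
move/cvgrPdist_le : e0 => /(_ _ r0); apply: filterS => n; rewrite sub0r normrN => en.
by rewrite distrC (le_trans (P_l n mA))// (le_trans (ler_norm _)).
Qed.

Let fin A n : measurable A -> P_ n A \is a fin_num.
Proof. by move=> mA; apply: fin_num_measure. Qed.

Let lE A : measurable A -> l A = limn (fun n => fine (P_ n A)).
Proof. by move=> mA; apply/esym/cvg_lim => //; exact: cvg_unif_prob. Qed.

Let lU A B : measurable A -> measurable B -> A `&` B = set0 -> l (A `|` B) = l A + l B.
Proof.
move=> mA mB AB0; have mAB : measurable (A `|` B) by exact: measurableU.
rewrite (lE mAB); apply/cvg_lim => //.
have -> : (fun n => fine (P_ n (A `|` B))) = (fun n => fine (P_ n A) + fine (P_ n B)).
  by apply/funext => n; rewrite measureU// fineD// fin.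
by apply: cvgD; exact: cvg_unif_prob.
Qed.

Let l0 : l set0 = 0.
Proof. by rewrite (lE measurable0); under eq_fun do rewrite measure0 /=; exact: lim_cst. Qed.

Let l1 : l setT = 1.
Proof. by rewrite (lE measurableT); under eq_fun do rewrite probability_setT /=; exact: lim_cst. Qed.

Let l_ge0 A : measurable A -> 0 <= l A.
Proof.
move=> mA; rewrite (lE mA); apply: limr_ge; first by apply: (cvgP (l A)); exact: cvg_unif_prob.
by apply: nearW => n; exact: fine_ge0.
Qed.

(** [l] is arbitrary off the measurable sets, while a measure must be nonnegative on all sets; hence
    the default value 0. *)
Definition unif_lim (A : set S) : \bar R :=
  (if pselect (measurable A) then l A else 0)%:E.

Lemma unif_limE A : measurable A -> unif_lim A = (l A)%:E.
Proof. by move=> mA; rewrite /unif_lim; case: pselect. Qed.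

Let unif_lim0 : unif_lim set0 = 0%E.
Proof. by rewrite unif_limE// l0. Qed.

Let unif_lim_ge0 A : (0 <= unif_lim A)%E.
Proof. by rewrite /unif_lim lee_fin; case: pselect => // mA; exact: l_ge0. Qed.

(** A three-epsilon argument: the error [e k] is the same for all sets, so one fixed [P_ k],
    continuous along the partial unions, controls [l] along them. *)
Let unif_lim_sigma_additive : semi_sigma_additive unif_lim.
Proof.
move=> F mF tF mU.
pose U n := \big[setU/set0]_(0 <= i < n) F i.
have mUn n : measurable (U n) by exact: bigsetU_measurable.
have sumU (m : set S -> R) n : m set0 = 0 ->
    (forall A B, measurable A -> measurable B -> A `&` B = set0 -> m (A `|` B) = m A + m B) ->
    m (U n) = \sum_(0 <= i < n) m (F i).
  move=> m0 mD; elim: n => [|n IH]; first by rewrite /U !big_geq.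
  rewrite /U !big_nat_recr//= mD ?IH//; first exact: bigsetU_measurable.
  apply/seteqP; split => // s []; rewrite big_mkord -(bigcup_mkord n F) /=.
  move=> [i /= ltin Fi] Fn; move/trivIsetP : tF => /(_ i n Logic.I Logic.I).
  rewrite (ltn_eqF ltin) => /(_ isT) Fin0.
  by have : (F i `&` F n) s by []; rewrite Fin0.
rewrite unif_limE//.
have -> : (fun n => \sum_(0 <= i < n) unif_lim (F i))%E = (fun n => (l (U n))%:E).
  apply/funext => n; rewrite (sumU l)// -sumEFin.
  by apply: eq_bigr => i _; rewrite unif_limE.
apply: cvg_EFin; first by near=> n.
apply/cvgrPdist_le => r r0.
have [k ek] : exists k, e k <= r / 3.
  move/cvgrPdist_le : e0 => /(_ _ (divr_gt0 r0 (ltr0n _ 3))) [k _ /(_ k (leqnn _))].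
  by rewrite /= sub0r normrN => /(le_trans (ler_norm _)); exists k.
have cP : fine (P_ k (U n)) @[n --> \oo] --> fine (P_ k (\bigcup_i F i)).
  have := @measure_semi_sigma_additive _ _ _ (P_ k) F mF tF mU.
  have -> : (fun n => \sum_(0 <= i < n) P_ k (F i))%E = (fun n => P_ k (U n)).
    apply/funext => n; rewrite /U !big_mkord measure_semi_additive_ord_I//.
      exact: sub_trivIset tF.
    by have := mUn n; rewrite /U big_mkord.
  move=> h; have /fine_cvgP[] // : P_ k (U n) @[n --> \oo] --> (fine (P_ k (\bigcup_i F i)))%:E.
  by rewrite fineK// fin.
move/cvgrPdist_le : cP => /(_ _ (divr_gt0 r0 (ltr0n _ 3))); apply: filterS => n hn.
have h1 := le_trans (P_l k mU) ek; have h2 := le_trans (P_l k (mUn n)) ek.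
move: hn h1 h2; set a := l _; set b := l _; set a' := fine _; set b' := fine _ => hn h1 h2.
have -> : a - b = (a - a') + (a' - b') + (b' - b) by ring.
apply: le_trans (ler_normD _ _) _; apply: le_trans (lerD (ler_normD _ _) (lexx _)) _.
rewrite distrC in h1; lra.
Unshelve. all: by end_near. Qed.

HB.instance Definition _ := isMeasure.Build _ _ _ unif_lim
  unif_lim0 unif_lim_ge0 unif_lim_sigma_additive.

Let unif_lim1 : unif_lim setT = 1%E.
Proof. by rewrite unif_limE// l1. Qed.

HB.instance Definition _ := Measure_isProbability.Build _ _ _ unif_lim unif_lim1.

Lemma exists_unif_lim : exists L : probability S R, forall A, measurable A -> L A = (l A)%:E.
Proof. by exists (unif_lim : probability S R) => A mA; exact: unif_limE. Qed.

End uniform_limit_of_probabilities.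

Section distribution_restr.
Context d d' (S : measurableType d) (X : measurableType d') (R : realType).
Variables (mu : {measure set S -> \bar R}) (D : set S) (mD : measurable D) (f : {mfun S >-> X}).

Definition distribution_restr := pushforward (mrestr mu mD) f.

Let distribution_restr0 : distribution_restr set0 = 0%E.
Proof. exact: measure0. Qed.

Let distribution_restr_ge0 A : (0 <= distribution_restr A)%E.
Proof. exact: measure_ge0. Qed.

Let distribution_restr_sigma_additive : semi_sigma_additive distribution_restr.
Proof. exact: measure_semi_sigma_additive. Qed.

HB.instance Definition _ := isMeasure.Build _ _ _ distribution_restr
  distribution_restr0 distribution_restr_ge0 distribution_restr_sigma_additive.

Lemma distribution_restrE A : distribution_restr A = mu (D `&` f @^-1` A).
Proof. by rewrite /distribution_restr /pushforward /mrestr setIC. Qed.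

Lemma integral_distribution_restr (u : X -> \bar R) :
  measurable_fun setT u -> (forall y, 0 <= u y)%E ->
  (\int[distribution_restr]_y u y = \int[mu]_(s in D) u (f s))%E.
Proof.
move=> mu_ u0.
have mf (g : X -> \bar R) : measurable_fun setT g -> measurable_fun D (g \o f).
  by move=> mg; apply: (@measurable_funS _ _ _ _ setT) => //; exact: measurableT_comp.
pose Pr u := (\int[distribution_restr]_y u y = \int[mu]_(s in D) u (f s))%E.
apply: (@nonneg_measurable_ind _ X R Pr) => //; rewrite /Pr.
- move=> C mC; rewrite integral_indic// setIT [LHS](distribution_restrE C).
  rewrite [RHS](@integral_indic _ _ _ mu _ mD (f @^-1` C)) 1?setIC//.
  exact: measurable_sfunP.
- move=> c g c0 g0 mg IH; rewrite [LHS](@ge0_integralZl _ _ _ distribution_restr _ measurableT _ mg)//.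
  rewrite [RHS](@ge0_integralZl _ _ _ mu _ mD (fun s => g (f s)))//; last exact: mf.
  by congr (_ * _)%E.
- move=> g h g0 mg h0 mh IHg IHh; rewrite [LHS](@ge0_integralD _ _ _ distribution_restr _ measurableT)//.
  rewrite [RHS](@ge0_integralD _ _ _ mu _ mD (fun s => g (f s)) (fun s => h (f s)))//; [|exact: mf..].
  by congr (_ + _)%E.
- move=> F F0 mF ndF IH.
  rewrite [LHS](@monotone_convergence _ _ _ distribution_restr _ measurableT F)//.
  rewrite [RHS](@monotone_convergence _ _ _ mu _ mD (fun k s => F k (f s)))//.
  + by congr (limn _); apply/funext => k; exact: IH.
  + by move=> k; exact: mf.
Qed.

Lemma integral_distribution_restr_signed (u : X -> \bar R) : measurable_fun setT u ->
  (\int[distribution_restr]_y u y = \int[mu]_(s in D) u (f s))%E.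
Proof.
move=> mu_; rewrite [LHS]integralE [RHS]integralE; congr (_ - _)%E.
  apply: (etrans (integral_distribution_restr (measurable_funepos mu_) (funepos_ge0 u))).
  by apply: eq_integral => s _; rewrite !funeposE.
apply: (etrans (integral_distribution_restr (measurable_funeneg mu_) (funeneg_ge0 u))).
by apply: eq_integral => s _; rewrite !funenegE.
Qed.

End distribution_restr.

(** * The stationary law as limit of the shifted laws *)

Section stationary_limit.
Local Open Scope ereal_scope.
Context d (X : measurableType d) (R : realType) (Q : R.-pker X ~> X) (x : X).
Variable mu : probability (path X) R.
Hypothesis mu_rect : forall n As, (forall i, measurable (As i)) ->
  mu (rect As n) = (\1_(As 0%N) x)%:E * fdd_tail Q n (fun i => As i.+1) x.
Variable pi : probability X R.
Variable e : nat -> R.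
Hypothesis e0 : (e @ \oo --> (0 : R))%R.
Hypothesis kiter_pi : forall n C, measurable C -> (`|fine (kiter Q n x C) - fine (pi C)| <= e n)%R.

Lemma kiterE n y C : kiter Q n y C = fdd_fun Q n (fun=> setT) (fun z => (\1_C z)%:E) y.
Proof.
elim: n y => //= n IH y; apply: eq_integral => z _.
by rewrite indicT mul1e IH.
Qed.

Lemma law_coord n C : measurable C -> distribution mu (coord n) C = kiter Q n x C.
Proof.
move=> mC; rewrite kiterE.
have := @integral_rect _ X R Q x mu mu_rect n (fun=> setT) (fun z => (\1_C z)%:E).
rewrite indicT mul1e => <- //; last exact/measurable_EFinP/measurable_indic.
have -> : rect (fun=> setT) n = setT :> set (path X) by apply/seteqP; split.
rewrite [RHS](@integral_indic _ _ _ mu _ measurableT (coord n @^-1` C)) ?setIT//.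
by rewrite -[_ @^-1` _]setTI; exact: measurable_coord.
Qed.

(* L is the law of the chain started from pi *)
Lemma exists_stationary : exists L : probability (path X) R, exists2 K : nat -> R,
  K @ \oo --> (0 : R)%R &
  forall n A, measurable A -> (`|fine (distribution mu (shift n) A) - fine (L A)| <= K n)%R.
Proof.
have /choice[u uP] (A : set (path X)) : exists u, measurable A -> cond_prob mu A u.
  have [mA|nA] := pselect (measurable A); last by exists (cst 0).
  by have [u] := exists_cond_prob mu_rect mA; exists u.
pose l A := fine (\int[pi]_y u A y).
(* The same [u A] serves all times, so the shifted probability of [A] is its integral against the
   law of the n-th coordinate; the distance to its integral against [pi] is at most [e n] whatever
   [A] is. *)
have H n A : measurable A -> (`|fine (distribution mu (shift n) A) - l A| <= e n)%R.
  move=> mA; have [mu_ u01 uE] := uP A mA.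
  have -> : distribution mu (shift n) A = \int[distribution mu (coord n)]_y u A y.
    rewrite ge0_integral_distribution//; last by move=> y; have /andP[] := u01 y.
    have := uE n (fun=> setT) (fun=> measurableT).
    have -> : rect (fun=> setT) n = setT :> set (path X) by apply/seteqP; split.
    by rewrite setTI.
  apply: integral01_dist => //.
  - exact: probability_le1.
  - exact: probability_le1.
  by move=> C mC; have /= := law_coord n mC => ->; exact: kiter_pi.
have [L LE] := exists_unif_lim e0 H.
exists L, e => // n A mA; rewrite LE//; exact: H.
Qed.

End stationary_limit.

(** * Strong law of large numbers *)

Section zero_one.
Local Open Scope ereal_scope.
Context d (X : measurableType d) (R : realType) (Q : R.-pker X ~> X) (x : X).
Variable mu : probability (path X) R.
Hypothesis mu_rect : forall n As, (forall i, measurable (As i)) ->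
  mu (rect As n) = (\1_(As 0%N) x)%:E * fdd_tail Q n (fun i => As i.+1) x.
Variable pi : probability X R.
Hypothesis kiter_cvg : forall y C, measurable C ->
  fine (kiter Q n y C) @[n --> \oo] --> fine (pi C).

Lemma measurable_kiter n C : measurable C -> measurable_fun setT (fun y => kiter Q n y C).
Proof.
move=> mC; under eq_fun do rewrite kiterE.
by apply: measurable_fun_fdd => //; exact/measurable_EFinP/measurable_indic.
Qed.

Lemma kiter_ge0 n y C : 0 <= kiter Q n y C.
Proof. by rewrite kiterE; apply: fdd_fun_ge0 => z; rewrite lee_fin. Qed.

Lemma kiter_le1 n y C : measurable C -> kiter Q n y C <= 1.
Proof.
move=> mC; elim: n y => /= [|n IH] y.
  by rewrite lee_fin indicE; case: (_ \in _).
apply: (@le_trans _ _ (\int[Q y]_z 1)); last by rewrite integral_cst// mul1e prob_kernel.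
apply: ge0_le_integral => //; first by move=> z _; exact: kiter_ge0.
exact: measurable_kiter.
Qed.

Lemma kiter_fin n y C : measurable C -> kiter Q n y C \is a fin_num.
Proof.
by move=> mC; rewrite ge0_fin_numE ?kiter_ge0// (le_lt_trans (kiter_le1 _ _ mC))// ltry.
Qed.

Lemma integral_rect_kiter n m As C : (forall i, measurable (As i)) -> measurable C ->
  mu (rect As n `&` coord (n + m) @^-1` C) = \int[mu]_(s in rect As n) kiter Q m (s n) C.
Proof.
move=> mA mC; elim: m n As mA => [|m IH] n As mA /=.
  have mr := measurable_rect n mA.
  rewrite addn0 [RHS](@integral_indic _ _ _ mu _ mr (coord n @^-1` C)) 1?setIC//.
  by rewrite -[_ @^-1` _]setTI; exact: measurable_coord.
rewrite -(@integral_rect_step _ X R Q x mu mu_rect n As (fun z => kiter Q m z C))//; last 2 first.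
- by move=> z; exact: kiter_ge0.
- exact: measurable_kiter.
pose As' i := if (i <= n)%N then As i else setT.
have -> : rect As n = rect As' n.+1.
  apply/seteqP; rewrite /As'; split => s /= H i.
    by move=> _; case: ifP => // /H.
  by move=> le_i; have := H i (leqW le_i); rewrite le_i.
by rewrite addnS -addSn IH// => i; rewrite /As'; case: ifP.
Qed.

(** Given the past up to time n, the conditional probability of an invariant event may be computed
    at any later time n + m, as [u] at the state reached there. As m grows the past is forgotten, so
    the event is independent of every rectangle, hence of itself. *)
Lemma zero_one (A : set (path X)) : measurable A -> shift 1 @^-1` A = A ->
  mu A = 0 \/ mu A = 1.
Proof.
move=> mA invA; have [u [mu_ u01 uE]] := exists_cond_prob mu_rect mA.
have invAn n : shift n @^-1` A = A.
  elim: n => [|n IH]; first by apply/seteqP; split.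
  rewrite -[in RHS]invA -[in RHS]IH; apply/seteqP; split => s /=; by rewrite shiftD add1n.
pose c := fine (\int[pi]_y u y).
have indep n As : (forall i, measurable (As i)) ->
    fine (mu (rect As n `&` A)) = (fine (mu (rect As n)) * c)%R.
  move=> mAs; have mr := measurable_rect n mAs.
  pose nu m := distribution_restr mu mr (coord (n + m)).
  have nuE m C : nu m C = mu (rect As n `&` coord (n + m) @^-1` C).
    by rewrite /nu /= setIC.
  have c0 : (0 <= fine (mu (rect As n)))%R by exact: fine_ge0.
  pose nu' := mscale (NngNum c0) pi.
  have nu_u m : fine (mu (rect As n `&` A)) = fine (\int[nu m]_y u y).
    rewrite -(invAn (n + m)%N).
    pose As' i := if (i <= n)%N then As i else setT.
    have rE : rect As n = rect As' (n + m).
      rewrite /As'; apply/seteqP; split => s H i le_i.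
        by case: ifP => // /H.
      by have := H i (leq_trans le_i (leq_addr _ _)); rewrite le_i.
    rewrite [in LHS]rE uE -?rE; last by move=> i; rewrite /As'; case: ifP.
    by rewrite integral_distribution_restr// => y; have /andP[] := u01 y.
  (* On the event [rect As n] the law of the coordinate n + m converges setwise to the mass of the
     event times [pi], by dominated convergence of the iterated kernels. *)
  have cv : fine (\int[nu m]_y u y) @[m --> \oo] --> fine (\int[nu']_y u y).
    apply: cvg_integral01 => //.
    - by move=> m; rewrite [leLHS](nuE m setT) preimage_setT setIT; exact: probability_le1.
    - rewrite /nu' /= /mscale /= probability_setT mule1 fineK ?fin_num_measure//.
      exact: probability_le1.
    move=> C mC.
    have -> : fine (nu' C) = fine (fine (mu (rect As n)) * fine (pi C))%:E.
      by rewrite /nu' /= /mscale /= -[in LHS](fineK (fin_num_measure pi C mC)) -EFinM.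
    apply: fine_cvg.
    have -> : (fun m => nu m C) = (fun m => \int[mu]_(s in rect As n) kiter Q m (s n) C).
      by apply/funext => m; rewrite nuE integral_rect_kiter.
    have -> : (fine (mu (rect As n)) * fine (pi C))%:E = \int[mu]_(s in rect As n) (fine (pi C))%:E.
      by rewrite integral_cst// EFinM muleC (fineK (fin_num_measure mu _ mr)).
    apply: (@dominated_cvg _ _ _ mu _ mr _ _ (cst 1)) => //.
    - move=> m; apply: (@measurable_funS _ _ _ _ setT) => //.
      exact: (measurableT_comp (measurable_kiter m mC) (measurable_coord n)).
    - move=> s _; apply/fine_cvgP; split; last exact: kiter_cvg.
      by apply: nearW => m; exact: kiter_fin.
    - exact: finite_measure_integrable_cst.
    - by move=> m s _; rewrite gee0_abs ?kiter_ge0// kiter_le1.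
  have {}cv : fine (mu (rect As n `&` A)) = fine (\int[nu']_y u y).
    have E : (fun m => fine (\int[nu m]_y u y)) = fun=> fine (mu (rect As n `&` A)).
      by apply/funext => m; rewrite -nu_u.
    by rewrite E in cv; rewrite -(cvg_lim _ cv)// lim_cst.
  rewrite cv ge0_integral_mscale//; last by move=> y _; have /andP[] := u01 y.
  rewrite fineM// integral01_fin//; exact: probability_le1.
have cE : c = fine (mu A).
  have := indep 0%N (fun=> setT) (fun=> measurableT).
  have -> : rect (fun=> setT) 0 = setT :> set (path X) by apply/seteqP; split.
  by rewrite setTI probability_setT mul1r.
have A0 : (0 <= fine (mu A))%R by exact: fine_ge0.
have AA : mu (A `&` A) = (fine (mu A))%:E * mu A.
  apply: (@measure_unique _ R (path X) (@rects _ X) (fun=> setT) _ _ _ _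
    (mrestr mu mA) (mscale (NngNum A0) mu)) => //.
  - exact: rects_setI.
  - move=> _; exact: rects_setT.
  - by rewrite bigcup_const.
  - move=> _ [n [As [mAs ->]]]; have mr := measurable_rect n mAs.
    rewrite /= /mrestr /mscale /=.
    rewrite -[LHS]fineK; last by apply: fin_num_measure; exact: measurableI.
    by rewrite indep// cE mulrC EFinM; congr (_ * _); rewrite fineK// fin_num_measure.
  - by move=> _; rewrite /= /mrestr setTI (le_lt_trans (probability_le1 _ _)) ?ltry.
move: AA; rewrite setIid -[mu A]fineK ?fin_num_measure// -EFinM => -[].
set a := fine _ => aa; have : (a * (1 - a) = 0)%R by rewrite mulrBr mulr1 {1}aa subrr.
move/eqP; rewrite mulf_eq0 subr_eq0 => /orP[/eqP ->|/eqP <-]; [by left|by right].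
Qed.

End zero_one.

(** * Maximal inequality and convergence of averages *)

Section strong_law.
Context d (X : measurableType d) (R : realType).
Variables (mu L : probability (path X) R).
Hypothesis zero_one_mu : forall A : set (path X), measurable A -> shift 1 @^-1` A = A ->
  mu A = 0%E \/ mu A = 1%E.
Hypothesis mu_L : forall A : set (path X), measurable A -> shift 1 @^-1` A = A -> mu A = L A.
Hypothesis L_inv : forall A : set (path X), measurable A -> L (shift 1 @^-1` A) = L A.
Local Notation theta := (@shift _ X 1).

Section birkhoff_sums.
Variable F : path X -> R.
Hypothesis mF : measurable_fun setT F.
Hypothesis iF : L.-integrable setT (EFin \o F).

Definition bsum (n : nat) (s : path X) : R := \sum_(t < n) F (shift t s).

Lemma bsumS n s : bsum n.+1 s = F s + bsum n (theta s).
Proof.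
by rewrite /bsum big_ord_recl.
Qed.

(** The maximum of 0 and the Birkhoff sums of lengths 1 to n. *)
Fixpoint bmax (n : nat) (s : path X) : R :=
  if n is n'.+1 then Num.max 0 (F s + bmax n' (theta s)) else 0.

Lemma bmax_ge0 n s : 0 <= bmax n s.
Proof. by case: n => //= n; rewrite le_max lexx. Qed.

Lemma bmax_le n s : bmax n s <= bmax n.+1 s.
Proof.
elim: n s => [|n IH] s; first exact: bmax_ge0.
by rewrite [bmax n.+1 s]/= [bmax n.+2 s]/= ge_max !le_max lexx /= lerD2l IH orbT.
Qed.

Lemma bsum_le_bmax n s : bsum n s <= bmax n s.
Proof.
elim: n s => [|n IH] s; first by rewrite /bsum big_ord0.
by rewrite bsumS /= le_max lerD2l IH orbT.
Qed.

Lemma measurable_bsum n : measurable_fun setT (bsum n).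
Proof.
by apply: measurable_sum => i; exact: (measurableT_comp mF (measurable_shift i)).
Qed.

Lemma measurable_bmax n : measurable_fun setT (bmax n).
Proof.
elim: n => [|n IH]; first exact: measurable_cst.
apply: measurable_maxr => //; apply: measurable_funD => //.
exact: (measurableT_comp IH (measurable_shift 1)).
Qed.

Lemma integrable_theta (G : path X -> R) : measurable_fun setT G ->
  L.-integrable setT (EFin \o G) -> L.-integrable setT (EFin \o G \o theta).
Proof.
move=> mG iG; apply/integrableP; split.
  by apply: measurableT_comp (measurable_shift 1); exact/measurable_EFinP.
have /integrableP[_] := iG; apply: le_lt_trans.
have -> : (\int[L]_s `|(EFin \o G) s| = \int[distribution L theta]_s `|(EFin \o G) s|)%E.
  by apply: eq_measure_integral => A mA _; rewrite /= /distribution /pushforward /= L_inv.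
rewrite ge0_integral_distribution//.
by apply: measurableT_comp => //; exact/measurable_EFinP.
Qed.

Lemma integral_theta (G : path X -> R) : measurable_fun setT G ->
  L.-integrable setT (EFin \o G) -> (\int[L]_s (G (theta s))%:E = \int[L]_s (G s)%:E)%E.
Proof.
move=> mG iG.
have -> : (\int[L]_s (G s)%:E = \int[distribution L theta]_s (G s)%:E)%E.
  by apply: eq_measure_integral => A mA _; rewrite /= /distribution /pushforward /= L_inv.
rewrite (@integral_distribution _ _ _ _ _ L theta (EFin \o G))//.
  exact/measurable_EFinP.
exact: (integrable_theta mG iG).
Qed.

Lemma integrable_bmax n : L.-integrable setT (EFin \o bmax n).
Proof.
elim: n => [|n IH]; first exact: integrable0.
have h := integrable_theta (measurable_bmax n) IH.
apply: le_integrable (integrableD measurableT (integrable_abse iF) h) => //.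
  by apply/measurable_EFinP; exact: (measurable_bmax n.+1).
move=> s _ /=; rewrite lee_fin ger0_norm; last by rewrite le_max lexx.
have M0 := bmax_ge0 n (theta s).
rewrite (ger0_norm (addr_ge0 (normr_ge0 _) M0)) ge_max addr_ge0//= lerD2r.
exact: ler_norm.
Qed.

(** Dropping the first term of the sums changes each of them by the finite amount F s, so this event
    is shift invariant and the zero-one law applies to it. *)
Definition unbounded : set (path X) := [set s | forall K : nat, exists n, K%:R < bsum n s].

Lemma measurable_unbounded : measurable unbounded.
Proof.
rewrite (_ : unbounded = \bigcap_K \bigcup_n [set s | K%:R < bsum n s]).
  apply: bigcapT_measurable => K; apply: bigcupT_measurable => n.
  rewrite (_ : [set _ | _] = bsum n @^-1` `]K%:R, +oo[).
    by rewrite -[_ @^-1` _]setTI; exact: measurable_bsum.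
  by apply/seteqP; split => s /=; rewrite in_itv /= andbT.
apply/seteqP; split => s H; first by move=> K _; have [n] := H K; exists n.
by move=> K; have [n _] := H K Logic.I; exists n.
Qed.

Lemma unbounded_inv : theta @^-1` unbounded = unbounded.
Proof.
apply/seteqP; split => s /= H K.
  have [n] := H (K + Num.truncn `|F s|).+1; exists n.+1; rewrite bsumS.
  have := truncnS_gt `|F s|; have := ler_norm (- F s); rewrite normrN.
  move: p; rewrite -addnS natrD; lra.
have [n] := H (K + Num.truncn `|F s|).+1; case: n => [|n].
  by rewrite /bsum big_ord0 ltNge ler0n.
exists n; move: p; rewrite bsumS.
have := truncnS_gt `|F s|; have := ler_norm (F s).
rewrite -addnS natrD; lra.
Qed.

(* Garsia's maximal ergodic argument *)
Lemma not_unbounded : (\int[L]_s (F s)%:E < 0)%E -> mu unbounded = 0%E.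
Proof.
move=> F0; have [//|mu1] := zero_one_mu measurable_unbounded unbounded_inv.
have L1 : L unbounded = 1%E.
  by rewrite -mu_L//; [exact: measurable_unbounded|exact: unbounded_inv].
(* [D n] has nonnegative integral, since [bmax] increases with n and [L] is shift invariant; where
   the sums are unbounded above it equals [F] from some n on. If that event has probability 1,
   dominated convergence with bound |F| makes the integral of [F] nonnegative, a contradiction. *)
pose D n s := Num.max (- bmax n (theta s)) (F s).
have DE n s : D n s = bmax n.+1 s - bmax n (theta s).
  by rewrite /D /= addr_maxl add0r addrK.
have mD n : measurable_fun setT (D n).
  apply: measurable_maxr => //; apply: measurableT_comp => //.
  exact: (measurableT_comp (measurable_bmax n) (measurable_shift 1)).
have D_ge0 n : (0 <= \int[L]_s (D n s)%:E)%E.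
  have -> : (\int[L]_s (D n s)%:E =
      \int[L]_s ((EFin \o bmax n.+1) \- (EFin \o bmax n \o theta)) s)%E.
    by apply: eq_integral => s _; rewrite DE.
  rewrite integralB//; last 2 first.
  - exact: integrable_bmax.
  - exact: integrable_theta (measurable_bmax n) (integrable_bmax n).
  rewrite [X in (_ - X)%E](integral_theta (measurable_bmax n) (integrable_bmax n)).
  have fin := integrable_fin_num measurableT (integrable_bmax n).
  rewrite sube_ge0; last by rewrite fin.
  apply: ge0_le_integral => //.
  - by move=> s _; rewrite lee_fin bmax_ge0.
  - by apply/measurable_EFinP; exact: measurable_bmax.
  - by apply/measurable_EFinP; exact: (measurable_bmax n.+1).
  - by move=> s _; rewrite lee_fin bmax_le.
have [_ _ cv] : [/\ L.-integrable setT (EFin \o F),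
   [sequence (\int[L]_s `|(D n s)%:E - (F s)%:E|)%E]_n @ \oo --> (0 : \bar R)%E &
   [sequence (\int[L]_s (D n s)%:E)%E]_n @ \oo --> (\int[L]_s (F s)%:E)%E].
  apply: (@dominated_convergence _ _ _ L setT measurableT _ _ (fun s => `|F s|%:E)) => //.
  - by move=> n; exact/measurable_EFinP.
  - exact/measurable_EFinP.
  - exists (~` unbounded); split.
    + exact: measurableC measurable_unbounded.
    + by apply: (etrans (probability_setC L measurable_unbounded)); rewrite L1 subee.
    + apply: subsetC => s us _.
      apply: cvg_EFin; first by near=> n.
      apply: (@cvg_trans _ ((fun=> F s) @ \oo)); last exact: cvg_cst.
      apply: near_eq_cvg; have : unbounded (theta s) by rewrite -unbounded_inv in us.
      move=> /(_ (Num.truncn `|F s|).+1)[k hk]; exists k => // n /= kn.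
      rewrite /D; apply/esym/max_idPr.
      have : bmax k (theta s) <= bmax n (theta s).
        by apply: (homo_leq (f := bmax^~ (theta s)) (r := fun a b => a <= b)) => //;
          [exact: le_trans|move=> i; exact: bmax_le].
      have := bsum_le_bmax k (theta s); have := truncnS_gt `|F s|.
      have := ler_norm (- F s); rewrite normrN; move: hk; lra.
  - exact: integrable_abse iF.
  - apply: aeW => s n _; rewrite abse_EFin lee_fin /D.
    have M0 := bmax_ge0 n (theta s).
    have [F0'|F0'] := leP 0 (F s).
      by rewrite max_r ?(ger0_norm F0')// (le_trans _ F0')// oppr_le0.
    rewrite (ltr0_norm F0') ler0_norm ?lerN2 ?le_max ?lexx ?orbT//.
    by rewrite ge_max oppr_le0 M0 ltW.
suff : (0 <= \int[L]_s (F s)%:E)%E by rewrite leNgt F0.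
rewrite -(cvg_lim _ cv)//; apply: lime_ge; first by apply/cvg_ex; eexists; exact: cv.
by apply: nearW.
Unshelve. all: by end_near. Qed.

End birkhoff_sums.

Lemma bsum_bounded_above (F : path X -> R) (c : R) : measurable_fun setT F ->
  L.-integrable setT (EFin \o F) -> (\int[L]_s (F s)%:E < c%:E)%E ->
  {ae mu, forall s, exists K : nat, forall n, bsum F n s <= K%:R + n%:R * c}.
Proof.
move=> mF iF Fc; pose G s := F s - c.
have mG : measurable_fun setT G by exact: measurable_funB.
have iG : L.-integrable setT (EFin \o G).
  have -> : EFin \o G = ((EFin \o F) \- cst c%:E)%E by [].
  by apply: integrableB => //; exact: finite_measure_integrable_cst.
have G0 : (\int[L]_s (G s)%:E < 0)%E.
  have -> : (\int[L]_s (G s)%:E = \int[L]_s ((EFin \o F) \- cst c%:E)%E s)%E by [].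
  rewrite integralB//; last exact: finite_measure_integrable_cst.
  have -> : (\int[L]_s cst c%:E s = c%:E)%E.
    transitivity (c%:E * L setT)%E; first exact: integral_cst.
    by rewrite -[RHS]mule1; congr (_ * _)%E; exact: probability_setT.
  by rewrite lteBlDr// add0e.
have U0 := not_unbounded mG iG G0.
exists (unbounded G); split => //; first exact: measurable_unbounded.
move=> s /= nb K; apply: contra_notP nb => /forallNP H.
exists K => n; have := H n => /negP; rewrite -leNgt.
by rewrite /bsum /G sumrB sumr_const card_ord mulr_natl lerBlDr.
Qed.

(** Centring F and -F with slack 1/(j+1) bounds the sums on both sides up to a random constant,
    which disappears after division by M; the countably many j share one null set. Convergence holds
    under [mu], whereas integrability and invariance are those of [L]. *)
Theorem strong_law (F : path X -> R) : measurable_fun setT F ->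
  L.-integrable setT (EFin \o F) ->
  {ae mu, forall s, M%:R^-1 * \sum_(t < M) F (shift t s) @[M --> \oo] -->
    Rintegral L setT F}.
Proof.
move=> mF iF; set m := Rintegral _ _ _.
have mE : (\int[L]_s (F s)%:E = m%:E)%E.
  by rewrite fineK//; exact: (integrable_fin_num measurableT iF).
pose up j s := exists K : nat, forall n, bsum F n s <= K%:R + n%:R * (m + j.+1%:R^-1).
pose dn j s := exists K : nat, forall n, bsum (fun s => - F s) n s <= K%:R + n%:R * (- m + j.+1%:R^-1).
have aeup j : {ae mu, forall s, up j s}.
  by apply: bsum_bounded_above => //; rewrite mE lte_fin ltrDl invr_gt0.
have aedn j : {ae mu, forall s, dn j s}.
  apply: bsum_bounded_above => //.
  - exact: measurableT_comp.
  - exact: (integrableN iF).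
  under eq_integral do rewrite -mulN1r EFinM.
  by rewrite integralZl// mE -EFinM lte_fin mulN1r ltrDl invr_gt0.
have : {ae mu, forall s, (forall j, up j s) /\ (forall j, dn j s)}.
  have := ae_foralln aeup; have := ae_foralln aedn.
  by apply: filterS2 => s ? ?; split.
apply: filterS => s [ups dns].
apply/cvgrPdist_le => r r0.
pose j := Num.truncn (r / 2)^-1.
have jr : j.+1%:R^-1 <= r / 2.
  by rewrite invf_ple ?posrE ?divr_gt0//; exact/ltW/truncnS_gt.
have [K1 hK1] := ups j; have [K2 hK2] := dns j.
exists (Num.truncn ((K1 + K2)%:R / (r / 2))).+1 => // n /= hn.
have n0 : 0 < n%:R :> R by rewrite ltr0n (leq_ltn_trans _ hn).
have Kn : K1%:R + K2%:R <= n%:R * (r / 2).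
  rewrite -ler_pdivrMr ?divr_gt0// -natrD.
  by apply/ltW/(lt_le_trans (truncnS_gt _)); rewrite ler_nat.
have jn : n%:R * j.+1%:R^-1 <= n%:R * (r / 2) by rewrite ler_pM2l.
have h1 := hK1 n; have h2 := hK2 n; move: h1 h2.
have -> : bsum (fun s => - F s) n s = - bsum F n s by rewrite /bsum sumrN.
rewrite -/(bsum F n s); set S := bsum F n s; rewrite !mulrDr mulrN => h1 h2.
have K1_0 : 0 <= K1%:R :> R by rewrite ler0n.
have K2_0 : 0 <= K2%:R :> R by rewrite ler0n.
have rr : n%:R * r = n%:R * (r / 2) + n%:R * (r / 2) by rewrite -mulrDr -splitr.
have -> : m - n%:R^-1 * S = n%:R^-1 * (n%:R * m - S).
  by rewrite mulrBr mulKf// gt_eqF.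
rewrite normrM gtr0_norm ?invr_gt0// ler_pdivrMl// ler_norml rr.
move: Kn jn h1 h2 K1_0 K2_0.
move: (n%:R * m) (n%:R / j.+1%:R) (n%:R * (r / 2)) (K1%:R : R) (K2%:R : R) S.
by move=> a b c k1 k2 S' *; apply/andP; split; lra.
Qed.

End strong_law.

(** * The transition operator on L2(pi) *)

Section L2.
Context d (X : measurableType d) (R : realType) (pi : {measure set X -> \bar R}).
Hypothesis pi1 : pi setT = 1%E.

Definition L2 (f : X -> R) :=
  measurable_fun setT f /\ pi.-integrable setT (fun x => ((f x) ^+ 2)%:E).

Lemma L2M f g : L2 f -> L2 g -> pi.-integrable setT (EFin \o (fun x => f x * g x)).
Proof.
move=> [mf f2] [mg g2].
apply: le_integrable (integrableD measurableT f2 g2) => //.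
  by apply/measurable_EFinP; exact: measurable_funM.
move=> x _ /=; rewrite lee_fin (ger0_norm (addr_ge0 (sqr_ge0 _) (sqr_ge0 _))) normrM.
rewrite -[f x ^+ 2]real_normK ?num_real// -[g x ^+ 2]real_normK ?num_real//.
have := sqr_ge0 (`|f x| - `|g x|); rewrite sqrrB.
have := mulr_ge0 (normr_ge0 (f x)) (normr_ge0 (g x)); nra.
Qed.

Lemma integrable_cst1 (c : R) : pi.-integrable setT (EFin \o cst c).
Proof.
apply/integrableP; split; first exact: (@measurable_cst _ _ _ _ setT (c%:E)).
by rewrite [ltLHS](@integral_cst _ _ _ pi _ measurableT `|c|%:E) pi1 mule1 ltry.
Qed.

Lemma L2_cst c : L2 (cst c).
Proof. by split; [exact: measurable_cst|exact: (integrable_cst1 (c ^+ 2))]. Qed.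

Lemma L2_integrable f : L2 f -> pi.-integrable setT (EFin \o f).
Proof.
move=> Lf; have := L2M Lf (L2_cst 1).
by apply: eq_integrable => // x _ /=; rewrite mulr1.
Qed.

Lemma L2Z c f : L2 f -> L2 (fun x => c * f x).
Proof.
move=> [mf f2]; split; first exact: measurable_funM.
apply: eq_integrable (integrableZl measurableT (c ^+ 2) f2) => // x _ /=.
by rewrite -EFinM exprMn.
Qed.

Lemma L2D f g : L2 f -> L2 g -> L2 (fun x => f x + g x).
Proof.
move=> Lf Lg; have [mf f2] := Lf; have [mg g2] := Lg.
split; first exact: measurable_funD.
have := integrableD measurableT (integrableD measurableT f2 g2)
          (integrableZl measurableT 2 (L2M Lf Lg)).
apply: eq_integrable => // x _ /=; rewrite -EFinM -!EFinD sqrrD; congr _%:E; ring.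
Qed.

Lemma L2N f : L2 f -> L2 (fun x => - f x).
Proof.
by move=> /(L2Z (-1)); congr L2; apply/funext => x; rewrite mulN1r.
Qed.

Lemma L2B f g : L2 f -> L2 g -> L2 (fun x => f x - g x).
Proof. by move=> Lf Lg; apply: L2D => //; exact: L2N. Qed.

Lemma L2_sum I (s : seq I) (F : I -> X -> R) : (forall i, L2 (F i)) ->
  L2 (fun x => \sum_(i <- s) F i x).
Proof.
move=> LF; elim: s => [|i s IH].
  by under eq_fun do rewrite big_nil; exact: L2_cst.
by under eq_fun do rewrite big_cons; exact: L2D.
Qed.

Lemma L2_le (f g : X -> R) : measurable_fun setT f -> L2 g -> (forall x, `|f x| <= `|g x|) -> L2 f.
Proof.
move=> mf [mg g2] fg; split => //; apply: le_integrable g2 => //.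
  by apply/measurable_EFinP; exact: measurable_funX.
by move=> x _; rewrite lee_fin !normrX; apply: lerXn2r => //; rewrite nnegrE.
Qed.

Lemma L2_pos f : L2 f -> L2 (f^\+)%R.
Proof.
move=> Lf; apply: (L2_le _ Lf); first by apply: measurable_funrpos; case: Lf.
move=> x; rewrite /funrpos ger0_norm ?le_max ?lexx ?orbT//.
by rewrite ge_max ler_norm normr_ge0.
Qed.

Lemma L2_neg f : L2 f -> L2 (f^\-)%R.
Proof.
move=> Lf; apply: (L2_le _ Lf); first by apply: measurable_funrneg; case: Lf.
move=> x; rewrite /funrneg ger0_norm ?le_max ?lexx ?orbT//.
by rewrite ge_max normr_ge0 -normrN ler_norm.
Qed.

Lemma sqr_Rintegral_le f : L2 f ->
  (Rintegral pi setT f) ^+ 2 <= Rintegral pi setT (fun x => f x ^+ 2).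
Proof.
move=> Lf; have [mf f2] := Lf; have f1 := L2_integrable Lf.
set c := Rintegral pi setT f.
have : 0 <= Rintegral pi setT (fun x => f x ^+ 2 - (2 * c * f x - c ^+ 2)).
  apply: Rintegral_ge0 => x _.
  have -> : f x ^+ 2 - (2 * c * f x - c ^+ 2) = (f x - c) ^+ 2 by rewrite sqrrB; ring.
  exact: sqr_ge0.
have ic : pi.-integrable setT (EFin \o cst (c ^+ 2)) by exact: integrable_cst1.
have ifc : pi.-integrable setT (EFin \o (fun x => 2 * c * f x)).
  by apply: eq_integrable (integrableZl measurableT (2 * c) f1).
have ifcc : pi.-integrable setT (EFin \o (fun x => 2 * c * f x - c ^+ 2)).
  by apply: eq_integrable (integrableB measurableT ifc ic).
rewrite RintegralB// RintegralB// RintegralZl// Rintegral_cst// pi1 /= -/c.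
by rewrite mulr1 subr_ge0; apply: le_trans; rewrite expr2; lra.
Qed.

End L2.

Section transition_operator.
Context d (X : measurableType d) (R : realType) (Q : R.-pker X ~> X).
Variable pi : probability X R.
Hypothesis pi_inv : forall C, measurable C -> pi C = (\int[pi]_y Q y C)%E.
Local Notation L2pi := (L2 pi).

Definition Qop (g : X -> R) (y : X) : R := Rintegral (Q y) setT g.

(** Two measures are allowed because this serves both the invariance of [pi] and the laws of two
    successive states on an event of the past. *)
Lemma integral_kernel (nu1 nu2 : {measure set X -> \bar R}) (psi : X -> \bar R) :
  (forall C, measurable C -> nu1 C = (\int[nu2]_y Q y C)%E) ->
  (forall y, 0 <= psi y)%E -> measurable_fun setT psi ->
  (\int[nu1]_y psi y = \int[nu2]_y \int[Q y]_z psi z)%E.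
Proof.
move=> H p0 mp.
have mker (phi : X -> \bar R) : (forall y, 0 <= phi y)%E -> measurable_fun setT phi ->
    measurable_fun setT (fun y => \int[Q y]_z phi z)%E.
  by move=> ? ?; apply: measurable_fun_integral_kernel => //; exact: measurable_kernel.
have ker0 (phi : X -> \bar R) y : (forall y, 0 <= phi y)%E -> (0 <= \int[Q y]_z phi z)%E.
  by move=> ?; exact: integral_ge0.
pose Pr psi := (\int[nu1]_y psi y = \int[nu2]_y \int[Q y]_z psi z)%E.
apply: (@nonneg_measurable_ind _ X R Pr _ _ _ _ psi p0 mp); rewrite {}/Pr.
- move=> A mA; rewrite integral_indic// setIT H//.
  by apply: eq_integral => y _; rewrite integral_indic// setIT.
- move=> c f c0 f0 mf IH; have c0' : (0 <= c%:E)%E by rewrite lee_fin.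
  rewrite (ge0_integralZl _ measurableT mf (fun y _ => f0 y) c0') IH.
  rewrite -(ge0_integralZl _ measurableT (mker f f0 mf) (fun y _ => ker0 f y f0) c0').
  apply: eq_integral => y _.
  by rewrite (ge0_integralZl _ measurableT mf (fun y _ => f0 y) c0').
- move=> f g f0 mf g0 mg IHf IHg.
  rewrite (ge0_integralD _ measurableT (fun y _ => f0 y) mf (fun y _ => g0 y) mg) IHf IHg.
  rewrite -(ge0_integralD _ measurableT (fun y _ => ker0 f y f0) (mker f f0 mf)
    (fun y _ => ker0 g y g0) (mker g g0 mg)).
  apply: eq_integral => y _.
  by rewrite (ge0_integralD _ measurableT (fun y _ => f0 y) mf (fun y _ => g0 y) mg).
- move=> F F0 mF ndF IH.
  rewrite (monotone_convergence nu1 measurableT mF (fun k y _ => F0 k y) (fun y _ => ndF y)).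
  transitivity (\int[nu2]_y limn (fun k => \int[Q y]_z F k z))%E; last first.
    apply: eq_integral => y _.
    by rewrite (monotone_convergence (Q y) measurableT mF (fun k y _ => F0 k y) (fun y _ => ndF y)).
  rewrite (monotone_convergence nu2 measurableT (fun k => mker (F k) (F0 k) (mF k))
    (fun k y _ => ker0 (F k) y (F0 k))).
  + by congr (limn _); apply/funext => k; exact: IH.
  + by move=> y _ a b ab; apply: ge0_le_integral => // z _; exact: ndF.
Qed.

Lemma measurable_Qop g : measurable_fun setT g -> measurable_fun setT (Qop g).
Proof.
move=> mg; rewrite /Qop /Rintegral; apply: (@measurableT_comp _ _ _ _ _ _ fine) => //.
under eq_fun do rewrite integralE.
have mg' : measurable_fun setT (EFin \o g) by exact/measurable_EFinP.
apply: emeasurable_funB; apply: measurable_fun_integral_kernel => //.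
- exact: measurable_kernel.
- exact: measurable_funepos.
- exact: measurable_kernel.
- exact: measurable_funeneg.
Qed.

(** By invariance the integral of g^2 against [Q y] has a finite [pi]-mean, hence is finite for
    almost every [y]. Elsewhere [Qop g y] may be a mere default value, so linearity of [Qop] is
    available only almost everywhere. *)
Lemma ae_L2_kernel g : L2pi g -> {ae pi, forall y, L2 (Q y) g}.
Proof.
move=> [mg g2].
have m2 : measurable_fun setT (fun z => (g z ^+ 2)%:E).
  by apply/measurable_EFinP; exact: measurable_funX.
have p0 z : (0 <= (g z ^+ 2)%:E)%E by rewrite lee_fin sqr_ge0.
have mQ : measurable_fun setT (fun y => \int[Q y]_z (g z ^+ 2)%:E)%E.
  by apply: measurable_fun_integral_kernel => //; exact: measurable_kernel.
have : pi.-integrable setT (fun y => \int[Q y]_z (g z ^+ 2)%:E)%E.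
  apply/integrableP; split => //.
  under eq_integral do rewrite gee0_abs ?integral_ge0//.
  rewrite -(integral_kernel pi_inv p0 m2); have /integrableP[_] := g2.
  by apply: le_lt_trans; apply: ge0_le_integral => //;
    [exact: measurableT_comp|move=> z _; exact: lee_abs].
move/integrable_ae => /(_ measurableT); apply: filterS => y /(_ Logic.I) fin.
split => //; apply/integrableP; split => //.
by under eq_integral do rewrite gee0_abs//; rewrite ltey_eq fin.
Qed.

Lemma Q1 y : Q y setT = 1%E. Proof. exact: prob_kernel. Qed.

Lemma pi1 : pi setT = 1%E. Proof. exact: probability_setT. Qed.

Lemma Qop_sqr_le g : L2pi g ->
  {ae pi, forall y, ((Qop g y) ^+ 2)%:E <= \int[Q y]_z (g z ^+ 2)%:E}%E.
Proof.
move=> /ae_L2_kernel; apply: filterS => y Ly.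
have := sqr_Rintegral_le (Q1 y) Ly; rewrite -lee_fin => /le_trans; apply.
have [_ i2] := Ly.
by rewrite fineK// (integrable_fin_num measurableT i2).
Qed.

Lemma integral_Qop_sqr_le g : L2pi g ->
  (\int[pi]_y ((Qop g y) ^+ 2)%:E <= \int[pi]_y (g y ^+ 2)%:E)%E.
Proof.
move=> Lg; have [mg g2] := Lg.
have m2 : measurable_fun setT (fun z => (g z ^+ 2)%:E).
  by apply/measurable_EFinP; exact: measurable_funX.
have p0 z : (0 <= (g z ^+ 2)%:E)%E by rewrite lee_fin sqr_ge0.
rewrite (integral_kernel pi_inv p0 m2).
apply: ae_ge0_le_integral => //.
- by move=> y _; rewrite lee_fin sqr_ge0.
- by apply/measurable_EFinP; apply: measurable_funX; exact: measurable_Qop.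
- by move=> y _; exact: integral_ge0.
- by apply: measurable_fun_integral_kernel => //; exact: measurable_kernel.
- by have := Qop_sqr_le Lg; apply: filterS.
Qed.

Lemma L2_Qop g : L2pi g -> L2pi (Qop g).
Proof.
move=> Lg; have [mg g2] := Lg; split; first exact: measurable_Qop.
apply/integrableP; split.
  by apply/measurable_EFinP; apply: measurable_funX; exact: measurable_Qop.
under eq_integral do rewrite gee0_abs ?lee_fin ?sqr_ge0//.
apply: le_lt_trans (integral_Qop_sqr_le Lg) _; have /integrableP[_] := g2.
apply: le_lt_trans; apply: ge0_le_integral => //.
- by move=> y _; rewrite lee_fin sqr_ge0.
- by apply/measurable_EFinP; exact: measurable_funX.
- by apply: measurableT_comp => //; apply/measurable_EFinP; exact: measurable_funX.
- by move=> y _; exact: lee_abs.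
Qed.

Lemma L2_Qpow k g : L2pi g -> L2pi (Qpow Q k g).
Proof. by move=> Lg; elim: k => //= k IH; exact: (L2_Qop IH). Qed.

Lemma QpowSr k g : Qpow Q k.+1 g = Qpow Q k (Qop g).
Proof. by elim: k => //= k IH; apply/funext => y; rewrite -IH. Qed.

Lemma Qop_sum I (s : seq I) (c : I -> R) (F : I -> X -> R) : (forall i, L2pi (F i)) ->
  {ae pi, forall y, Qop (fun x => \sum_(i <- s) c i * F i x) y =
     \sum_(i <- s) c i * Qop (F i) y}.
Proof.
move=> LF; elim: s => [|i s IH].
  apply: aeW => y; rewrite big_nil /Qop.
  under eq_Rintegral do rewrite big_nil.
  by rewrite Rintegral_cst// mul0r.
have h1 := ae_L2_kernel (LF i).
have h2 := ae_L2_kernel (L2_sum pi1 s (fun j => L2Z (c j) (LF j))).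
move: IH; apply: filterS3 h1 h2 => y Li Ls IH; rewrite big_cons -IH /Qop.
under eq_Rintegral do rewrite big_cons.
rewrite RintegralD//; last 2 first.
- exact: (L2_integrable (Q1 y) (L2Z _ Li)).
- exact: (L2_integrable (Q1 y) Ls).
by rewrite RintegralZl//; exact: (L2_integrable (Q1 y) Li).
Qed.

End transition_operator.

(** * Joint laws of states at different times *)

Section joint_law.
Context d d' (S : measurableType d') (X : measurableType d) (R : realType).
Variables (Q : R.-pker X ~> X) (pi : probability X R) (L : probability S R).
Variables (Y W Z : {mfun S >-> X}).
Hypothesis pi_inv : forall C, measurable C -> pi C = (\int[pi]_y Q y C)%E.
Hypothesis lawY : forall C, measurable C -> L (Y @^-1` C) = pi C.
Hypothesis lawW : forall C, measurable C -> L (W @^-1` C) = pi C.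
Hypothesis lawZ : forall C, measurable C -> L (Z @^-1` C) = pi C.
Hypothesis joint : forall A B, measurable A -> measurable B ->
  L (Y @^-1` A `&` Z @^-1` B) = (\int[L]_(s in Y @^-1` A) Q (W s) B)%E.

Lemma L2_law (V : {mfun S >-> X}) f :
  (forall C, measurable C -> L (V @^-1` C) = pi C) -> L2 pi f -> L2 L (f \o V).
Proof.
move=> lawV [mf f2].
have m2 : measurable_fun setT (fun z => (f z ^+ 2)%:E).
  by apply/measurable_EFinP; exact: measurable_funX.
split; first exact: measurableT_comp.
apply/integrableP; split; first exact: (measurableT_comp m2).
have /integrableP[_] := f2; apply: le_lt_trans.
have -> : (\int[pi]_y `|(f y ^+ 2)%:E| = \int[distribution L V]_y `|(f y ^+ 2)%:E|)%E.
  by apply: eq_measure_integral => A mA _; rewrite /= /distribution /pushforward lawV.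
by rewrite ge0_integral_distribution//; exact: measurableT_comp.
Qed.

Lemma ae_law (V : {mfun S >-> X}) (P : set X) :
  (forall C, measurable C -> L (V @^-1` C) = pi C) ->
  {ae pi, forall y, P y} -> {ae L, forall s, P (V s)}.
Proof.
move=> lawV [N [mN N0 PN]]; exists (V @^-1` N); split.
- exact: measurable_sfunP.
- by rewrite lawV.
- by move=> s /= nP; exact: PN.
Qed.

(** [Y] is to be the initial state, [W] and [Z] two successive later ones. For the indicator of [A]
    as [phi] this is [integral_kernel] for the laws of [Z] and [W] on the event that [Y] lies in
    [A]. *)
Lemma ge0_integral_joint (phi psi : X -> \bar R) :
  (forall y, 0 <= phi y)%E -> measurable_fun setT phi ->
  (forall y, 0 <= psi y)%E -> measurable_fun setT psi ->
  (\int[L]_s (phi (Y s) * psi (Z s)) = \int[L]_s (phi (Y s) * \int[Q (W s)]_z psi z))%E.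
Proof.
move=> phi0 mphi psi0 mpsi.
have mk : measurable_fun setT (fun y => \int[Q y]_z psi z)%E.
  by apply: measurable_fun_integral_kernel => //; exact: measurable_kernel.
have k0 y : (0 <= \int[Q y]_z psi z)%E by exact: integral_ge0.
have mcomp (V : {mfun S >-> X}) (f : X -> \bar R) : measurable_fun setT f ->
    measurable_fun setT (fun s => f (V s)).
  by move=> mf; exact: (measurableT_comp mf).
have restrE A (f : S -> \bar R) : (\int[L]_s ((\1_A (Y s))%:E * f s) = \int[L]_(s in Y @^-1` A) f s)%E.
  rewrite [RHS]integral_mkcond; apply: eq_integral => s _; rewrite patchE indicE.
  have -> : (s \in Y @^-1` A) = (Y s \in A) by apply/idP/idP; rewrite !inE.
  by case: (Y s \in A); rewrite ?mul1e ?mul0e.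
pose Pr phi := (\int[L]_s (phi (Y s) * psi (Z s)) =
                \int[L]_s (phi (Y s) * \int[Q (W s)]_z psi z))%E.
apply: (@nonneg_measurable_ind _ X R Pr _ _ _ _ phi phi0 mphi); rewrite {}/Pr.
- move=> A mA; rewrite !restrE.
  have mYA : measurable (Y @^-1` A) by exact: measurable_sfunP.
  rewrite -(integral_distribution_restr L mYA Z mpsi psi0).
  rewrite -(integral_distribution_restr L mYA W mk k0).
  apply: integral_kernel => // C mC.
  transitivity (L (Y @^-1` A `&` Z @^-1` C)); first exact: distribution_restrE.
  rewrite joint//.
  rewrite (integral_distribution_restr L mYA W)//; exact: measurable_kernel.
- move=> c f c0 f0 mf IH; have c0' : (0 <= c%:E)%E by rewrite lee_fin.
  under eq_integral do rewrite -muleA.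
  rewrite (@ge0_integralZl _ _ _ L _ measurableT (fun s => f (Y s) * psi (Z s))%E)//; last 2 first.
  + by apply: emeasurable_funM; exact: mcomp.
  + by move=> s _; exact: mule_ge0.
  rewrite IH -(@ge0_integralZl _ _ _ L _ measurableT (fun s => f (Y s) * \int[Q (W s)]_z psi z)%E)//; last 2 first.
  + by apply: emeasurable_funM; [exact: mcomp|exact: (mcomp W _ mk)].
  + by move=> s _; exact: mule_ge0.
  by apply: eq_integral => s _; rewrite muleA.
- move=> f g f0 mf g0 mg IHf IHg.
  under eq_integral do rewrite ge0_muleDl//.
  under [RHS]eq_integral do rewrite ge0_muleDl//.
  rewrite (@ge0_integralD _ _ _ L _ measurableT (fun s => f (Y s) * psi (Z s))%E (fun s => g (Y s) * psi (Z s))%E)//; last 4 first.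
  + by move=> s _; exact: mule_ge0.
  + by apply: emeasurable_funM; exact: mcomp.
  + by move=> s _; exact: mule_ge0.
  + by apply: emeasurable_funM; exact: mcomp.
  rewrite IHf IHg -(@ge0_integralD _ _ _ L _ measurableT (fun s => f (Y s) * \int[Q (W s)]_z psi z)%E (fun s => g (Y s) * \int[Q (W s)]_z psi z)%E)//.
  + by move=> s _; exact: mule_ge0.
  + by apply: emeasurable_funM; [exact: mcomp|exact: (mcomp W _ mk)].
  + by move=> s _; exact: mule_ge0.
  + by apply: emeasurable_funM; [exact: mcomp|exact: (mcomp W _ mk)].
- move=> F F0 mF ndF IH.
  have lim (h : S -> \bar R) (mh : measurable_fun setT h) (h0 : forall s, (0 <= h s)%E) :
     (\int[L]_s (limn (F^~ (Y s)) * h s) = limn (fun n => \int[L]_s (F n (Y s) * h s)))%E.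
    rewrite -(@monotone_convergence _ _ _ L _ measurableT (fun n s => F n (Y s) * h s)%E); first last.
    + by move=> s _ a b ab; apply: lee_wpmul2r => //; exact: ndF.
    + by move=> n s _; exact: mule_ge0.
    + by move=> n; apply: emeasurable_funM => //; exact: mcomp.
    apply: eq_integral => s _; have cF : cvgn (F^~ (Y s)).
      by apply: ereal_nondecreasing_is_cvgn => a b ab; exact: ndF.
    (* The limit of the product is the product of the limits unless the latter has the form 0 times
       infinity; the cases where a factor is 0 are settled directly. *)
    have [l0|l0] := eqVneq (limn (F^~ (Y s))) 0%E.
      rewrite l0 mul0e; under eq_fun => n.
        have -> : F n (Y s) = 0%E.
          apply/eqP; rewrite eq_le F0 andbT -l0; apply: lime_ge => //.
          by exists n => // m /= nm; exact: ndF.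
        rewrite mul0e; over.
      by rewrite lim_cst.
    have [h0'|h0'] := eqVneq (h s) 0%E.
      by rewrite h0' mule0; under eq_fun do rewrite mule0; rewrite lim_cst.
    have hcst : limn (fun _ : nat => h s) = h s by exact: lim_cst.
    rewrite -[in LHS]hcst -limeM//; first exact: is_cvg_cst.
    by rewrite hcst mule_defE (negbTE l0) (negbTE h0') //= !andbF.
  rewrite lim//; last exact: mcomp.
  rewrite lim//; last exact: (mcomp W _ mk).
  by congr (limn _); apply/funext => n.
Qed.

Lemma ge0_integral_joint_Qop (f g : X -> R) : L2 pi f -> L2 pi g ->
  (forall y, 0 <= f y) -> (forall y, 0 <= g y) ->
  Rintegral L setT (fun s => f (Y s) * g (Z s)) =
  Rintegral L setT (fun s => f (Y s) * Qop Q g (W s)).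
Proof.
move=> Lf Lg f0 g0; have [mf _] := Lf; have [mg _] := Lg.
have mf' : measurable_fun setT (EFin \o f) by exact/measurable_EFinP.
have mg' : measurable_fun setT (EFin \o g) by exact/measurable_EFinP.
rewrite /Rintegral; congr fine; under eq_integral do rewrite EFinM.
rewrite (ge0_integral_joint (phi := EFin \o f) (psi := EFin \o g))//.
have mk : measurable_fun setT (fun y => \int[Q y]_z (g z)%:E)%E.
  by apply: measurable_fun_integral_kernel => //; exact: measurable_kernel.
apply: ae_eq_integral => //.
- apply: emeasurable_funM; first exact: (measurableT_comp mf').
  exact: (measurableT_comp mk).
- apply/measurable_EFinP; apply: measurable_funM; first exact: (measurableT_comp mf).
  by apply: measurableT_comp => //; exact: measurable_Qop.
have := ae_law lawW (ae_L2_kernel pi_inv Lg); apply: filterS => s Lgs _ /=.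
rewrite EFinM; congr (_ * _)%E; rewrite /Qop fineK//.
exact: (integrable_fin_num measurableT (L2_integrable (Q1 Q (W s)) Lgs)).
Qed.

Lemma L2_joint (f g : X -> R) (V V' : {mfun S >-> X}) :
  (forall C, measurable C -> L (V @^-1` C) = pi C) ->
  (forall C, measurable C -> L (V' @^-1` C) = pi C) ->
  L2 pi f -> L2 pi g -> L.-integrable setT (EFin \o (fun s => f (V s) * g (V' s))).
Proof. by move=> lV lV' Lf Lg; exact: (L2M (L2_law lV Lf) (L2_law lV' Lg)). Qed.

Lemma posBneg (f : X -> R) y : f y = (f^\+)%R y - (f^\-)%R y.
Proof. by rewrite -[in LHS](funrposBneg f). Qed.

(** Splitting into positive and negative parts, [g] before [f]: the parts of [g] recombine inside
    [Qop] at almost every state only, and laws of the coordinates carry null sets of [pi] over to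
    paths. *)
Lemma integral_joint_Qop (f g : X -> R) : L2 pi f -> L2 pi g ->
  Rintegral L setT (fun s => f (Y s) * g (Z s)) =
  Rintegral L setT (fun s => f (Y s) * Qop Q g (W s)).
Proof.
move=> Lf Lg; have [mg _] := Lg.
have pos (h : X -> R) y : 0 <= (h^\+)%R y by rewrite /funrpos le_max lexx orbT.
have neg (h : X -> R) y : 0 <= (h^\-)%R y by rewrite /funrneg le_max lexx orbT.
have step (h : X -> R) : L2 pi h -> (forall y, 0 <= h y) ->
    Rintegral L setT (fun s => h (Y s) * g (Z s)) =
    Rintegral L setT (fun s => h (Y s) * Qop Q g (W s)).
  move=> Lh h0; under eq_Rintegral do rewrite (posBneg g) mulrBr.
  rewrite RintegralB//; [|exact: (L2_joint lawY lawZ Lh (L2_pos Lg))|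
    exact: (L2_joint lawY lawZ Lh (L2_neg Lg))].
  rewrite !ge0_integral_joint_Qop//; [|exact: L2_neg|exact: L2_pos].
  have Lp := L2_Qop pi_inv (L2_pos Lg); have Ln := L2_Qop pi_inv (L2_neg Lg).
  rewrite -RintegralB//; [|exact: (L2_joint lawY lawW Lh Lp)|exact: (L2_joint lawY lawW Lh Ln)].
  rewrite /Rintegral; congr fine; apply: ae_eq_integral => //.
  - apply/measurable_EFinP; apply: measurable_funB; apply: measurable_funM.
    + by case: (L2_law lawY Lh).
    + by case: (L2_law lawW Lp).
    + by case: (L2_law lawY Lh).
    + by case: (L2_law lawW Ln).
  - apply/measurable_EFinP; apply: measurable_funM; first by case: (L2_law lawY Lh).
    by case: (L2_law lawW (L2_Qop pi_inv Lg)).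
  have h1 := ae_law lawW (ae_L2_kernel pi_inv Lg); apply: filterS h1 => s Lgs _.
  rewrite -mulrBr; congr (_ * _)%:E; rewrite /Qop -RintegralB//.
  - by apply: eq_Rintegral => y _; rewrite -posBneg.
  - exact: (L2_integrable (Q1 Q (W s)) (L2_pos Lgs)).
  - exact: (L2_integrable (Q1 Q (W s)) (L2_neg Lgs)).
have LQg := L2_Qop pi_inv Lg.
under eq_Rintegral do rewrite (posBneg f) mulrBl.
under [RHS]eq_Rintegral do rewrite (posBneg f) mulrBl.
rewrite RintegralB//; [|exact: (L2_joint lawY lawZ (L2_pos Lf) Lg)|
    exact: (L2_joint lawY lawZ (L2_neg Lf) Lg)].
rewrite RintegralB//; [|exact: (L2_joint lawY lawW (L2_pos Lf) LQg)|
    exact: (L2_joint lawY lawW (L2_neg Lf) LQg)].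
rewrite !step//; [exact: L2_neg|exact: L2_pos].
Qed.

End joint_law.

(** * The stationary chain *)

Section stationary_chain.
Local Open Scope ereal_scope.
Context d (X : measurableType d) (R : realType) (Q : R.-pker X ~> X) (x : X).
Variables (mu L : probability (path X) R) (pi : probability X R).
Hypothesis mu_rect : forall n As, (forall i, measurable (As i)) ->
  mu (rect As n) = (\1_(As 0%N) x)%:E * fdd_tail Q n (fun i => As i.+1) x.
Hypothesis kiter_cvg : forall y C, measurable C ->
  fine (kiter Q n y C) @[n --> \oo] --> fine (pi C).
Variable e : nat -> R.
Hypothesis e0 : (e @ \oo --> (0 : R))%R.
Hypothesis mu_L : forall n A, measurable A ->
  (`|fine (distribution mu (shift n) A) - fine (L A)| <= e n)%R.

Lemma cvg_stationary A : measurable A -> fine (mu (shift n @^-1` A)) @[n --> \oo] --> fine (L A).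
Proof.
move=> mA; apply/cvgrPdist_le => r r0; move/cvgrPdist_le : e0 => /(_ _ r0).
apply: filterS => n; rewrite sub0r normrN distrC => h.
exact: (le_trans (mu_L n mA) (le_trans (ler_norm _) h)).
Qed.

Lemma cvg_stationary_eq A (l : R) : measurable A ->
  fine (mu (shift n @^-1` A)) @[n --> \oo] --> l -> L A = l%:E.
Proof.
move=> mA h; rewrite -(fineK (fin_num_measure L _ mA)); congr _%:E.
by rewrite -(cvg_lim _ h)// -(cvg_lim _ (cvg_stationary mA)).
Qed.

Lemma stationary_inv A : measurable A -> L (shift 1 @^-1` A) = L A.
Proof.
move=> mA; have mA1 : measurable (shift 1 @^-1` A).
  by rewrite -[_ @^-1` _]setTI; exact: measurable_shift.
rewrite -[RHS](fineK (fin_num_measure L _ mA)); apply: cvg_stationary_eq => //.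
have -> : (fun n => fine (mu (shift n @^-1` (shift 1 @^-1` A)))) =
          (fun n => fine (mu (shift n.+1 @^-1` A))).
  apply/funext => n; congr (fine (mu _)).
  by apply/seteqP; split => s /=; rewrite shiftD addn1.
by rewrite (cvg_shiftS (fun n => fine (mu (shift n @^-1` A)))); exact: cvg_stationary.
Qed.

Lemma stationary_law n C : measurable C -> L (coord n @^-1` C) = pi C.
Proof.
move=> mC; have mC' : measurable (coord n @^-1` C : set (path X)).
  by rewrite -[_ @^-1` _]setTI; exact: measurable_coord.
rewrite -[RHS](fineK (fin_num_measure pi _ mC)); apply: cvg_stationary_eq => //.
have -> : (fun m => fine (mu (shift m @^-1` (coord n @^-1` C)))) =
          (fun m => fine (kiter Q (m + n) x C)).
  by apply/funext => m; rewrite -(law_coord mu_rect).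
by rewrite (cvg_shiftn n (fun m => fine (kiter Q m x C))); exact: kiter_cvg.
Qed.

(** The one-step Markov property of [mu] at time n + k, in the limit of large n. Both sides are
    integrals of [0, 1]-valued path functions, so setwise convergence of the shifted laws
    suffices. *)
Lemma stationary_joint k A B : measurable A -> measurable B ->
  L (coord 0 @^-1` A `&` coord k.+1 @^-1` B) = \int[L]_(s in coord 0 @^-1` A) Q (coord k s) B.
Proof.
move=> mA mB.
have mcA n : measurable (coord n @^-1` A : set (path X)).
  by rewrite -[_ @^-1` _]setTI; exact: measurable_coord.
have mcB n : measurable (coord n @^-1` B : set (path X)).
  by rewrite -[_ @^-1` _]setTI; exact: measurable_coord.
pose u (s : path X) := (\1_A (coord 0 s))%:E * Q (coord k s) B.
have mu_ : measurable_fun setT u.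
  apply: emeasurable_funM.
    apply: (measurableT_comp (f := fun y => (\1_A y)%:E) _ (measurable_coord 0)).
    exact/measurable_EFinP/measurable_indic.
  exact: (measurableT_comp (measurable_kernel Q _ mB) (measurable_coord k)).
have u01 s : 0 <= u s <= 1.
  rewrite mule_ge0 ?lee_fin//=; apply: (@le_trans _ _ (1 * 1)); last by rewrite mule1.
  apply: lee_pmul => //; first by rewrite lee_fin indicE; case: (_ \in _).
  by rewrite -(Q1 Q (coord k s)); apply: le_measure; rewrite ?inE.
have restrE (m : {measure set (path X) -> \bar R}) D f : measurable_fun setT f -> (forall s, 0 <= f s) ->
    \int[m]_(s in D) f s = \int[m]_s ((\1_D s)%:E * f s).
  move=> mf f0; rewrite integral_mkcond; apply: eq_integral => s _; rewrite patchE indicE.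
  by case: (_ \in _); rewrite ?mul1e ?mul0e.
have -> : \int[L]_(s in coord 0 @^-1` A) Q (coord k s) B = \int[L]_s u s.
  rewrite restrE//; exact: (measurableT_comp (measurable_kernel Q _ mB) (measurable_coord k)).
have finu : \int[L]_s u s \is a fin_num.
  by apply: integral01_fin => //; exact: probability_le1.
rewrite -[RHS]fineK//; apply: cvg_stationary_eq; first exact: measurableI.
have -> : (fun n => fine (mu (shift n @^-1` (coord 0 @^-1` A `&` coord k.+1 @^-1` B)))) =
    (fun n => fine (\int[distribution mu (shift n)]_s u s)).
  apply/funext => n; congr fine.
  rewrite ge0_integral_distribution//; last by move=> s; have /andP[] := u01 s.
  pose As i := if i == n then A else setT.
  have mAs i : measurable (As i) by rewrite /As; case: ifP.
  have rE : rect As (n + k) = coord n @^-1` A.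
    apply/seteqP; split => s /= H.
      by have := H n (leq_addr _ _); rewrite /As eqxx.
    by move=> i _; rewrite /As; case: eqP => // ->.
  have mk : measurable_fun setT (fun z => (\1_B z)%:E : \bar R).
    exact/measurable_EFinP/measurable_indic.
  have := @integral_rect_step _ X R Q x mu mu_rect (n + k) As (fun z => (\1_B z)%:E) mAs _ mk.
  rewrite rE => /(_ (fun z => _)) h.
  transitivity (\int[mu]_(s in coord n @^-1` A) (\1_B (s (n + k).+1))%:E).
    rewrite [RHS](@integral_indic _ _ _ mu _ (mcA n) (coord (n + k).+1 @^-1` B)) 1?setIC//.
    congr (mu _); apply/seteqP; split => s /=; by rewrite /coord /shift addn0 addnS.
  rewrite h => [|z]; last by rewrite lee_fin.
  rewrite restrE; last 2 first.
  - apply: (measurableT_comp (f := fun y => \int[Q y]_z (\1_B z)%:E) _ (measurable_coord (n + k))).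
    by apply: measurable_fun_integral_kernel => //; exact: measurable_kernel.
  - by move=> s; exact: integral_ge0.
  apply: eq_integral => s _; rewrite /u /= /coord /shift addn0; congr (_ * _).
  by rewrite integral_indic// setIT.
apply: cvg_integral01 => //.
- by move=> n; exact: probability_le1.
- exact: probability_le1.
- by move=> C mC; exact: cvg_stationary.
Qed.

End stationary_chain.

Section path_pairs.
Context d (X : measurableType d).

Definition pair01 (s : path X) : X * X := (s 0%N, s 1%N).
Definition pair10 (s : path X) : X * X := (s 1%N, s 0%N).

Lemma measurable_pair01 : measurable_fun setT pair01.
Proof. by apply: measurable_fun_pair; exact: measurable_coord. Qed.

Lemma measurable_pair10 : measurable_fun setT pair10.
Proof. by apply: measurable_fun_pair; exact: measurable_coord. Qed.

HB.instance Definition _ := @isMeasurableFun.Build _ _ (path X) (X * X)%type pair01 measurable_pair01.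
HB.instance Definition _ := @isMeasurableFun.Build _ _ (path X) (X * X)%type pair10 measurable_pair10.

End path_pairs.
Arguments pair01 {d} X.
Arguments pair10 {d} X.

(** * Reversibility as self-adjointness; averages of lagged products *)

Section covariances.
Context d (X : measurableType d) (R : realType) (Q : R.-pker X ~> X) (x : X).
Variables (mu L : probability (path X) R) (pi : probability X R).
Hypothesis mu_rect : forall n As, (forall i, measurable (As i)) ->
  mu (rect As n) = ((\1_(As 0%N) x)%:E * fdd_tail Q n (fun i => As i.+1) x)%E.
Hypothesis kiter_cvg : forall y C, measurable C ->
  fine (kiter Q n y C) @[n --> \oo] --> fine (pi C).
Variable e : nat -> R.
Hypothesis e0 : (e @ \oo --> (0 : R))%R.
Hypothesis mu_L : forall n A, measurable A ->
  (`|fine (distribution mu (shift n) A) - fine (L A)| <= e n)%R.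
Hypothesis rev : reversible pi Q.

Lemma reversible_inv C : measurable C -> pi C = (\int[pi]_y Q y C)%E.
Proof.
move=> mC; have := rev mC measurableT; rewrite -/(reversible _ _) => <-.
under eq_integral do rewrite (Q1 Q); rewrite integral_cst// mul1e//.
Qed.

Let slaw := stationary_law mu_rect kiter_cvg e0 mu_L.
Let sjoint := stationary_joint mu_rect e0 mu_L.

(** Induction on the lag for all [g]: integrating out the last state replaces [g] by [Qop Q g] and
    shortens the lag by one. *)
Lemma integral_stationary_pair k f g : L2 pi f -> L2 pi g ->
  Rintegral L setT (fun s => f (coord 0 s) * g (coord k s)) =
  Rintegral pi setT (fun y => f y * Qpow Q k g y).
Proof.
move=> Lf; elim: k g => [|k IH] g Lg.
  have [mf _] := Lf; have [mg _] := Lg.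
  rewrite /Rintegral; congr fine => /=.
  have -> : (\int[pi]_y (f y * g y)%:E = \int[distribution L (coord 0)]_y (f y * g y)%:E)%E.
    by apply: eq_measure_integral => A mA _; apply/esym; exact: (slaw 0%N mA).
  rewrite integral_distribution//.
    by apply/measurable_EFinP; exact: measurable_funM.
  have := L2_joint (slaw 0%N) (slaw 0%N) Lf Lg; exact.
rewrite QpowSr -IH; last exact: (L2_Qop reversible_inv Lg).
exact: (integral_joint_Qop reversible_inv (slaw 0%N) (slaw k) (slaw k.+1) (sjoint k) Lf Lg).
Qed.

(** Detailed balance says that the laws of the pair of states at times 0 and 1 and of the swapped
    pair agree on products of measurable sets, a pi-system generating the product sigma-algebra. *)
Lemma law_pair_sym (h : X * X -> \bar R) : measurable_fun setT h ->
  L.-integrable setT (fun s => h (s 0%N, s 1%N)) ->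
  L.-integrable setT (fun s => h (s 1%N, s 0%N)) ->
  (\int[L]_s h (s 0%N, s 1%N) = \int[L]_s h (s 1%N, s 0%N))%E.
Proof.
move=> mh i1 i2.
rewrite -(integral_distribution (X := pair01 X))// -(integral_distribution (X := pair10 X))//.
apply: eq_measure_integral => C mC _.
pose G : set (set (X * X)) :=
  [set C | exists A, measurable A /\ exists B, measurable B /\ C = A `*` B].
apply: (@measure_unique _ R (X * X)%type G (fun=> setT) _ _ _ _
  (distribution L (pair01 X)) (distribution L (pair10 X))) => //.
- rewrite measurable_prod_measurableType; congr (<<s _ >>).
  rewrite predeqE; split => [[A mA [B mB <-]]|[A [mA [B [mB ->]]]]].
    by exists A; split => //; exists B.
  by exists A => //; exists B.
- move=> _ _ [A [mA [B [mB ->]]]] [A' [mA' [B' [mB' ->]]]].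
  rewrite -setXI; exists (A `&` A'); split; first exact: measurableI.
  by exists (B `&` B'); split => //; exact: measurableI.
- by move=> _; exists setT; split => //; exists setT; rewrite setXTT.
- by rewrite bigcup_const.
- move=> _ [A [mA [B [mB ->]]]].
  have E A' B' : measurable A' -> measurable B' ->
      L (coord 0 @^-1` A' `&` coord 1 @^-1` B') = (\int[pi]_(y in A') Q y B')%E.
    move=> mA' mB'; have mk := measurable_kernel Q _ mB'.
    rewrite sjoint//.
    have mcA : measurable (coord 0 @^-1` A' : set (path X)).
      by rewrite -[_ @^-1` _]setTI; exact: measurable_coord.
    have -> : (\int[pi]_(y in A') Q y B' = \int[distribution L (coord 0)]_(y in A') Q y B')%E.
      by apply: eq_measure_integral => D mD _; apply/esym; exact: (slaw 0%N mD).
    rewrite ge0_integral_pushforward//.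
    exact: (@measurable_funS _ _ _ _ setT).
  have h1 : distribution L (pair01 X) (A `*` B) = L (coord 0 @^-1` A `&` coord 1 @^-1` B) by [].
  have h2 : distribution L (pair10 X) (A `*` B) = L (coord 0 @^-1` B `&` coord 1 @^-1` A).
    by rewrite setIC.
  apply: (etrans h1); apply: etrans (esym h2); rewrite !E//; exact: rev.
- by move=> _; apply: (le_lt_trans (probability_le1 _ measurableT)); exact: ltry.
Qed.

Lemma Qop_selfadj f g : L2 pi f -> L2 pi g ->
  Rintegral pi setT (fun y => f y * Qop Q g y) = Rintegral pi setT (fun y => g y * Qop Q f y).
Proof.
move=> Lf Lg; rewrite -!(integral_stationary_pair 1)//.
rewrite /Rintegral; congr fine.
have [mf _] := Lf; have [mg _] := Lg.
have mh : measurable_fun setT (fun p : X * X => (f p.1 * g p.2)%:E).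
  apply/measurable_EFinP; apply: measurable_funM; exact: measurableT_comp.
rewrite [LHS](law_pair_sym mh).
- by apply: eq_integral => s _; rewrite mulrC.
- exact: (L2_joint (slaw 0%N) (slaw 1%N) Lf Lg).
- exact: (L2_joint (slaw 1%N) (slaw 0%N) Lf Lg).
Qed.

Lemma Qpow_selfadj a f g : L2 pi f -> L2 pi g ->
  Rintegral pi setT (fun y => f y * Qpow Q a g y) = Rintegral pi setT (fun y => Qpow Q a f y * g y).
Proof.
elim: a f g => // a IH f g Lf Lg.
rewrite QpowSr IH//; last exact: (L2_Qop reversible_inv Lg).
rewrite Qop_selfadj//; last exact: (L2_Qpow reversible_inv).
by apply: eq_Rintegral => y _; rewrite mulrC.
Qed.

(** Self-adjointness tested against the constant 1, which [Qop] fixes. *)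
Lemma pimean_Qop f : L2 pi f -> pimean pi (Qop Q f) = pimean pi f.
Proof.
move=> Lf; have := Qop_selfadj (L2_cst (pi1 pi) 1) Lf.
rewrite /pimean.
have -> : (fun y => cst 1 y * Qop Q f y) = Qop Q f by apply/funext => y; rewrite mul1r.
have -> // : (fun y => f y * Qop Q (cst 1) y) = f.
by apply/funext => y; rewrite /Qop Rintegral_cst// (Q1 Q) /= !mulr1.
Qed.

Lemma strong_law_pair k f g : L2 pi f -> L2 pi g ->
  {ae mu, forall s : path X, M%:R^-1 * \sum_(t < M) (f (s t) * g (s (t + k)%N)) @[M --> \oo] -->
    Rintegral pi setT (fun y => f y * Qpow Q k g y)}.
Proof.
move=> Lf Lg; rewrite -integral_stationary_pair//.
have [mf _] := Lf; have [mg _] := Lg.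
have mF : measurable_fun setT (fun s : path X => f (coord 0 s) * g (coord k s)).
  by apply: measurable_funM; apply: measurableT_comp => //; exact: measurable_coord.
have iF := L2_joint (slaw 0%N) (slaw k) Lf Lg.
have := strong_law (zero_one mu_rect kiter_cvg) _ (stationary_inv e0 mu_L) mF iF.
(* An invariant event has the same probability under all shifted laws, so the limit [L] gives it its
   [mu]-probability. *)
have inv (A : set (path X)) : measurable A -> shift 1 @^-1` A = A -> mu A = L A.
  move=> mA invA.
  have invAn n : shift n @^-1` A = A.
    elim: n => [|n IH]; first by apply/seteqP; split.
    rewrite -[in RHS]invA -[in RHS]IH; apply/seteqP; split => s /=; by rewrite shiftD add1n.
  rewrite -[LHS](fineK (fin_num_measure mu _ mA)); apply/esym.
  apply: (cvg_stationary_eq e0 mu_L mA).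
  by under eq_fun do rewrite invAn; exact: cvg_cst.
move=> /(_ inv); apply: filterS => s; apply: cvg_trans.
apply: near_eq_cvg; apply: nearW => M /=; congr (_ * _); apply: eq_bigr => t _.
by rewrite /coord /shift addn0.
Qed.

End covariances.

(** * Hausdorff moment sequences *)

Section moment_functional.
Context (R : realFieldType).
Implicit Types (m : nat -> R) (p q : {poly R}).

(** The Riesz functional of [m]: the linear form sending X^i to m i, which is integration against a
    representing measure if there is one. *)
Definition Lm m p : R := \sum_(i < size p) p`_i * m i.

Lemma LmE m p n : (size p <= n)%N -> Lm m p = \sum_(i < n) p`_i * m i.
Proof.
move=> sn; rewrite /Lm (big_ord_widen _ (fun i => p`_i * m i) sn) [RHS](bigID (fun i : 'I_n => (i < size p)%N)) /=.
rewrite [X in _ + X]big1 ?addr0// => i; rewrite -leqNgt => h.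
by rewrite nth_default// mul0r.
Qed.

Lemma LmD m p q : Lm m (p + q) = Lm m p + Lm m q.
Proof.
pose n := maxn (size (p + q)) (maxn (size p) (size q)).
rewrite (@LmE m (p + q) n) ?leq_maxl//.
rewrite (@LmE m p n) ?(@LmE m q n) ?leq_max ?leqnn ?orbT//.
by rewrite -big_split /=; apply: eq_bigr => i _; rewrite coefD mulrDl.
Qed.

Lemma LmZ m c p : Lm m (c *: p) = c * Lm m p.
Proof.
rewrite (@LmE m (c *: p) (size p)) ?size_scale_leq// /Lm mulr_sumr.
by apply: eq_bigr => i _; rewrite coefZ mulrA.
Qed.

Lemma Lm0 m : Lm m 0 = 0.
Proof. by rewrite /Lm size_poly0 big_ord0. Qed.

Lemma Lm_sum m I (s : seq I) (F : I -> {poly R}) :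
  Lm m (\sum_(i <- s) F i) = \sum_(i <- s) Lm m (F i).
Proof.
by elim: s => [|i s IH]; rewrite ?big_nil ?Lm0// !big_cons LmD IH.
Qed.

Lemma LmXn m k : Lm m 'X^k = m k.
Proof.
rewrite /Lm size_polyXn big_ord_recr /= coefXn eqxx mul1r big1 ?add0r// => i _.
by rewrite coefXn ltn_eqF ?mul0r.
Qed.

Lemma Lm1 m : Lm m 1 = m 0%N. Proof. by rewrite -(LmXn m 0) expr0. Qed.

(** A linear form is determined by its values on monomials; changes of variable and integrals of
    polynomials are identified with [Lm] in this way. *)
Lemma Lm_ind m (L : {poly R} -> R) :
  (forall p q, L (p + q) = L p + L q) -> (forall c p, L (c *: p) = c * L p) ->
  (forall k, L 'X^k = m k) -> forall p, L p = Lm m p.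
Proof.
move=> LD LZ LX p; have L0 : L 0 = 0 by rewrite -(scale0r 0) LZ mul0r.
have Lsum (s : seq nat) (F : nat -> {poly R}) : L (\sum_(i <- s) F i) = \sum_(i <- s) L (F i).
  by elim: s => [|i s IH]; rewrite ?big_nil ?L0// !big_cons LD IH.
rewrite -[p in LHS]coefK poly_def -(big_mkord xpredT (fun i => p`_i *: 'X^i)) Lsum big_mkord.
by apply: eq_bigr => i _; rewrite LZ LX.
Qed.

Lemma Lm_comp m n z : (forall i, n i = Lm m (z ^+ i)) ->
  forall p, Lm n p = Lm m (p \Po z).
Proof.
move=> nE p; symmetry; apply: (@Lm_ind n (fun p => Lm m (p \Po z))).
- by move=> q r; rewrite comp_polyD LmD.
- by move=> c q; rewrite comp_polyZ LmZ.
- by move=> k; rewrite comp_Xn_poly nE.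
Qed.

Lemma Lm_shift m p : Lm (fun k => m k.+1) p = Lm m ('X * p).
Proof.
symmetry; apply: (@Lm_ind (fun k => m k.+1) (fun p => Lm m ('X * p))).
- by move=> q r; rewrite mulrDr LmD.
- by move=> c q; rewrite -scalerAr LmZ.
- by move=> k; rewrite -exprS LmXn.
Qed.

Lemma Lm_mul m p q : Lm m (p * q) = \sum_(i < size p) \sum_(j < size q) p`_i * q`_j * m (i + j)%N.
Proof.
rewrite -[p in LHS]coefK -[q in LHS]coefK !poly_def mulr_suml Lm_sum.
apply: eq_bigr => i _; rewrite mulr_sumr Lm_sum; apply: eq_bigr => j _.
by rewrite -scalerAl -scalerAr scalerA -exprD LmZ LmXn.
Qed.

End moment_functional.

(** * Bernstein approximation on [0, 1] *)

Section bernstein.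
Context (R : realType).
Implicit Types (m : nat -> R).

(** Complete monotonicity: the alternating iterated differences of [m] are nonnegative. This is
    Hausdorff's condition on [0, 1]. *)
Definition pos01 m := forall i j, 0 <= Lm m ('X^i * (1 - 'X) ^+ j).

Lemma pos01_shift m : pos01 m -> pos01 (fun k => m k.+1).
Proof. by move=> pm i j; rewrite Lm_shift mulrA -exprS. Qed.

(* the Bernstein weights of m: masses at the points i/N of discrete measures
   whose moments converge to m *)
Definition bw m N i : R := 'C(N, i)%:R * Lm m ('X^i * (1 - 'X) ^+ (N - i)).

Lemma bw_ge0 m N i : pos01 m -> 0 <= bw m N i.
Proof. by move=> pm; rewrite mulr_ge0. Qed.

Lemma sum_bw m N : \sum_(i < N.+1) bw m N i = m 0%N.
Proof.
rewrite -Lm1 -(expr1n _ N) -[in RHS](subrK 'X 1) exprDn Lm_sum.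
apply: eq_bigr => i _; rewrite /bw [_ * 'X^_]mulrC.
by rewrite -LmZ scaler_nat.
Qed.

Definition bS m a N : R := \sum_(i < N.+1) bw m N i * (i%:R / N%:R) ^+ a.

Lemma bw_step m N i : bw m N.+1 i.+1 * i.+1%:R = N.+1%:R * bw (fun k => m k.+1) N i.
Proof.
rewrite /bw Lm_shift subSS.
have -> : 'X * ('X^i * (1 - 'X) ^+ (N - i)) = 'X^(i.+1) * (1 - 'X) ^+ (N - i) :> {poly R}.
  by rewrite mulrA -exprS.
by rewrite mulrAC -natrM [(_ * i.+1)%N]mulnC -mul_bin_diag natrM mulrA.
Qed.

Lemma expr_dist (u v : R) a : 0 <= u <= 1 -> 0 <= v <= 1 -> `|u ^+ a - v ^+ a| <= a%:R * `|u - v|.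
Proof.
move=> /andP[u0 u1] /andP[v0 v1]; elim: a => [|a IH]; first by rewrite !expr0 subrr normr0 mul0r.
have -> : u ^+ a.+1 - v ^+ a.+1 = u * (u ^+ a - v ^+ a) + (u - v) * v ^+ a.
  by rewrite !exprS; ring.
apply: le_trans (ler_normD _ _) _; rewrite -[a.+1%:R]natr1 [leRHS]mulrDl mul1r !normrM; apply: lerD.
  rewrite (ger0_norm u0); apply: le_trans IH.
  by rewrite -[leRHS]mul1r ler_wpM2r.
rewrite -[leRHS]mulr1 ler_wpM2l// normrX (ger0_norm v0).
exact: exprn_ile1.
Qed.

Lemma cvg_invnS : (n.+1%:R^-1 : R) @[n --> \oo] --> (0 : R).
Proof. exact: cvg_harmonic. Qed.

(** The identity (i+1) C(N+1, i+1) = (N+1) C(N, i) absorbs one factor (i+1)/(N+1) into the weights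
    and turns them into those of the shifted sequence. What remains is the distance from (i+1)/(N+1)
    to i/N, at most 1/(N+1). *)
Lemma bS_step m a N : pos01 m ->
  `|bS m a.+1 N.+1 - bS (fun k => m k.+1) a N| <= m 1%N * a%:R * N.+1%:R^-1.
Proof.
move=> pm; rewrite {1}/bS big_ord_recl /= mul0r expr0n /= mulr0 add0r.
have -> : \sum_(i < N.+1) bw m N.+1 (bump 0 i) * ((bump 0 i)%:R / N.+1%:R) ^+ a.+1 =
    \sum_(i < N.+1) bw (fun k => m k.+1) N i * (i.+1%:R / N.+1%:R) ^+ a.
  apply: eq_bigr => i _; rewrite /bump /= add1n exprS !mulrA bw_step.
  by congr (_ * _); rewrite mulrAC mulfV ?mul1r ?pnatr_eq0.
rewrite -sumrB; apply: le_trans (ler_norm_sum _ _ _) _.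
rewrite -mulrA -(sum_bw (fun k => m k.+1) N) mulr_suml.
apply: ler_sum => i _; rewrite -mulrBr normrM ger0_norm ?bw_ge0//; last exact: pos01_shift.
apply: ler_wpM2l; first by apply: bw_ge0; exact: pos01_shift.
have iN : (i <= N)%N by rewrite -ltnS.
have uv0 k n : (k <= n)%N -> 0 <= (k%:R / n%:R : R) <= 1.
  move=> kn; rewrite divr_ge0//=; have [->|n0] := posnP n; first by rewrite invr0 mulr0.
  by rewrite ler_pdivrMr ?ltr0n// mul1r ler_nat.
apply: le_trans (expr_dist a (uv0 i.+1 N.+1 _) (uv0 i N iN)) _; first by rewrite ltnS.
apply: ler_wpM2l => //.
(* For N = 0 the point i/N is 0 by the convention on inverses, and its distance to 1 is exactly the
   allowed 1/(N+1). *)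
have [N0|N0] := posnP N.
  have -> : nat_of_ord i = 0%N by apply/eqP; rewrite -leqn0 -N0.
  by rewrite N0 mul0r subr0 ger0_norm// mul1r.
have -> : i.+1%:R / N.+1%:R - i%:R / N%:R = (1 - i%:R / N%:R) * N.+1%:R^-1 :> R.
  by rewrite -!natr1; field; rewrite natr1 !pnatr_eq0 /= -lt0n N0.
have /andP[h0 h1] := uv0 i N iN.
rewrite normrM (ger0_norm (x := 1 - _)) ?subr_ge0// (ger0_norm (x := _^-1))//.
by rewrite -[leRHS]mul1r ler_wpM2r// gerBl.
Qed.

(** Induction on the exponent, trading each power for a shift of the sequence; exponent 0 is
    exact. *)
Lemma cvg_bS m a : pos01 m -> bS m a N @[N --> \oo] --> m a.
Proof.
elim: a m => [|a IH] m pm.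
  apply: (@cvg_trans _ ((fun=> m 0%N) @ \oo)); last exact: cvg_cst.
  apply: near_eq_cvg; apply: nearW => N; rewrite /bS -[LHS](sum_bw m N).
  by apply: eq_bigr => i _; rewrite expr0 mulr1.
rewrite -(cvg_shiftS (fun N => bS m a.+1 N)).
have h := IH _ (pos01_shift pm).
have d0 : bS m a.+1 N.+1 - bS (fun k => m k.+1) a N @[N --> \oo] --> (0 : R).
  apply: norm_cvg0; apply: (@squeeze_cvgr _ _ _ _ (fun=> 0) (fun N => m 1%N * a%:R * N.+1%:R^-1)).
  - by apply: nearW => N; rewrite normr_ge0 bS_step.
  - exact: cvg_cst.
  - by rewrite -[X in _ --> X](mulr0 (m 1%N * a%:R)); apply: cvgMr; exact: cvg_invnS.
have -> : [sequence bS m a.+1 n.+1]_n = (fun N =>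
    (bS m a.+1 N.+1 - bS (fun k => m k.+1) a N) + bS (fun k => m k.+1) a N).
  by apply/funext => N /=; rewrite subrK.
by rewrite -[m a.+1]add0r; exact: cvgD.
Qed.

End bernstein.

(** * Quantile functions of the Bernstein weights *)

Section quantile.
Context (R : realType).
Implicit Types (m : nat -> R).

(** The count is [K] minus the ceiling of [b]. *)
Lemma count_threshold (b : R) (K : nat) : 0 <= b -> b <= K%:R ->
  (K%:R - b - 1 <= \sum_(i < K) (b <= i%:R)%R%:R) /\ \sum_(i < K) (b <= i%:R)%R%:R <= K%:R - b.
Proof.
move=> b0; elim: K => [|K IH] bK.
  by rewrite big_ord0; split; [rewrite subr_le0; lra|rewrite subr_ge0].
rewrite big_ord_recr /=; have [bK'|Kb] := leP b K%:R.
  have [] := IH bK'; set s := \sum_(i < K) _ => h1 h2.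
  by rewrite (_ : (true : nat)%:R = 1 :> R)// -[K.+1%:R]natr1; split; lra.
rewrite big1 => [|i _].
  by rewrite -natr1 addr0; rewrite -natr1 in bK; split; lra.
by rewrite leNgt (le_lt_trans _ Kb)// ler_nat ltnW.
Qed.

Section fixed_level.
Variables (m : nat -> R) (N : nat).
Hypothesis pm : pos01 m.
Let c := m 0%N.

Definition bW j : R := \sum_(i < j.+1) bw m N i.

Lemma bW_mono i j : (i <= j)%N -> bW i <= bW j.
Proof.
move=> /subnKC <-; elim: (j - i)%N => [|k IH]; first by rewrite addn0.
by rewrite addnS; apply: le_trans IH _; rewrite /bW [leRHS]big_ord_recr /= lerDl bw_ge0.
Qed.

Lemma bW_ge0 j : 0 <= bW j.
Proof. by apply: sumr_ge0 => i _; exact: bw_ge0. Qed.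

Lemma bW_le j : (j <= N)%N -> bW j <= c.
Proof. by move=> jN; rewrite /c -(sum_bw m N); exact: bW_mono. Qed.

Lemma m0_ge0 : 0 <= c.
Proof. exact: le_trans (bW_ge0 0) (bW_le (leq0n _)). Qed.

(* the quantile function of the discrete measure with mass bw m N i at i/N *)
Definition quantile (t : R) : R := N%:R^-1 * \sum_(j < N) (bW j <= t)%R%:R.

Lemma quantile_mono s t : s <= t -> quantile s <= quantile t.
Proof.
move=> st; rewrite /quantile ler_wpM2l// ler_sum// => j _.
by rewrite ler_nat; case: (leP (bW j) s) => // /le_trans -> //.
Qed.

Lemma quantile01 t : 0 <= quantile t <= 1.
Proof.
rewrite /quantile mulr_ge0 ?sumr_ge0//=.
have [->|N0] := posnP N; first by rewrite invr0 mul0r.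
rewrite ler_pdivrMl ?ltr0n// mulr1.
apply: (@le_trans _ _ (\sum_(j < N) 1)); last by rewrite sumr_const card_ord.
by apply: ler_sum => j _; rewrite lern1 leq_b1.
Qed.

Let a r j : R := (j.+1%:R / N%:R) ^+ r - (j%:R / N%:R) ^+ r.

Lemma sum_pow_step r J : \sum_(j < J) a r j = (J%:R / N%:R) ^+ r - 0 ^+ r.
Proof.
rewrite -(big_mkord xpredT (a r)) telescope_sumr ?leq0n//.
by rewrite mul0r.
Qed.

Lemma pow_step_ge0 r j : 0 <= a r j.
Proof.
rewrite subr_ge0; apply: lerXn2r; rewrite ?nnegrE ?divr_ge0//.
by rewrite ler_wpM2r ?invr_ge0// ler_nat.
Qed.

(** By monotonicity the j with bW j <= t form an initial segment of some length J, so the quantile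
    is J/N, and its r-th power telescopes into the increments [a r j]. *)
Lemma quantileX r t : quantile t ^+ r = 0 ^+ r + \sum_(j < N) a r j * (bW j <= t)%R%:R.
Proof.
have [J JN HJ] : exists2 J : nat, (J <= N)%N & forall j, (j < N)%N -> (bW j <= t)%R = (j < J)%N.
  elim: {1 2}N => [|n [J JN HJ]]; first by exists 0%N.
  have [h|h] := boolP (bW n <= t)%R.
    exists n.+1 => // j jn; rewrite jn; apply: le_trans h.
    by apply: bW_mono; rewrite -ltnS.
  exists J; first exact: leqW.
  move=> j; rewrite ltnS leq_eqVlt => /orP[/eqP ->|/HJ//].
  by rewrite (negbTE h) ltnNge JN.
have sumJ (b : nat -> R) : \sum_(j < N) b j * (bW j <= t)%R%:R = \sum_(j < J) b j.
  rewrite (big_ord_widen _ b JN) [in RHS]big_mkcond /=; apply: eq_bigr => j _.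
  by rewrite HJ//; case: ifP => _; rewrite ?mulr1 ?mulr0.
rewrite sumJ sum_pow_step addrC subrK /quantile; congr (_ ^+ r).
have := sumJ (fun=> 1); under eq_bigr do rewrite mul1r.
by move=> ->; rewrite sumr_const card_ord mulrC.
Qed.

Lemma bS_quantile r : bS m r N = c * 0 ^+ r + \sum_(j < N) a r j * (c - bW j).
Proof.
rewrite /bS.
have E (i : 'I_N.+1) : (i%:R / N%:R) ^+ r = 0 ^+ r + \sum_(j < N) a r j * (j < i)%N%:R.
  have iN : (i <= N)%N by rewrite -ltnS.
  rewrite -[LHS](subrK (0 ^+ r)) addrC -sum_pow_step (big_ord_widen _ (a r) iN) big_mkcond /=.
  by congr (_ + _); apply: eq_bigr => j _; case: ifP => _; rewrite ?mulr1 ?mulr0.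
under eq_bigr do rewrite E mulrDr.
rewrite big_split /= -mulr_suml sum_bw -/c; congr (_ + _).
under eq_bigr do rewrite mulr_sumr.
rewrite exchange_big /=; apply: eq_bigr => j _.
under eq_bigr do rewrite mulrCA; rewrite -mulr_sumr; congr (_ * _).
have -> : c = \sum_(i < N.+1) bw m N i by rewrite sum_bw.
have jN : (j < N.+1)%N by rewrite ltnS ltnW.
rewrite /bW (big_ord_widen _ (bw m N) jN) [X in _ - X]big_mkcond /= -sumrB.
apply: eq_bigr => i _; rewrite ltnS ltnNge; case: ifP => _ /=; rewrite ?mulr0 ?mulr1 ?subrr ?subr0//.
Qed.

(** By Abel summation the moment combines the lengths c - bW j with weights [a r j]; the Riemann sum
    is the same combination of the lengths of {t : bW j <= t} as measured by the grid. Each length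
    is missed by at most one step c/K and the weights add up to at most 1, so the bound does not
    involve [N]. *)
Lemma quantile_riemann r K : (0 < K)%N ->
  `|c / K%:R * \sum_(i < K) quantile (c / K%:R * i%:R) ^+ r - bS m r N| <= c / K%:R.
Proof.
move=> K0; have c0 := m0_ge0; have K0' : 0 < K%:R :> R by rewrite ltr0n.
have h0 : 0 <= c / K%:R by rewrite divr_ge0// ltW.
under eq_bigr do rewrite quantileX.
rewrite big_split /= sumr_const card_ord bS_quantile mulrDr.
have -> : c / K%:R * (0 ^+ r *+ K) = c * 0 ^+ r.
  by rewrite -mulr_natr; field; rewrite gt_eqF.
rewrite exchange_big /= mulr_sumr opprD addrACA subrr add0r -sumrB.
apply: le_trans (ler_norm_sum _ _ _) _.
apply: (@le_trans _ _ (\sum_(j < N) a r j * (c / K%:R))).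
  apply: ler_sum => j _; rewrite -mulr_sumr mulrCA -mulrBr normrM (ger0_norm (pow_step_ge0 r j)).
  apply: ler_wpM2l; first exact: pow_step_ge0.
  have [c00|c00] := eqVneq c 0.
    rewrite c00 !mul0r sub0r opprB subr0.
    have -> : bW j = 0 by apply/le_anti; rewrite bW_ge0 andbT -c00 bW_le// ltnW.
    by rewrite normr0.
  have cgt : 0 < c by rewrite lt_neqAle eq_sym c00.
  have hgt : 0 < c / K%:R by rewrite divr_gt0.
  pose b := bW j / (c / K%:R).
  have b0 : 0 <= b by rewrite divr_ge0// bW_ge0.
  have bK : b <= K%:R.
    by rewrite /b ler_pdivrMr// mulrCA mulfV ?gt_eqF// mulr1 bW_le// ltnW.
  have [h1 h2] := count_threshold b0 bK.
  have -> : \sum_(i < K) (bW j <= c / K%:R * i%:R)%R%:R = \sum_(i < K) (b <= i%:R)%R%:R :> R.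
    by apply: eq_bigr => i _; rewrite /b ler_pdivrMr// mulrC.
  set s := \sum_(i < K) _ in h1 h2 *.
  have -> : c / K%:R * s - (c - bW j) = c / K%:R * (s - (K%:R - b)).
    by rewrite /b; field; rewrite c00 gt_eqF.
  rewrite normrM (ger0_norm h0) -[leRHS]mulr1 ler_wpM2l//.
  by rewrite ler_norml; apply/andP; split; lra.
rewrite -mulr_suml sum_pow_step -[leRHS]mul1r ler_wpM2r// lerBlDr.
have [N0|N0] := posnP N; first by rewrite N0 mul0r lerDr.
by rewrite mulfV ?pnatr_eq0 -?lt0n// expr1n lerDl exprn_ge0.
Qed.

End fixed_level.

End quantile.

(** * Limits along an ultrafilter *)

Section ultra_limit.
Context (R : realType).

Lemma fmap_ultra (T T' : Type) (U : set_system T) (f : T -> T') :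
  UltraFilter U -> UltraFilter (f @ U)%classic.
Proof.
move=> UU; apply: Build_UltraFilter => G PG UG; apply/seteqP; split => // A GA.
have [//|UnA] := @in_ultra_setVsetC _ U (f @^-1` A) UU.
have : G (A `&` ~` A) by apply: filterI => //; exact: UG.
by rewrite setICr => /filter_not_empty.
Qed.

Lemma ultra_cvg (U : set_system nat) (f : nat -> R) : UltraFilter U ->
  (forall n, 0 <= f n <= 1) -> exists2 l : R, 0 <= l <= 1 & f @ U --> l.
Proof.
move=> UU f01; have := @segment_compact R 0 1; rewrite compact_ultra => cpt.
have UfU := fmap_ultra f UU.
have [|l [/= l01 fl]] := cpt (f @ U)%classic UfU.
  by apply: nearW => n; rewrite /= in_itv /=; exact: f01.
by exists l => //; rewrite in_itv /= in l01.
Qed.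

End ultra_limit.

Lemma cvg_exprn (R : realType) (T : Type) (F : set_system T) {FF : Filter F} (f : T -> R) (l : R) r :
  f @ F --> l -> (fun t => f t ^+ r) @ F --> l ^+ r.
Proof.
move=> fl; elim: r => [|r IH]; first by rewrite expr0; exact: cvg_cst.
by under eq_fun do rewrite exprS; rewrite exprS; exact: cvgM.
Qed.

(** * Riemann sums of monotone functions *)

Section riemann_sum.
Context (R : realType).
Local Notation lambda := (@lebesgue_measure R).

Lemma integral_monotone_bounds (f : R -> R) (h : R) (K : nat) : 0 < h ->
  (forall s t, s <= t -> f s <= f t) -> (forall t, 0 <= f t) ->
  ((h * \sum_(i < K) f (h * i%:R))%:E <= \int[lambda]_(t in `[0%R, (h * K%:R)%R[) (f t)%:E)%E /\
  (\int[lambda]_(t in `[0%R, (h * K%:R)%R[) (f t)%:E <= (h * \sum_(i < K) f (h * i.+1%:R))%:E)%E.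
Proof.
move=> h0 fm f0.
have mf D : measurable D -> measurable_fun D (EFin \o f).
  by move=> mD; apply/measurable_EFinP; apply: nondecreasing_measurable.
elim: K => [|K [IH1 IH2]].
  rewrite !big_ord0 mulr0 set_itvco0 integral_set0; split => //.
have hK : h * K%:R <= h * K.+1%:R by rewrite ler_pM2l// ler_nat.
have K0 : 0 <= h * K%:R by rewrite mulr_ge0// ltW.
have -> : `[0%R, h * K.+1%:R[%classic = `[0%R, h * K%:R[%classic `|` `[h * K%:R, h * K.+1%:R[%classic.
  by rewrite -itv_bndbnd_setU// bnd_simp.
rewrite ge0_integral_setU//=; last 3 first.
- by apply: mf; exact: measurableU.
- by move=> t _; rewrite lee_fin.
- apply/disj_setPS => t [] /=; rewrite !in_itv /= => /andP[_ t1] /andP[t2 _].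
  by move: (lt_le_trans t1 t2); rewrite ltxx.
have leng : lambda `[h * K%:R, h * K.+1%:R[%classic = h%:E.
  rewrite lebesgue_measure_itv /= lte_fin ltr_pM2l// ltr_nat ltnSn.
  by rewrite -EFinB -mulrBr -natr1 addrAC subrr add0r mulr1.
have step (g : R) : (\int[lambda]_(t in `[(h * K%:R)%R, (h * K.+1%:R)%R[) g%:E = (h * g)%:E)%E.
  by rewrite integral_cst//= leng EFinM muleC.
rewrite !big_ord_recr /= !mulrDr !EFinD; split; apply: leeD => //.
  rewrite -step//; apply: ge0_le_integral => //.
  - by move=> t _; rewrite lee_fin.
  - exact: mf.
  - by move=> t /=; rewrite in_itv /= => /andP[ht _]; rewrite lee_fin fm.
rewrite -step//; apply: ge0_le_integral => //.
- by move=> t _; rewrite lee_fin.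
- exact: mf.
- by move=> t /=; rewrite in_itv /= => /andP[_ /ltW ht]; rewrite lee_fin fm.
Qed.

Lemma integral_monotone_riemann (f : R -> R) (c : R) (K : nat) : 0 < c -> (0 < K)%N ->
  (forall s t, s <= t -> f s <= f t) -> (forall t, 0 <= f t <= 1) ->
  `|Rintegral lambda `[0%R, c[ f - c / K%:R * \sum_(i < K) f (c / K%:R * i%:R)| <= c / K%:R.
Proof.
move=> c0 K0 fm f01; have K0' : 0 < K%:R :> R by rewrite ltr0n.
have h0 : 0 < c / K%:R by rewrite divr_gt0.
have f0 t : 0 <= f t by have /andP[] := f01 t.
have [] := integral_monotone_bounds K h0 fm f0.
rewrite divfK ?gt_eqF//; set I := integral _ _ _ => h1 h2.
have If : I \is a fin_num.
  rewrite ge0_fin_numE; first by apply: le_lt_trans h2 _; exact: ltry.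
  by apply: integral_ge0 => t _; rewrite lee_fin.
rewrite /Rintegral -/I; move: h1 h2; rewrite -(fineK If) !lee_fin /= => h1 h2.
rewrite ger0_norm ?subr_ge0// lerBlDl; apply: le_trans h2 _.
rewrite -lerBlDl -mulrBr -sumrB.
have -> : \sum_(i < K) (f (c / K%:R * i.+1%:R) - f (c / K%:R * i%:R)) =
   f (c / K%:R * K%:R) - f (c / K%:R * 0%:R).
  by rewrite -(big_mkord xpredT (fun i => f (c / K%:R * i.+1%:R) - f (c / K%:R * i%:R))) telescope_sumr.
rewrite -[leRHS]mulr1; apply: ler_wpM2l; first exact: ltW.
have /andP[_ h] := f01 (c / K%:R * K%:R).
by rewrite lerBlDr (le_trans h)// lerDl.
Qed.

End riemann_sum.

(** * The moment problem on [0, 1] *)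

Section hausdorff01.
Context (R : realType).
Local Notation lambda := (@lebesgue_measure R).

(** One ultrafilter gives limits at all real t simultaneously. The limit is monotone, hence
    measurable, and its integral differs from a Riemann sum by at most m 0 / K, as do the level-N
    moments, uniformly in N. This replaces dominated convergence, which fails along ultrafilters in
    general. *)
Lemma quantile_limit (m : nat -> R) : pos01 m -> 0 < m 0%N ->
  exists q : R -> R, [/\ forall s t, s <= t -> q s <= q t, forall t, 0 <= q t <= 1 &
    forall r, Rintegral lambda `[0%R, m 0%N[ (fun t => q t ^+ r) = m r].
Proof.
move=> pm m0; have [U [UU oU]] := @ultraFilterLemma nat \oo _.
have PU : ProperFilter U by exact: ultra_proper.
have /choice[q qP] (t : R) : exists l : R, 0 <= l <= 1 /\ (quantile m ^~ t) @ U --> l.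
  have [l] := ultra_cvg UU (fun N => quantile01 m N t).
  by exists l.
have q_mono s t : s <= t -> q s <= q t.
  move=> st; have [_ qs] := qP s; have [_ qt] := qP t.
  apply: (ler_cvg_to qs qt).
  by apply: nearW => N; exact: quantile_mono.
exists q; split => //; first by move=> t; have [] := qP t.
move=> r; have qr_mono s t : s <= t -> q s ^+ r <= q t ^+ r.
  move=> st; have [/andP[s0 _] _] := qP s; have [/andP[t0 _] _] := qP t.
  by apply: lerXn2r; rewrite ?nnegrE// q_mono.
have qr01 t : 0 <= q t ^+ r <= 1.
  by have [/andP[t0 t1] _] := qP t; rewrite exprn_ge0// exprn_ile1.
have bound K : (0 < K)%N -> `|Rintegral lambda `[0%R, m 0%N[ (fun t => q t ^+ r) - m r| <= (m 0%N / K%:R) * 2.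
  move=> K0; have h1 := integral_monotone_riemann m0 K0 qr_mono qr01.
  set h := m 0%N / K%:R in h1 *; set I := Rintegral _ _ _ in h1 *.
  pose S := h * \sum_(i < K) q (h * i%:R) ^+ r.
  have h2 : `|S - m r| <= h.
    have cv : (fun N => `|h * \sum_(i < K) quantile m N (h * i%:R) ^+ r - bS m r N|) @ U --> `|S - m r|.
      apply: cvg_norm; apply: cvgB.
        apply: cvgMr; apply: cvg_big => // [|i _]; first exact: add_continuous.
        apply: cvg_exprn; by have [] := qP (h * i%:R).
      by apply: cvg_trans (cvg_bS (a := r) pm); apply: cvg_app.
    apply: (ler_cvg_to cv (cvg_cst h)); apply: nearW => N.
    exact: quantile_riemann.
  rewrite mulrDr mulr1; have -> : I - m r = (I - S) + (S - m r) by rewrite addrA subrK.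
  by apply: le_trans (ler_normD _ _) _; apply: lerD.
apply/eqP; rewrite -subr_eq0 -normr_eq0; apply/negPn/negP => ne.
have pos : 0 < `|Rintegral lambda `[0%R, m 0%N[ (fun t => q t ^+ r) - m r|.
  by rewrite lt_neqAle eq_sym ne normr_ge0.
set D := `|_| in pos bound.
pose x : R := m 0%N * 2 / D; have hx := truncnS_gt x.
have := bound (Num.truncn x).+1 isT.
rewrite mulrAC ler_pdivlMr ?ltr0n// leNgt => /negP; apply.
by rewrite [ltRHS]mulrC -ltr_pdivrMr//; exact: hx.
Qed.

End hausdorff01.

(** * The moment problem on [-1, 1] *)

Section hausdorff.
Context (R : realType).
Local Notation lambda := (@lebesgue_measure R).
Implicit Types m : nat -> R.

(* m is a moment sequence on [-1, 1] iff its moment functional is nonnegative on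
   products of powers of the linear polynomials nonnegative on [-1, 1] *)
Definition pos11 m := forall i j, 0 <= Lm m ((1 + 'X) ^+ i * (1 - 'X) ^+ j).

(** The affine map from [-1, 1] onto [0, 1]; 1 + X and 1 - X are twice z and twice 1 - z. *)
Let z : {poly R} := 2^-1 *: (1 + 'X).

Lemma pos11_pos01 m : pos11 m -> pos01 (fun i => Lm m (z ^+ i)).
Proof.
move=> pm i j; rewrite (Lm_comp (m := m) (z := z))// rmorphM !rmorphXn rmorphB /= comp_polyX rmorph1.
have -> : 1 - z = 2^-1 *: (1 - 'X).
  have -> : (1 : {poly R}) - z = (2^-1 + 2^-1 : R) *: 1 - z.
    by rewrite -[X in X *: 1]/(2^-1 + 2^-1) (_ : 2^-1 + 2^-1 = 1 :> R) ?scale1r//; field.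
  by rewrite /z scalerDl scalerDr opprD addrACA subrr add0r scalerBr.
by rewrite /z !exprZn -scalerAl -scalerAr scalerA LmZ mulr_ge0.
Qed.

Lemma Lm_comp_affine m p : Lm m (p \Po (2 *: z - 1)) = Lm m p.
Proof.
suff -> : 2 *: z - 1 = 'X by rewrite comp_polyXr.
by rewrite /z scalerA mulfV// scale1r addrAC subrr add0r.
Qed.

(* Hausdorff's moment theorem on [-1, 1]: the measure is the image of Lebesgue
   measure on [0, m 0[ under an ultrafilter limit of the quantile functions of
   the Bernstein weights *)
Lemma hausdorff m : pos11 m -> exists mu : {measure set R -> \bar R},
  mu (~` `[-1, 1]%classic) = 0%E /\ forall k, ((m k)%:E = \int[mu]_x (x ^+ k)%:E)%E.
Proof.
move=> pm; pose n i := Lm m (z ^+ i); have pn : pos01 n := pos11_pos01 pm.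
have mn p : Lm n p = Lm m (p \Po z) by exact: Lm_comp.
have n0 : n 0%N = m 0%N by rewrite /n expr0 Lm1.
have mE p : Lm m p = Lm n (p \Po (2 *: 'X - 1)).
  rewrite mn -comp_polyA comp_polyB comp_polyZ comp_polyX comp_polyC.
  by rewrite Lm_comp_affine.
(* Zero mass is treated apart, as the domain [0, m 0[ of the quantile function must not be empty:
   all Bernstein weights vanish, hence all moments. *)
have [m0|m0] := eqVneq (m 0%N) 0.
  have nz i : n i = 0.
    rewrite -(cvg_lim _ (cvg_bS (a := i) pn))//.
    have -> : bS n i = fun=> 0; last exact: lim_cst.
    apply/funext => N; apply: big1 => j _.
    suff -> : bw n N j = 0 by rewrite mul0r.
    apply/le_anti; rewrite bw_ge0// andbT -[leRHS](etrans n0 m0) -(sum_bw n N).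
    by rewrite (bigD1 j)//= lerDl sumr_ge0// => k _; exact: bw_ge0.
  exists mzero; split => // k.
  rewrite integral_measure_zero -LmXn mE /Lm big1// => i _.
  by rewrite nz mulr0.
have {}m0 : 0 < n 0%N.
  by rewrite n0 lt_neqAle eq_sym m0 -n0; exact: (m0_ge0 0 pn).
have [q [qm q01 qI]] := quantile_limit pn m0.
pose c := n 0%N; pose D : set R := `[0%R, c[%classic.
have mD : measurable D by exact: measurable_itv.
have lD : lambda D = c%:E.
  by rewrite lebesgue_measure_itv /= lte_fin m0 -EFinB subr0.
pose f t := 2 * q t - 1.
have mq : measurable_fun setT q by exact: nondecreasing_measurable.
have mf : measurable_fun setT f by apply: measurable_funB => //; exact: measurable_funM.
have ipol p : lambda.-integrable D (EFin \o (fun t => p.[q t])).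
  apply: measurable_bounded_integrable => //.
  - by rewrite [ltLHS]lD ltry.
  - apply: (@measurable_funS _ _ _ _ setT) => //.
    under eq_fun do rewrite horner_coef; apply: measurable_sum => i.
    by apply: measurable_funM => //; exact: measurable_funX.
  - exists (\sum_(i < size p) `|p`_i|); split; first exact: num_real.
    move=> M ltM t _ /=; apply/ltW/(le_lt_trans _ ltM).
    rewrite horner_coef; apply: le_trans (ler_norm_sum _ _ _) _; apply: ler_sum => i _.
    rewrite normrM -[leRHS]mulr1 ler_wpM2l// normrX.
    have /andP[h0 h1] := q01 t.
    by rewrite (ger0_norm h0) exprn_ile1.
have LI p : Rintegral lambda D (fun t => p.[q t]) = Lm n p.
  apply: (@Lm_ind _ n (fun p => Rintegral lambda D (fun t => p.[q t]))).
  - move=> p1 p2; under eq_Rintegral do rewrite hornerD; rewrite RintegralD//.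
  - move=> a p1; under eq_Rintegral do rewrite hornerZ; rewrite RintegralZl//.
  - by move=> k; rewrite -qI; apply: eq_Rintegral => t _; rewrite hornerXn.
have mf' : @measurable_fun _ _ (measurableTypeR R) R setT f by exact: mf.
pose F : {mfun measurableTypeR R >-> R} := @mfun_Sub _ _ (measurableTypeR R) R f (mem_set mf').
have FE t : F t = f t by [].
exists (distribution_restr lambda mD F); split.
  rewrite [LHS](distribution_restrE lambda mD F).
  rewrite (_ : D `&` _ = set0) ?measure0//; apply/seteqP; split => // t [_ /=].
  rewrite in_itv /= /f; have /andP[h0 h1] := q01 t; apply; apply/andP; split; lra.
move=> k; rewrite integral_distribution_restr_signed//; last first.
  by apply/measurable_EFinP; exact: measurable_funX.
have E t : F t ^+ k = ('X^k \Po (2 *: 'X - 1)).[q t].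
  by rewrite FE horner_comp hornerXn hornerD hornerZ hornerX hornerN hornerC.
under eq_integral do rewrite E.
rewrite -LmXn mE -LI fineK//.
have mD' : @measurable _ (measurableTypeR R) D by exact: mD.
exact: (@integrable_fin_num _ (measurableTypeR R) R lambda D mD' _ (ipol _)).
Qed.

End hausdorff.

(** * Moment sequences described without measures *)

Section moment_seq.
Context (R : realType).
Implicit Types (m : int -> R) (b : R).

(** With the converse [moment_seq_of_bounds] this characterizes [moment_seq] by evenness, positivity
    and geometric decay. *)
Lemma moment_seq_bounds b m : 0 <= b <= 1 -> moment_seq b m ->
  [/\ forall k, m k = m `|k|%N, pos11 (fun n : nat => m n) &
      forall n : nat, `|m n| <= m 0 * b ^+ n].
Proof.
move=> /andP[b0 b1] [mu [mu0 muE]].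
pose D : set R := `[- b, b]%classic.
have mD : measurable D by exact: measurable_itv.
have DE x : D x -> `|x| <= b by rewrite /D /= in_itv /= ler_norml.
have m0E : mu setT = (m 0)%:E.
  by rewrite muE; under eq_integral do rewrite expr0; rewrite integral_cst// mul1e.
have intD (f : R -> R) : measurable_fun setT f ->
    (\int[mu]_x (f x)%:E = \int[mu]_(x in D) (f x)%:E)%E.
  move=> mf; rewrite [RHS]integral_mkcond; apply: ae_eq_integral => //.
  - exact/measurable_EFinP.
  - apply/(measurable_restrict _ mD) => //; apply: measurable_funTS; exact/measurable_EFinP.
  - exists (~` D); split => //; first exact: measurableC.
    move=> x /= h Dx; apply: h => _; rewrite patchE mem_set//.
have muD : mu D = (m 0)%:E.
  rewrite -m0E -[setT](setvU D) setUC measureU//; last by rewrite setICr.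
    by rewrite [X in _ = (_ + X)%E]mu0 adde0.
  exact: measurableC.
have ib (f : R -> R) M : measurable_fun setT f -> (forall x, D x -> `|f x| <= M) ->
    mu.-integrable D (EFin \o f).
  move=> mf fM; apply: measurable_bounded_integrable => //.
  - by rewrite [ltLHS]muD ltry.
  - exact: measurable_funTS.
  - exists M; split; first exact: num_real.
    by move=> M' ltM t Dt /=; apply/ltW/(le_lt_trans _ ltM)/fM.
have mX k : measurable_fun setT (fun x : R => x ^+ k) by exact: measurable_funX.
have mp (p : {poly R}) : measurable_fun setT (fun x : R => p.[x]).
  under eq_fun do rewrite horner_coef; apply: measurable_sum => i.
  by apply: measurable_funM => //; exact: measurable_funX.
have ip (p : {poly R}) : mu.-integrable D (EFin \o (fun x => p.[x])).
  apply: (ib _ (\sum_(i < size p) `|p`_i|) (mp p)) => x Dx.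
  rewrite horner_coef; apply: le_trans (ler_norm_sum _ _ _) _; apply: ler_sum => i _.
  rewrite normrM -[leRHS]mulr1 ler_wpM2l// normrX exprn_ile1//.
  exact: le_trans (DE _ Dx) b1.
have LI (p : {poly R}) : Rintegral mu D (fun x => p.[x]) = Lm (fun n : nat => m n) p.
  apply: (@Lm_ind _ (fun n : nat => m n) (fun p => Rintegral mu D (fun x => p.[x]))).
  - by move=> p1 p2; under eq_Rintegral do rewrite hornerD; rewrite RintegralD.
  - by move=> a p1; under eq_Rintegral do rewrite hornerZ; rewrite RintegralZl.
  - move=> k; under eq_Rintegral do rewrite hornerXn.
    rewrite /Rintegral -(intD _ (mX k)); transitivity (fine (m k)%:E) => //.
    by rewrite muE.
split.
- by move=> k; apply: EFin_inj; rewrite !muE; apply: eq_integral => x _; rewrite absz_nat.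
- move=> i j; rewrite -LI; apply: Rintegral_ge0 => x /DE; rewrite ler_norml => /andP[h1 h2].
  by rewrite hornerM !horner_exp !hornerD hornerN hornerX hornerC mulr_ge0// exprn_ge0//; lra.
- move=> n; rewrite -[m n]/((fun n : nat => m n) n) -LmXn -LI.
  apply: le_trans (le_normr_Rintegral _ _) _ => //.
  apply: (@le_trans _ _ (Rintegral mu D (fun=> b ^+ n))).
    apply: le_Rintegral => //.
    + apply: (ib _ 1) => [|x Dx]; first exact: measurableT_comp.
      by rewrite normr_id hornerXn normrX exprn_ile1// (le_trans (DE _ Dx)).
    + by apply: (ib _ (b ^+ n)) => // x _; rewrite ger0_norm// exprn_ge0.
    + by move=> x Dx; rewrite hornerXn normrX lerXn2r ?nnegrE//; exact: DE.
  by rewrite Rintegral_cst// [X in fine X]muD /= mulrC.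
Qed.

Lemma measurable_ge_norm (e : R) : measurable [set x : R | e <= `|x|].
Proof.
rewrite (_ : [set x | _] = (fun x : R => `|x|) @^-1` `[e, +oo[%classic); last first.
  by apply/seteqP; split => x /=; rewrite in_itv /= andbT.
rewrite -[_ @^-1` _]setTI; exact: normr_measurable.
Qed.

Lemma measure_itv0 (mu : {measure set R -> \bar R}) b :
  (forall e, b < e -> mu [set x | e <= `|x|] = 0%E) -> mu (~` `[- b, b]%classic) = 0%E.
Proof.
move=> h; pose A n := [set x : R | b + n.+1%:R^-1 <= `|x|].
have mA n : measurable (A n) by exact: measurable_ge_norm.
apply/eqP; rewrite eq_le measure_ge0 andbT.
apply: (@le_trans _ _ (\sum_(n <oo) mu (A n))%E).
  apply: measure_sigma_subadditive => //; first by apply: measurableC; exact: measurable_itv.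
  move=> x /= /negP; rewrite in_itv /= -ler_norml -ltNge => bx.
  have [n _ hn] := @near_infty_natSinv_lt R (PosNum (etrans (subr_gt0 b `|x|) bx)).
  exists n => //; rewrite /A /= addrC -lerBrDr ltW//; exact: (hn n (leqnn n)).
by rewrite eseries0// => n _ _; apply: h; rewrite ltrDl invr_gt0.
Qed.

(** Markov's inequality for even powers: the mass of {|x| >= e} is at most C (b/e)^(2n) for all n,
    hence 0 when e > b. The decay is asked at even lags, where autocovariances are variances. *)
Lemma moment_seq_of_bounds b m : 0 <= b ->
  (forall k, m k = m `|k|%N) -> pos11 (fun n : nat => m n) ->
  (exists C, forall n : nat, m (n.*2) <= C * b ^+ n.*2) -> moment_seq b m.
Proof.
move=> b0 me /hausdorff[mu [mu0 muE]] [C mC]; exists mu; split; last first.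
  by move=> k; rewrite me -muE.
apply: measure_itv0 => e be; set A := [set x | _].
have mA : measurable A by exact: measurable_ge_norm.
have muT : mu setT = (m 0)%:E.
  by rewrite [(m 0)%:E]muE; under eq_integral do rewrite expr0; rewrite integral_cst// mul1e.
have fA : mu A \is a fin_num.
  rewrite ge0_fin_numE ?measure_ge0//; apply: le_lt_trans (le_measure _ _ _ (@subsetT _ A)) _; rewrite ?inE//.
  by rewrite [ltLHS]muT ltry.
have e0 : 0 < e by exact: le_lt_trans b0 be.
have bnd n : fine (mu A) <= C * (b ^+ 2 / e ^+ 2) ^+ n.
  rewrite exprMn exprVn -!exprM !mul2n mulrA ler_pdivlMr ?exprn_gt0//.
  apply: le_trans (mC n); rewrite -lee_fin muE EFinM fineK//.
  have -> : (mu A * (e ^+ n.*2)%:E = \int[mu]_(x in A) (e ^+ n.*2)%:E)%E.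
    by rewrite integral_cst// muleC.
  apply: (@le_trans _ _ (\int[mu]_(x in A) (x ^+ n.*2)%:E)%E).
    apply: ge0_le_integral => //.
    - by move=> x _; rewrite lee_fin exprn_ge0// ltW.
    - by apply/measurable_EFinP; apply: measurable_funTS; exact: measurable_funX.
    - move=> x Ax; rewrite lee_fin -mul2n !exprM lerXn2r// ?nnegrE ?sqr_ge0//.
      by rewrite -[x ^+ 2]real_normK ?num_real// lerXn2r ?nnegrE// ltW.
  apply: ge0_subset_integral => //.
  - by apply/measurable_EFinP; exact: measurable_funX.
  - by move=> x _; rewrite lee_fin -mul2n exprM exprn_ge0// sqr_ge0.
have : (fun n => C * (b ^+ 2 / e ^+ 2) ^+ n) @ \oo --> C * 0.
  apply: cvgMr; apply: cvg_expr; rewrite ger0_norm ?divr_ge0 ?sqr_ge0//.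
  by rewrite ltr_pdivrMr ?exprn_gt0// mul1r ltrXn2r// ?nnegrE// ltW.
rewrite mulr0 => c0.
have : fine (mu A) <= 0 by apply: (ler_cvg_to (cvg_cst _) c0); exact: nearW.
rewrite -lee_fin fineK// => h.
by apply/eqP; rewrite eq_le h measure_ge0.
Qed.

End moment_seq.

(** * Projection onto moment sequences *)

Section sumZ.
Context (R : realType).
Implicit Types (a b : int -> R) (c : R).

(** Partial sum over the window |k| <= N; its limit is [sumZ]. *)
Definition win a N : R := \sum_(i < (N + N).+1) a (i%:Z - N%:Z).

Lemma winS a N : win a N.+1 = win a N + (a (N.+1%:Z) + a (- N.+1%:Z)).
Proof.
rewrite /win addSn addnS big_ord_recl big_ord_recr /= addrCA.
congr (_ + _); last rewrite addrC.
  apply: eq_bigr => i _; congr a; rewrite /bump /= !intS; lia.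
congr (_ + _); congr a; rewrite /bump /=; lia.
Qed.

Lemma winE a N : win a N = a 0 + \sum_(k < N) (a k.+1%:Z + a (- k.+1%:Z)).
Proof.
elim: N => [|N IH]; last by rewrite winS IH [in RHS]big_ord_recr /= -!addrA.
by rewrite /win big_ord0 addr0 big_ord_recr big_ord0; exact: add0r.
Qed.

Lemma winD a b N : win (fun k => a k + b k) N = win a N + win b N.
Proof. by rewrite /win big_split. Qed.

Lemma winZ t a N : win (fun k => t * a k) N = t * win a N.
Proof. by rewrite /win mulr_sumr. Qed.

Lemma le_win a b N : (forall k, a k <= b k) -> win a N <= win b N.
Proof. by move=> h; apply: ler_sum. Qed.

Lemma win_ge0 a N : (forall k, 0 <= a k) -> 0 <= win a N.
Proof. by move=> h; apply: sumr_ge0. Qed.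

Lemma win_norm a N : `|win a N| <= win (fun k => `|a k|) N.
Proof. exact: ler_norm_sum. Qed.

Lemma win_nondecreasing a : (forall k, 0 <= a k) -> nondecreasing_seq (win a).
Proof.
by move=> a0; apply/nondecreasing_seqP => n; rewrite winS lerDl addr_ge0.
Qed.

Lemma le_win_term a k N : (forall k, 0 <= a k) -> (`|k| <= N)%N -> a k <= win a N.
Proof.
move=> a0 kN; have h : (`|(k + N%:Z)%R|%N < (N + N).+1)%N by lia.
have kE : k = (Ordinal h)%:Z - N%:Z by move=> /=; lia.
by rewrite [in leLHS]kE /win (bigD1 (Ordinal h))//= lerDl sumr_ge0.
Qed.

Section geometric.
Variable c : R.
Hypothesis c01 : 0 < c < 1.
Let c0 : 0 < c. Proof. by case/andP: c01. Qed.
Let c1 : c < 1. Proof. by case/andP: c01. Qed.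

(** The constant is explicit because limits in the sample size require it to be uniform, whereas the
    ratio [c] stays fixed. *)
Definition geo a C := forall k, `|a k| <= C * c ^+ `|k|%N.

Lemma geo_ge0 a C : geo a C -> 0 <= C.
Proof. by move=> /(_ 0); rewrite expr0 mulr1; apply: le_trans. Qed.

Lemma geo_norm a C : geo a C -> geo (fun k => `|a k|) C.
Proof. by move=> h k; rewrite normr_id. Qed.

Lemma geoD a b A B : geo a A -> geo b B -> geo (fun k => a k + b k) (A + B).
Proof. by move=> ha hb k; rewrite mulrDl (le_trans (ler_normD _ _))// lerD. Qed.

Lemma geoZ t a A : geo a A -> geo (fun k => t * a k) (`|t| * A).
Proof. by move=> ha k; rewrite normrM -mulrA ler_wpM2l. Qed.

Lemma geoB a b A B : geo a A -> geo b B -> geo (fun k => a k - b k) (A + B).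
Proof. by move=> ha hb k; rewrite mulrDl (le_trans (ler_normB _ _))// lerD. Qed.

Lemma geoM a b A B : geo a A -> geo b B -> geo (fun k => a k * b k) (A * B).
Proof.
move=> ha hb k; rewrite normrM (le_trans (ler_pM _ _ (ha k) (hb k)))//.
rewrite mulrACA -[leRHS]mulr1 mulrA ler_wpM2l ?exprn_ile1 ?(ltW c0) ?(ltW c1)//.
by rewrite !mulr_ge0 ?exprn_ge0 ?(geo_ge0 ha) ?(geo_ge0 hb) ?(ltW c0).
Qed.

Lemma geo_pair a C n : geo a C -> `|a n.+1%:Z + a (- n.+1%:Z)| <= 2 * C * c ^+ n.
Proof.
move=> ga; have C0 := geo_ge0 ga; apply: le_trans (ler_normD _ _) _.
have -> : 2 * C * c ^+ n = C * c ^+ n + C * c ^+ n by ring.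
have cS : c ^+ n.+1 <= c ^+ n by rewrite exprS ler_piMl// ?exprn_ge0// ltW.
apply: lerD; first by apply: le_trans (ga _) _; rewrite ler_wpM2l.
by apply: le_trans (ga _) _; rewrite abszN ler_wpM2l.
Qed.

Lemma geo_tail a C K N : geo a C -> (K <= N)%N ->
  `|win a N - win a K| <= 2 * C * (c ^+ K / (1 - c)).
Proof.
move=> ga KN; have C0 := geo_ge0 ga.
have d0 : 0 < 1 - c by rewrite subr_gt0.
(* The exact finite geometric sum, in place of its bound, makes the induction on N close. *)
suff h : `|win a N - win a K| <= 2 * C * ((c ^+ K - c ^+ N) / (1 - c)).
  apply: le_trans h _; rewrite ler_wpM2l ?mulr_ge0// ler_wpM2r ?invr_ge0 ?(ltW d0)//.
  by rewrite gerBl exprn_ge0// ltW.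
elim: N KN => [|N IH].
  by rewrite leqn0 => /eqP ->; rewrite !subrr normr0 mul0r mulr0.
rewrite leq_eqVlt => /predU1P[->|]; first by rewrite !subrr normr0 mul0r mulr0.
rewrite ltnS => /IH h; rewrite winS addrAC.
apply: le_trans (ler_normD _ _) _.
have -> : 2 * C * ((c ^+ K - c ^+ N.+1) / (1 - c)) =
    2 * C * ((c ^+ K - c ^+ N) / (1 - c)) + 2 * C * c ^+ N.
  by rewrite exprS; field; rewrite gt_eqF.
apply: lerD => //; exact: geo_pair.
Qed.

Lemma cvg_win a C : geo a C -> win a @ \oo --> sumZ a.
Proof.
move=> ga; suff : cvgn (win a) by [].
have C0 := geo_ge0 ga.
pose s k := a k.+1%:Z + a (- k.+1%:Z).
have -> : win a = (fun N => a 0 + series s N).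
  by apply/funext => N; rewrite winE /series /= big_mkord.
apply: is_cvgD; first exact: is_cvg_cst.
apply: normed_cvg; apply: (@series_le_cvg _ _ (geometric (2 * C) c)).
- by move=> n; exact: normr_ge0.
- by move=> n; rewrite /= !mulr_ge0// exprn_ge0// ltW.
- move=> n; exact: geo_pair.
- by apply: is_cvg_geometric_series; rewrite ger0_norm// ltW.
Qed.

Lemma sumZD a b A B : geo a A -> geo b B ->
  sumZ (fun k => a k + b k) = sumZ a + sumZ b.
Proof.
move=> ga gb; apply: cvg_lim => //.
rewrite (_ : (fun N => _) = (fun N => win a N + win b N)).
  by apply: cvgD; [exact: cvg_win ga|exact: cvg_win gb].
by apply/funext => N; exact: winD.
Qed.

Lemma sumZZ t a A : geo a A -> sumZ (fun k => t * a k) = t * sumZ a.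
Proof.
move=> ga; apply: cvg_lim => //.
rewrite (_ : (fun N => _) = (fun N => t * win a N)).
  by apply: cvgMr; exact: cvg_win ga.
by apply/funext => N; exact: winZ.
Qed.

Lemma sumZB a b A B : geo a A -> geo b B ->
  sumZ (fun k => a k - b k) = sumZ a - sumZ b.
Proof.
move=> ga gb; have gN : geo (fun k => -1 * b k) B.
  by move=> k; rewrite mulN1r normrN.
rewrite -mulN1r -(sumZZ _ gb) -(sumZD ga gN).
by congr sumZ; apply/funext => k; rewrite mulN1r.
Qed.

Lemma win_le_sumZ a A N : (forall k, 0 <= a k) -> geo a A -> win a N <= sumZ a.
Proof.
move=> a0 ga; apply: nondecreasing_cvgn_le (win_nondecreasing a0) _ _.
by apply/cvg_ex; exists (sumZ a); exact: cvg_win ga.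
Qed.

Lemma sumZ_le a A B : geo a A -> (forall N, win a N <= B) -> sumZ a <= B.
Proof.
by move=> ga h; apply: (ler_cvg_to (cvg_win ga) (cvg_cst B)); exact: nearW.
Qed.

Lemma le_sumZ a b A B : geo a A -> geo b B -> (forall k, a k <= b k) ->
  sumZ a <= sumZ b.
Proof.
move=> ga gb h; apply: (ler_cvg_to (cvg_win ga) (cvg_win gb)).
by apply: nearW => N; exact: le_win.
Qed.

Lemma sumZ_norm a A : geo a A -> `|sumZ a| <= sumZ (fun k => `|a k|).
Proof.
move=> ga; apply: (ler_cvg_to (cvg_norm (cvg_win ga)) (cvg_win (geo_norm ga))).
by apply: nearW => N; exact: win_norm.
Qed.

Lemma sumZ_ge0 a A : geo a A -> (forall k, 0 <= a k) -> 0 <= sumZ a.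
Proof.
move=> ga h; apply: (ler_cvg_to (cvg_cst 0) (cvg_win ga)).
by apply: nearW => N; exact: win_ge0.
Qed.

Lemma le_sumZ_term a A k : geo a A -> (forall k, 0 <= a k) -> a k <= sumZ a.
Proof.
move=> ga a0; apply: le_trans (win_le_sumZ `|k|%N a0 ga).
exact: le_win_term.
Qed.

(** Tannery's theorem: the common constant makes the tails small uniformly in M, and a finite window
    tends to 0 termwise. *)
Lemma cvg_sumZ0 (a : nat -> int -> R) C : (forall M, geo (a M) C) ->
  (forall k, a M k @[M --> \oo] --> 0) -> sumZ (a M) @[M --> \oo] --> 0.
Proof.
move=> ga a0; apply/cvgrPdist_le => e e0.
have C0 := geo_ge0 (ga 0).
have : (fun K => 2 * C * (c ^+ K / (1 - c))) @ \oo --> 2 * C * (0 / (1 - c)).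
  by apply: cvgMr; apply: cvgMl; apply: cvg_expr; rewrite ger0_norm// ltW.
rewrite mul0r mulr0 => /cvgrPdist_le /(_ (e / 2)) /(_ (divr_gt0 e0 (ltr0n R 2))).
move=> [K _ /(_ K (leqnn K))]; rewrite sub0r normrN => hK.
have : win (a M) K @[M --> \oo] --> (\sum_(i < (K + K).+1) 0 : R).
  by apply: cvg_big => [|i _]; [exact: add_continuous|exact: a0].
rewrite big1// => /cvgrPdist_le /(_ (e / 2)) /(_ (divr_gt0 e0 (ltr0n R 2))).
apply: filterS => M; rewrite !sub0r !normrN => hM.
have : `|win (a M) N| @[N --> \oo] --> `|sumZ (a M)|.
  exact: cvg_norm (cvg_win (ga M)).
move=> /ler_cvg_to /(_ (cvg_cst e)); apply.
exists K => // N /= KN.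
rewrite -[win _ N](subrK (win (a M) K)) (le_trans (ler_normD _ _))// [e]splitr.
apply: lerD => //; apply: le_trans (geo_tail (ga M) KN) _.
exact: le_trans (ler_norm _) hK.
Qed.

End geometric.

Lemma win_fsbig a N :
  ((win a N)%:E = \sum_(k \in [set k : int | (`|k| <= N)%N]) (a k)%:E)%E.
Proof.
rewrite /win -sumEFin (fsbig_ord _ _ (fun i : nat => (a (i%:Z - N%:Z))%:E)).
apply/esym/(reindex_fsbig (fun i : nat => i%:Z - N%:Z)); split.
- by move=> i /=; lia.
- by move=> i j _ _; lia.
- by move=> k /= h; exists (`|(k + N%:Z)%R|%N) => /=; lia.
Qed.

(** The least-squares objective is an unordered sum; it equals the window limit because every finite
    set of lags lies in a window. *)
Lemma esum_int a c C : 0 < c < 1 -> geo c a C -> (forall k, 0 <= a k) ->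
  esum [set: int] (EFin \o a) = (sumZ a)%:E.
Proof.
move=> c01 ga a0.
have fW N : finite_set [set k : int | (`|k| <= N)%N].
  apply: (@sub_finite_set _ _ ((fun i : nat => i%:Z - N%:Z) @` `I_(N + N).+1)).
    by move=> k /= h; exists (`|(k + N%:Z)%R|%N) => /=; lia.
  exact: finite_image.
apply/eqP; rewrite eq_le; apply/andP; split.
  apply: ge_ereal_sup => _ [A [finA _] <-].
  have [N hN] : exists N : nat, forall k, A k -> (`|k| <= N)%N.
    have /finite_seqP[s ->] := finA; exists (\max_(k <- s) `|k|%N) => k /= ks.
    exact: (@leq_bigmax_seq _ s xpredT (fun k : int => `|k|%N)).
  apply: (@le_trans _ _ (win a N)%:E); last first.
    by rewrite lee_fin; exact: win_le_sumZ c01 _ _ _ _ _.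
  rewrite win_fsbig; apply: lee_fsum_nneg_subset => //.
    by move=> k; rewrite !inE; exact: hN.
  by move=> k _; rewrite lee_fin.
have : (fun N => (win a N)%:E) @ \oo --> (sumZ a)%:E.
  by apply: cvg_EFin; [exact: nearW|exact: cvg_win ga].
move=> /lee_cvg_to /(_ (cvg_cst _)); apply; apply: nearW => N.
by rewrite win_fsbig; apply: ereal_sup_ubound; exists [set k : int | (`|k| <= N)%N].
Qed.

End sumZ.

(** * Cone and closure properties of moment sequences *)

Section moment_seq_closure.
Context (R : realType).
Implicit Types (m : int -> R) (b : R).

Lemma Lm_lin s t (m m' : nat -> R) p :
  Lm (fun n => s * m n + t * m' n) p = s * Lm m p + t * Lm m' p.
Proof.
rewrite /Lm !mulr_sumr -big_split /=; apply: eq_bigr => i _; ring.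
Qed.

Lemma moment_seq_lin b s t m m' : 0 <= b <= 1 -> 0 <= s -> 0 <= t ->
  moment_seq b m -> moment_seq b m' -> moment_seq b (fun k => s * m k + t * m' k).
Proof.
move=> b01 s0 t0 /(moment_seq_bounds b01)[me mp mb] /(moment_seq_bounds b01)[me' mp' mb'].
apply: moment_seq_of_bounds; first by case/andP: b01.
- by move=> k; rewrite me me'.
- by move=> i j; rewrite (Lm_lin s t (fun n : nat => m n) (fun n : nat => m' n)) addr_ge0// mulr_ge0.
- exists (s * m 0 + t * m' 0) => n.
  rewrite mulrDl -!mulrA lerD// ler_wpM2l//; first exact: le_trans (ler_norm _) (mb _).
  exact: le_trans (ler_norm _) (mb' _).
Qed.

Lemma moment_seq0 b : 0 <= b -> moment_seq b (fun=> 0 : R).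
Proof.
by move=> b0; exists mzero; split => // k; rewrite integral_measure_zero.
Qed.

(** Positivity on a given polynomial involves finitely many lags, so it passes to pointwise limits.
    The filter is general because minimizing sequences are followed along an ultrafilter. *)
Lemma moment_seq_cvg b (F : set_system nat) {FF : ProperFilter F}
    (mm : nat -> int -> R) m : 0 <= b <= 1 -> (forall n, moment_seq b (mm n)) ->
  (forall k, mm n k @[n --> F] --> m k) -> moment_seq b m.
Proof.
move=> b01 mmb mm_m.
have /all_and3[me mp mb] := fun n => moment_seq_bounds b01 (mmb n).
have b0 : 0 <= b by case/andP: b01.
apply: moment_seq_of_bounds => //.
- move=> k; have h := mm_m k; rewrite (_ : mm ^~ k = mm ^~ (`|k|%N : int)) in h.
    exact: (cvg_unique (@norm_hausdorff _ R) h (mm_m _)).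
  by apply/funext => n; exact: me.
- move=> i j; set p := _ * _.
  have h : Lm (fun l : nat => mm n l) p @[n --> F] --> Lm (fun l : nat => m l) p.
    apply: cvg_big => [|l _]; [exact: add_continuous|].
    by apply: cvgMr; exact: mm_m.
  by apply: (ler_cvg_to (cvg_cst 0) h); apply: nearW => n; exact: mp.
- exists (m 0) => n.
  have h : mm k 0 * b ^+ n.*2 @[k --> F] --> m 0 * b ^+ n.*2 by apply: cvgMl; exact: mm_m.
  apply: (ler_cvg_to (mm_m n.*2) h).
  by apply: nearW => k; exact: le_trans (ler_norm _) (mb _ _).
Qed.

(** The ratio is relaxed from [b] to [c] because [b] may be 0, while the geometric estimates need a
    positive ratio. *)
Lemma moment_geo b c m : 0 <= b <= 1 -> b <= c -> moment_seq b m -> geo c m (m 0).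
Proof.
move=> b01 bc /(moment_seq_bounds b01)[me _ mb] k; rewrite me.
have m0 : 0 <= m 0 by have := mb 0%N; rewrite expr0 mulr1; apply: le_trans.
apply: le_trans (mb _) _; rewrite ler_wpM2l// lerXn2r ?nnegrE//; first by case/andP: b01.
by case/andP: b01 => ? _; exact: le_trans bc.
Qed.

End moment_seq_closure.

(** * Existence and variational inequality of the projection *)

Section projection.
Context (R : realType) (delta c : R) (r : int -> R) (Cr : R).
Hypothesis c01 : 0 < c < 1.
Hypothesis d01 : 0 <= 1 - delta <= 1.
Hypothesis dc : 1 - delta <= c.
Hypothesis gr : geo c r Cr.
Implicit Types m : int -> R.

Let sq m k := (r k - m k) ^+ 2.

Lemma geo_sqB a b A B : geo c a A -> geo c b B ->
  geo c (fun k => (a k - b k) ^+ 2) ((A + B) * (A + B)).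
Proof. by move=> ha hb; have h := geoB ha hb; exact: (geoM c01 h h). Qed.

Let geo_ms m : moment_seq (1 - delta) m -> geo c m (m 0).
Proof. exact: moment_geo. Qed.

Let geo_sq m : moment_seq (1 - delta) m -> geo c (sq m) ((Cr + m 0) * (Cr + m 0)).
Proof. by move=> /geo_ms gm; exact: geo_sqB. Qed.

Lemma lsq_objE m : moment_seq (1 - delta) m -> lsq_obj r m = (sumZ (sq m))%:E.
Proof.
by move=> /geo_sq gm; apply: (esum_int c01 gm) => k; exact: sqr_ge0.
Qed.

(* an ultrafilter limit of a minimizing sequence is a minimizer *)
Lemma exists_lsq_argmin : exists m, moment_seq (1 - delta) m /\
  forall m', moment_seq (1 - delta) m' -> (lsq_obj r m <= lsq_obj r m')%E.
Proof.
pose S := [set B : R | exists2 m, moment_seq (1 - delta) m & sumZ (sq m) <= B].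
have sq0 m k : 0 <= sq m k by exact: sqr_ge0.
have S0 : has_inf S.
  split.
    exists (sumZ (sq (fun=> 0))); exists (fun=> 0) => //.
    by apply: moment_seq0; case/andP: d01.
  exists 0 => B [m mm]; apply: le_trans; exact: (sumZ_ge0 c01 (geo_sq mm)).
have I0 : 0 <= inf S.
  apply: lb_le_inf; first by case: S0.
  by move=> B [m mm]; apply: le_trans; exact: (sumZ_ge0 c01 (geo_sq mm)).
have /choice[mm mmP] (n : nat) : exists m, moment_seq (1 - delta) m /\ sumZ (sq m) <= inf S + n.+1%:R^-1.
  have [|B [m mm mB] hB] := @inf_adherent _ S n.+1%:R^-1 _ S0; first by rewrite invr_gt0.
  by exists m; split => //; apply: le_trans mB (ltW hB).
(* Along the minimizing sequence (r 0 - m 0)^2 <= inf S + 1, which forces |r 0 - m 0| <= inf S + 2;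
   as |m k| <= |m 0|, all terms are bounded by [D] and have limits along the ultrafilter. *)
pose D := `|r 0| + (inf S + 2).
have D0 : 0 < D by rewrite ltr_wpDl// ltr_wpDl.
have mmD n k : `|mm n k| <= D.
  have [mn mn1] := mmP n; have gm := geo_ms mn.
  apply: (@le_trans _ _ `|mm n 0|).
    apply: le_trans (gm k) _; rewrite -[leRHS]mulr1 ler_pM ?exprn_ge0 ?exprn_ile1 ?ler_norm//.
    - exact: geo_ge0 gm.
    - by case/andP: c01 => /ltW.
    - by case/andP: c01 => /ltW.
    - by case/andP: c01 => _ /ltW.
  rewrite -lerBlDl; apply: le_trans (lerB_dist _ _) _; rewrite distrC.
  have h : `|r 0 - mm n 0| ^+ 2 <= inf S + 1.
    rewrite real_normK ?num_real//; 
    have h0 := le_sumZ_term c01 0 (geo_sq mn) (sq0 _); apply: le_trans h0 _.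
    by apply: le_trans mn1 _; rewrite lerD2l invf_le1// ler1n.
  rewrite leNgt; apply/negP => lt.
  have := normr_ge0 (r 0 - mm n 0); move: h lt; nra.
have [U [UU oU]] := @ultraFilterLemma nat \oo _.
have PU : ProperFilter U by exact: ultra_proper.
have /choice[m mP] (k : int) : exists l : R, mm n k @[n --> U] --> l.
  have [|l _ h] := ultra_cvg UU (f := fun n => (mm n k + D) / (2 * D)).
    move=> n; have := mmD n k; rewrite ler_norml => /andP[h1 h2].
    have D2 : 0 < 2 * D by rewrite mulr_gt0.
    by rewrite ler_pdivlMr// ler_pdivrMr// mul0r mul1r; apply/andP; split; lra.
  exists (l * (2 * D) - D).
  have -> : mm ^~ k = fun n => (mm n k + D) / (2 * D) * (2 * D) - D.
    by apply/funext => n; rewrite divfK ?addrK// mulf_neq0 ?gt_eqF.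
  by apply: cvgB; [exact: cvgMl|exact: cvg_cst].
have mS : moment_seq (1 - delta) m.
  by apply: (moment_seq_cvg d01 _ mP) => n; have [] := mmP n.
exists m; split => // m' m'S; rewrite !lsq_objE// lee_fin.
apply: (@le_trans _ _ (inf S)); last first.
  by apply: ge_inf; [case: S0|exists m'].
apply: (sumZ_le c01 (geo_sq mS)) => N.
have h1 : win (sq (mm n)) N @[n --> U] --> win (sq m) N.
  apply: cvg_big => [|i _]; first exact: add_continuous.
  by apply: cvg_exprn; apply: cvgB; [exact: cvg_cst|exact: mP].
have h2 : inf S + n.+1%:R^-1 @[n --> U] --> inf S + 0.
  apply: cvgD; first exact: cvg_cst.
  by apply: cvg_trans cvg_harmonic; exact: cvg_app.
rewrite addr0 in h2.
apply: (ler_cvg_to h1 h2); apply: nearW => n; have [mn mn1] := mmP n.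
exact: le_trans (win_le_sumZ c01 N (sq0 _) (geo_sq mn)) mn1.
Qed.

Lemma Pi_projP : moment_seq (1 - delta) (Pi_proj delta r) /\
  forall m', moment_seq (1 - delta) m' -> (lsq_obj r (Pi_proj delta r) <= lsq_obj r m')%E.
Proof. exact: (ClassicalEpsilon.epsilon_spec _ _ exists_lsq_argmin). Qed.

(* the variational inequality <r - m, gam - m> <= 0 of the projection m *)
Lemma Pi_proj_var gam (m := Pi_proj delta r) : moment_seq (1 - delta) gam ->
  sumZ (fun k => (m k - gam k) ^+ 2) <= sumZ (fun k => (r k - gam k) * (m k - gam k)).
Proof.
move=> gS; have [mS mmin] := Pi_projP; rewrite -/m in mS mmin.
have gm := geo_ms mS; have gg := geo_ms gS.
have g1 := geoB gr gm; have g2 := geoB gm gg; have g3 := geoB gr gg.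
have gB := geo_sqB gm gg; have gA := geoM c01 g1 g2; have gE := geoM c01 g3 g2.
set B := sumZ _; set E := sumZ _; pose A := sumZ (fun k => (r k - m k) * (m k - gam k)).
have EE : E = A + B.
  rewrite /A /B -(sumZD c01 gA gB); congr sumZ; apply/funext => k; ring.
have B0 : 0 <= B by apply: (sumZ_ge0 c01 gB) => k; exact: sqr_ge0.
(* Moving from the minimizer a fraction t of the way to [gam] changes the objective by t (2A +
   tB). *)
have key t : 0 <= t <= 1 -> 0 <= t * (2 * A + t * B).
  move=> /andP[t0 t1].
  have tS : moment_seq (1 - delta) (fun k => (1 - t) * m k + t * gam k).
    by apply: moment_seq_lin => //; rewrite subr_ge0.
  have := mmin _ tS; rewrite !lsq_objE// lee_fin.
  have gs := geo_sq mS.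
  have -> : sumZ (sq (fun k => (1 - t) * m k + t * gam k)) =
      sumZ (sq m) + t * (2 * A + t * B).
    transitivity (sumZ (sq m) + (sumZ (fun k => (2 * t) * ((r k - m k) * (m k - gam k))) + sumZ (fun k => t ^+ 2 * (m k - gam k) ^+ 2))).
      rewrite -(sumZD c01 (geoZ (2 * t) gA) (geoZ (t ^+ 2) gB)).
      rewrite -(sumZD c01 gs (geoD (geoZ (2 * t) gA) (geoZ (t ^+ 2) gB))).
      by congr sumZ; apply/funext => k; rewrite /sq; ring.
    by rewrite (sumZZ c01 _ gA) (sumZZ c01 _ gB) -/A -/B; ring.
  by rewrite lerDl.
rewrite EE -subr_ge0 addrK leNgt; apply/negP => A0.
have BA : 0 < B - A by lra.
have t0 : 0 < - A / (B - A) by rewrite divr_gt0// oppr_gt0.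
(* If A < 0, this t lies in [0, 1] and tB <= -A, so 2A + tB <= A < 0, a contradiction. *)
have := key (- A / (B - A)); rewrite (ltW t0) ler_pdivrMr// mul1r.
have -> : - A <= B - A by lra.
move=> /(_ isT); rewrite pmulr_rge0// leNgt => /negP; apply.
have : - A / (B - A) * B <= - A.
  by rewrite mulrAC ler_pdivrMr// ler_wpM2l ?oppr_ge0 ?(ltW A0)//; lra.
by move=> h; lra.
Qed.

End projection.

Lemma cvg0_of_sqr_le (R : realType) (x y : nat -> R) :
  (forall n, x n ^+ 2 <= y n) -> y @ \oo --> 0 -> x @ \oo --> 0.
Proof.
move=> xy /cvgrPdist_le y0; apply/cvgrPdist_le => e e0.
have := y0 _ (exprn_gt0 2 e0); apply: filterS => n; rewrite !sub0r !normrN => yn.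
have h : `|x n| ^+ 2 <= e ^+ 2.
  by rewrite real_normK ?num_real// (le_trans (xy n))// (le_trans (ler_norm _)).
by move: h; rewrite ler_pXn2r// nnegrE// ltW.
Qed.

(* The empirical autocovariances r M converge to gam M at each lag only. This is
   enough: all elements of the constraint set decay like c ^ |k|, so the scalar
   product of r M - gam M with m - gam M in the variational inequality tends to 0,
   whence m - gam M tends to 0 in l^2, and in l^1 by domination. *)
Lemma Pi_proj_consistent (R : realType) (delta c B : R) (r gam : nat -> int -> R) :
  0 < c < 1 -> 0 <= 1 - delta <= 1 -> 1 - delta <= c ->
  (forall M, exists C, geo c (r M) C) -> (forall M k, `|r M k| <= B) ->
  (forall M, moment_seq (1 - delta) (gam M)) -> (forall M, gam M 0 <= B) ->
  (forall k, r M k - gam M k @[M --> \oo] --> 0) ->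
  sigma2 (Pi_proj delta (r M)) - sigma2 (gam M) @[M --> \oo] --> 0.
Proof.
move=> c01 d01 dc gr rB gS gB rg0; pose m M := Pi_proj delta (r M).
have /andP[c0 c1] := c01; have B0 : 0 <= B := le_trans (normr_ge0 _) (rB 0%N 0).
have mS M : moment_seq (1 - delta) (m M).
  by have [C gC] := gr M; have [] := Pi_projP c01 d01 dc gC.
have gm M := moment_geo d01 dc (mS M); have gg M := moment_geo d01 dc (gS M).
have m0 M : 0 <= m M 0 := geo_ge0 (gm M); have g0 M : 0 <= gam M 0 := geo_ge0 (gg M).
have gB' M k : `|gam M k| <= B.
  apply: le_trans (gg M k) _; rewrite -[leRHS]mulr1 ler_pM ?exprn_ge0 ?exprn_ile1 ?(ltW c0) ?(ltW c1)//.
pose q M k := `|r M k - gam M k| * c ^+ `|k|%N.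
have gq M : geo c (q M) (2 * B).
  move=> k; rewrite normrM normr_id ler_pM//.
    by rewrite (le_trans (ler_normB _ _))// mulr_natl mulr2n lerD.
  by rewrite ger0_norm// exprn_ge0// ltW.
have q0 M k : 0 <= q M k by rewrite mulr_ge0// exprn_ge0// ltW.
(* A weighted l^1 distance between [r M] and [gam M]. As |m k - gam k| <= (m 0 + gam 0) c^|k|, it
   bounds the scalar product in the variational inequality by eps (m 0 + gam 0). *)
pose eps M := sumZ (q M).
have eps0 : eps @ \oo --> 0.
  apply: (cvg_sumZ0 c01 gq) => k; rewrite -(mul0r (c ^+ `|k|%N)); apply: cvgMl.
  by rewrite -[X in _ --> X](@normr0 _ R); apply: cvg_norm; exact: rg0.
pose v (k : int) : R := 2 * B * c ^+ `|k|%N.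
have gv : geo c v (2 * B) by move=> k; rewrite ger0_norm// mulr_ge0 ?mulr_ge0 ?exprn_ge0// ltW.
have epsE M : eps M <= sumZ v.
  by apply: (le_sumZ c01 (gq M) gv) => k; apply: le_trans (ler_norm _) (gq M k).
have epsp M : 0 <= eps M := sumZ_ge0 c01 (gq M) (q0 M).
have d2 M k : (m M k - gam M k) ^+ 2 <= eps M * (m M 0 + gam M 0).
  have [C gC] := gr M; have gmg := geoB (gm M) (gg M); have grg := geoB gC (gg M).
  have gP := geoM c01 grg gmg.
  apply: (@le_trans _ _ (sumZ (fun k => (m M k - gam M k) ^+ 2))).
    by apply: (le_sumZ_term c01 k (geo_sqB c01 (gm M) (gg M))) => j; exact: sqr_ge0.
  apply: le_trans (Pi_proj_var c01 d01 dc gC (gS M)) _.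
  apply: le_trans (ler_norm _) _; apply: le_trans (sumZ_norm c01 gP) _.
  rewrite mulrC -(sumZZ c01 _ (gq M)); apply: (le_sumZ c01 (geo_norm gP) (geoZ _ (gq M))) => j.
  by rewrite normrM /q mulrCA ler_wpM2l//; exact: gmg.
(* A bound on x = m 0 uniform in M. With g = gam 0 and V = sumZ v one has (x - g)^2 <= V (x + g); if
   x > 1, dividing x^2 <= 2gx + Vx + Vg by x gives x <= 2g + V + Vg. *)
pose K := 1 + 2 * B + sumZ v + sumZ v * B.
have mK M : m M 0 <= K.
  have v0 : 0 <= sumZ v := le_trans (epsp M) (epsE M).
  have h := d2 M 0; have eE := epsE M; have gBM := gB M; have g0M := g0 M; have m0M := m0 M.
  have h' : (m M 0 - gam M 0) ^+ 2 <= sumZ v * (m M 0 + gam M 0).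
    by apply: le_trans h _; rewrite ler_wpM2r// addr_ge0.
  have vB : sumZ v * gam M 0 <= sumZ v * B by rewrite ler_wpM2l.
  have [x1|x1] := leP (m M 0) 1.
    by apply: le_trans x1 _; rewrite /K -!addrA lerDl !addr_ge0// mulr_ge0.
  suff : m M 0 <= 2 * gam M 0 + sumZ v + sumZ v * gam M 0 by rewrite /K; lra.
  have x0 : 0 < m M 0 by exact: lt_trans x1.
  rewrite -(ler_pM2r x0).
  have : sumZ v * gam M 0 <= sumZ v * gam M 0 * m M 0 by rewrite ler_peMr ?mulr_ge0// ltW.
  have := sqr_ge0 (gam M 0); move: h'; rewrite -subr_ge0 => h1 h2 h3.
  rewrite -subr_ge0; nra.
rewrite (_ : (fun M => _) = fun M => sumZ (fun k => m M k - gam M k)); last first.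
  by apply/funext => M; rewrite (sumZB c01 (gm M) (gg M)).
apply: (cvg_sumZ0 c01 (C := K + B)) => [M k|k].
  apply: le_trans (geoB (gm M) (gg M) k) _.
  by rewrite ler_wpM2r ?exprn_ge0 ?(ltW c0)// lerD.
apply: (cvg0_of_sqr_le (y := fun M => eps M * (K + B))) => [M|].
  by apply: le_trans (d2 M k) _; rewrite ler_wpM2l// lerD.
by rewrite -(mul0r (K + B)); apply: cvgMl.
Qed.

(** * Autocovariance sequences *)

(** The even parts of both exponents form a square. The remaining factor is 1, 1 - X^2, 1 + X or 1 -
    X, and 1 + X = ((1 + X)^2 + (1 - X^2)) / 2, likewise for 1 - X. *)
Lemma pos11_of_squares (R : realType) (m : nat -> R) :
  (forall p, 0 <= Lm m (p * p)) -> (forall p, 0 <= Lm m ((1 - 'X^2) * (p * p))) ->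
  pos11 m.
Proof.
move=> sq sqX.
have half p q : p = 2^-1 *: q -> 0 <= Lm m q -> 0 <= Lm m p.
  by move=> -> h; rewrite LmZ mulr_ge0.
have s2 (p : {poly R}) : 2^-1 *: (p + p) = p.
  by rewrite scalerDr -scalerDl (_ : 2^-1 + 2^-1 = 1) ?scale1r//; field.
move=> i j; rewrite -[i]odd_double_half -[j]odd_double_half.
set a := i./2; set b := j./2; rewrite !exprD -!muln2 !exprM.
set u := (1 + 'X) ^+ a; set v := (1 - 'X) ^+ b.
rewrite !expr2.
case: (odd i); case: (odd j); rewrite ?expr1 ?expr0 ?mul1r.
- by apply: le_trans (sqX (u * v)) _; rewrite le_eqVlt; apply/orP; left; apply/eqP; congr Lm; ring.
- apply: (half _ (((1 + 'X) * (u * v)) * ((1 + 'X) * (u * v)) + (1 - 'X^2) * ((u * v) * (u * v)))).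
    by rewrite -[LHS]s2; congr (_ *: _); ring.
  by rewrite LmD addr_ge0.
- apply: (half _ (((1 - 'X) * (u * v)) * ((1 - 'X) * (u * v)) + (1 - 'X^2) * ((u * v) * (u * v)))).
    by rewrite -[LHS]s2; congr (_ *: _); ring.
  by rewrite LmD addr_ge0.
- by apply: le_trans (sq (u * v)) _; rewrite le_eqVlt; apply/orP; left; apply/eqP; congr Lm; ring.
Qed.

(** * Covariance as a positive bilinear form *)

Section covariance.
Context d (X : measurableType d) (R : realType) (pi : probability X R).
Local Notation L2pi := (L2 pi).
Implicit Types f g : X -> R.

Definition cov f g : R :=
  Rintegral pi setT (fun x => f x * g x) - pimean pi f * pimean pi g.

Lemma covC f g : cov f g = cov g f.
Proof.
rewrite /cov [pimean pi f * _]mulrC; congr (_ - _).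
by apply: eq_Rintegral => y _; rewrite mulrC.
Qed.

Let i1 f : L2pi f -> pi.-integrable setT (EFin \o f).
Proof. exact: (L2_integrable (pi1 pi)). Qed.

Lemma covDl f1 f2 g : L2pi f1 -> L2pi f2 -> L2pi g ->
  cov (fun x => f1 x + f2 x) g = cov f1 g + cov f2 g.
Proof.
move=> L1 L2' Lg; rewrite /cov /pimean RintegralD ?i1//.
under eq_Rintegral do rewrite mulrDl.
by rewrite RintegralD//; [ring|exact: L2M|exact: L2M].
Qed.

Lemma covZl c f g : L2pi f -> L2pi g -> cov (fun x => c * f x) g = c * cov f g.
Proof.
move=> Lf Lg; rewrite /cov /pimean RintegralZl ?i1//.
under eq_Rintegral do rewrite -mulrA.
by rewrite RintegralZl//; [ring|exact: L2M].
Qed.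

Lemma cov0l g : cov (fun=> 0) g = 0.
Proof.
rewrite /cov /pimean; under eq_Rintegral do rewrite mul0r.
by rewrite !Rintegral_cst// !mul0r subrr.
Qed.

Lemma cov_suml I (s : seq I) c (F : I -> X -> R) g : (forall i, L2pi (F i)) -> L2pi g ->
  cov (fun x => \sum_(i <- s) c i * F i x) g = \sum_(i <- s) c i * cov (F i) g.
Proof.
move=> LF Lg; elim: s => [|i s IH].
  by rewrite big_nil -[RHS](cov0l g); congr cov; apply/funext => y; rewrite big_nil.
rewrite big_cons -IH -covZl// -covDl//; last 2 first.
- exact: L2Z.
- by apply: L2_sum => [|j]; [exact: (pi1 pi)|exact: L2Z].
by congr cov; apply/funext => y; rewrite big_cons.
Qed.

Lemma cov_ge0 f : L2pi f -> 0 <= cov f f.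
Proof.
move=> Lf; rewrite subr_ge0 -expr2; exact: (sqr_Rintegral_le (pi1 pi) Lf).
Qed.

(** The variances of f + g and f - g are nonnegative. This is weaker than Cauchy-Schwarz but keeps
    the decay rate. *)
Lemma cov_le f g : L2pi f -> L2pi g -> `|cov f g| <= (cov f f + cov g g) / 2.
Proof.
move=> Lf Lg; have LN : L2pi (fun x => -1 * g x) by exact: L2Z.
have := cov_ge0 (L2D Lf LN); have := cov_ge0 (L2D Lf Lg).
have LD : L2pi (fun x => f x + g x) by exact: L2D.
have LB : L2pi (fun x => f x + -1 * g x) by exact: L2D.
rewrite !covDl// !(covC _ (fun x => _ + _)) !covDl// !covZl// !(covC _ (fun x => _ * _)) !covZl//.
by rewrite (covC g f) ler_norml => h1 h2; apply/andP; split; lra.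
Qed.

End covariance.

(** * Autocovariances through powers of the transition operator *)

Section autocovariance.
Context d (X : measurableType d) (R : realType) (pi : probability X R) (Q : R.-pker X ~> X).
Hypothesis pi_inv : forall C, measurable C -> pi C = (\int[pi]_y Q y C)%E.
Hypothesis Qpow_sa : forall a f g, L2 pi f -> L2 pi g ->
  Rintegral pi setT (fun y => f y * Qpow Q a g y) = Rintegral pi setT (fun y => Qpow Q a f y * g y).
Hypothesis pimeanQ : forall f, L2 pi f -> pimean pi (Qop Q f) = pimean pi f.
Local Notation L2pi := (L2 pi).
Local Notation cov := (cov pi).
Implicit Types f g : X -> R.

Let LQ k f : L2pi f -> L2pi (Qpow Q k f).
Proof. exact: (L2_Qpow pi_inv). Qed.

Lemma pimean_Qpow k f : L2pi f -> pimean pi (Qpow Q k f) = pimean pi f.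
Proof. by move=> Lf; elim: k => //= k IH; rewrite [LHS]pimeanQ ?IH//; exact: LQ. Qed.

Lemma QpowD a b f : Qpow Q (a + b) f = Qpow Q a (Qpow Q b f).
Proof. by elim: a => //= a ->. Qed.

Lemma cov_Qpow a b f g : L2pi f -> L2pi g ->
  cov (Qpow Q a f) (Qpow Q b g) = cov f (Qpow Q (a + b) g).
Proof.
move=> Lf Lg; rewrite /cov !pimean_Qpow// QpowD; congr (_ - _).
by rewrite [RHS]Qpow_sa//; exact: LQ.
Qed.

(** Self-adjointness makes both branches of [gamma] equal. *)
Lemma gammaE f g k : L2pi f -> L2pi g -> gamma pi Q f g k = cov f (Qpow Q `|k|%N g).
Proof.
move=> Lf Lg; rewrite /gamma /cov pimean_Qpow//; case: ifP => // _; congr (_ - _).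
by rewrite Qpow_sa//; apply: eq_Rintegral => y _; rewrite mulrC.
Qed.

Lemma cov_Qpow_sa k f g : L2pi f -> L2pi g -> cov f (Qpow Q k g) = cov (Qpow Q k f) g.
Proof. by move=> Lf Lg; rewrite -{1}[k]addn0 -cov_Qpow. Qed.

Lemma gammaC f g k : L2pi f -> L2pi g -> gamma pi Q f g k = gamma pi Q g f k.
Proof. by move=> Lf Lg; rewrite !gammaE// cov_Qpow_sa// covC. Qed.

Lemma gamma_bilin n (u v : 'I_n -> R) (f : 'I_n -> X -> R) k : (forall i, L2pi (f i)) ->
  gamma pi Q (fun x => \sum_i u i * f i x) (fun x => \sum_i v i * f i x) k =
  \sum_i \sum_j u i * v j * gamma pi Q (f i) (f j) k.
Proof.
move=> Lf.
have Ls w : L2pi (fun x => \sum_i w i * f i x).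
  by apply: L2_sum => [|i]; [exact: (pi1 pi)|exact: L2Z].
rewrite gammaE// cov_suml//; last exact: LQ.
apply: eq_bigr => i _; rewrite cov_Qpow_sa// covC cov_suml//; last exact: LQ.
rewrite mulr_sumr; apply: eq_bigr => j _.
by rewrite mulrA covC -cov_Qpow_sa// gammaE.
Qed.

(** The right side is the covariance of p(Q)f and q(Q)f, so positivity of the functional becomes a
    statement about variances. *)
Lemma Lm_gamma f p q : L2pi f ->
  Lm (fun n : nat => gamma pi Q f f n) (p * q) =
  cov (fun x => \sum_(i < size p) p`_i * Qpow Q i f x)
      (fun x => \sum_(i < size q) q`_i * Qpow Q i f x).
Proof.
move=> Lf.
have Ls (r : {poly R}) : L2pi (fun x => \sum_(i < size r) r`_i * Qpow Q i f x).
  by apply: L2_sum => [|i]; [exact: (pi1 pi)|apply: L2Z; exact: LQ].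
rewrite Lm_mul cov_suml//; last by move=> i; exact: LQ.
apply: eq_bigr => i _; rewrite covC cov_suml//; [|by move=> j; exact: LQ|exact: LQ].
rewrite mulr_sumr; apply: eq_bigr => j _.
by rewrite mulrA [in RHS]covC [in RHS]cov_Qpow// gammaE.
Qed.

(** On p^2 the functional is the variance of h = p(Q)f; on (1 - X^2) p^2 it is Var(h) - Var(Qh),
    nonnegative because [Qop] preserves the mean and contracts the second moment. *)
Lemma gamma_pos11 f : L2pi f -> pos11 (fun n : nat => gamma pi Q f f n).
Proof.
move=> Lf; apply: pos11_of_squares => p.
  rewrite Lm_gamma//; apply: cov_ge0; apply: L2_sum => [|i]; first exact: (pi1 pi).
  by apply: L2Z; exact: LQ.
pose h x := \sum_(i < size p) p`_i * Qpow Q i f x.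
pose h1 x := \sum_(i < size p) p`_i * Qpow Q i (Qop Q f) x.
have LQf : L2pi (Qop Q f) by exact: (L2_Qop pi_inv).
have Lh : L2pi h.
  by apply: L2_sum => [|i]; [exact: (pi1 pi)|apply: L2Z; exact: LQ].
have Lh1 : L2pi h1.
  by apply: L2_sum => [|i]; [exact: (pi1 pi)|apply: L2Z; exact: LQ].
(* [h1] is p(Q) applied to Qf; it agrees with Q applied to [h] almost everywhere, which is enough
   under integrals. *)
have hh1 : {ae pi, forall y, Qop Q h y = h1 y}.
  apply: filterS (Qop_sum pi_inv (index_enum 'I_(size p)) (fun i => p`_i) (fun i => LQ i Lf)) => y ->.
  by apply: eq_bigr => i _; rewrite -QpowSr.
have E1 : Lm (fun n : nat => gamma pi Q f f n) ('X^2 * (p * p)) = cov h1 h1.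
  rewrite expr2 -mulrA -!Lm_shift -Lm_gamma//.
  congr (Lm _ _); apply/funext => n.
  by rewrite !gammaE// !absz_nat -QpowSr [RHS](cov_Qpow 1 n.+1).
have -> : (1 - 'X^2) * (p * p) = p * p + (-1) *: ('X^2 * (p * p)) by rewrite scaleN1r; ring.
rewrite LmD LmZ E1 Lm_gamma// mulN1r subr_ge0 /cov.
have -> : pimean pi h1 = pimean pi h.
  rewrite -(pimeanQ Lh) /pimean /Rintegral; congr fine; apply: ae_eq_integral => //.
  - by apply/measurable_EFinP; case: Lh1.
  - by apply/measurable_EFinP; apply: measurable_Qop; case: Lh.
  - by apply: filterS hh1 => y ->.
rewrite lerD2r.
have := integral_Qop_sqr_le pi_inv Lh.
have -> : (\int[pi]_y (Qop Q h y ^+ 2)%:E = \int[pi]_y (h1 y * h1 y)%:E)%E.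
  apply: ae_eq_integral => //.
  - apply/measurable_EFinP; apply: measurable_funX; apply: measurable_Qop; by case: Lh.
  - by apply/measurable_EFinP; apply: measurable_funM; case: Lh1.
  - by apply: filterS hh1 => y -> _; rewrite expr2.
under [X in (_ <= X)%E]eq_integral do rewrite expr2.
move=> hle; apply: fine_le hle.
- exact: (integrable_fin_num _ (L2M Lh1 Lh1)).
- exact: (integrable_fin_num _ (L2M Lh Lh)).
Qed.

Lemma spectral_measureP f : L2pi f -> spectral_rep pi Q f (spectral_measure pi Q f).
Proof.
move=> Lf; apply: ClassicalEpsilon.epsilon_spec.
have [mu [mu0 muE]] := hausdorff (gamma_pos11 Lf).
by exists mu; split => // k; rewrite gammaE// -muE gammaE// absz_nat.
Qed.

(** Each cross covariance at lag 2k is bounded through [cov_le] by the mean of the two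
    autocovariances at that lag, hence is of order b^(2k). Components with coefficient 0 are exempt,
    so a pairwise combination is not held to the smallest gap of all coordinates. *)
Lemma gamma_lincomb_moment_seq b n (u : 'I_n -> R) (f : 'I_n -> X -> R) : 0 <= b <= 1 ->
  (forall i, L2pi (f i)) ->
  (forall i, u i != 0 -> moment_seq b (gamma pi Q (f i) (f i))) ->
  moment_seq b (gamma pi Q (fun x => \sum_i u i * f i x) (fun x => \sum_i u i * f i x)).
Proof.
move=> b01 Lf fS.
have Ls : L2pi (fun x => \sum_i u i * f i x).
  by apply: L2_sum => [|i]; [exact: (pi1 pi)|exact: L2Z].
apply: moment_seq_of_bounds; first by case/andP: b01.
- by move=> k; rewrite !gammaE.
- exact: gamma_pos11.
exists (\sum_i \sum_j `|u i| * `|u j| * ((gamma pi Q (f i) (f i) 0 + gamma pi Q (f j) (f j) 0) / 2)).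
move=> k; rewrite gamma_bilin// mulr_suml; apply: ler_sum => i _.
rewrite mulr_suml; apply: ler_sum => j _.
apply: le_trans (ler_norm _) _; rewrite !normrM -[leRHS]mulrA.
have [->|ui] := eqVneq (u i) 0; first by rewrite normr0 !mul0r.
have [->|uj] := eqVneq (u j) 0; first by rewrite normr0 mulr0 !mul0r.
rewrite ler_wpM2l ?mulr_ge0// mulrAC ler_pdivlMr//.
have [_ _ bi] := moment_seq_bounds b01 (fS i ui).
have [_ _ bj] := moment_seq_bounds b01 (fS j uj).
rewrite mulrDl; apply: le_trans (lerD (le_trans (ler_norm _) (bi k.*2)) (le_trans (ler_norm _) (bj k.*2))).
rewrite !gammaE// absz_nat -!addnn -!cov_Qpow// -ler_pdivlMr//.
by apply: cov_le; exact: LQ.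
Qed.

End autocovariance.

(** * Support and spectral gap *)

Section support.
Context (R : realType) (F : {measure set R -> \bar R}).

(** A point off the support has a null neighbourhood, which contains a rational interval around it;
    countably many null intervals thus cover [A]. *)
Lemma measure_disjoint_msupp (A : set R) : measurable A ->
  A `&` msupp F = set0 -> F A = 0%E.
Proof.
move=> mA As.
pose I (p : rat * rat) : set R := `]ratr p.1, ratr p.2[%classic.
have [dec decK] : exists dec : nat -> option (rat * rat), forall p, exists n, dec n = Some p.
  by exists unpickle => p; exists (pickle p); exact: pickleK.
pose B n := if dec n is Some p then
  if F (I p) == 0%E then I p else set0 else set0.
apply/eqP; rewrite eq_le measure_ge0 andbT.
have B0 n : F (B n) = 0%E.
  rewrite /B; case: (dec n) => [p|]; last exact: measure0.
  by case: ifP => [/eqP //|_]; exact: measure0.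
apply: (@le_trans _ _ (\sum_(n <oo) F (B n))%E); last by rewrite eseries0.
apply: measure_sigma_subadditive => //.
  by move=> n; rewrite /B; case: (dec n) => [p|//]; case: ifP => _ //; exact: measurable_itv.
move=> x Ax; have : ~ msupp F x by move=> sx; have : (A `&` msupp F) x by []; rewrite As.
rewrite /msupp /= => /existsNP[U /not_implyP[oU /not_implyP[Ux /negP]]].
rewrite -leNgt => FU.
have /nbhs_ballP[e /= e0 xU] : nbhs x U by apply: open_nbhs_nbhs.
have xe1 : x - e < x by rewrite gtrBl.
have xe2 : x < x + e by rewrite ltrDl.
have [p] := rat_in_itvoo xe1; rewrite in_itv /= => /andP[p1 p2].
have [q] := rat_in_itvoo xe2; rewrite in_itv /= => /andP[q1 q2].
have [n nE] := decK (p, q); exists n => //; rewrite /B nE.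
have -> : F (I (p, q)) == 0%E.
  rewrite eq_le measure_ge0 andbT (le_trans _ FU)// le_measure// ?inE//.
  - exact: measurable_itv.
  - exact: open_measurable.
  - move=> y; rewrite /I /= in_itv /= => /andP[h1 h2]; apply: xU.
    by rewrite /ball /= ltr_norml; apply/andP; split; lra.
by rewrite /I /= in_itv /= p2 q1.
Qed.

Lemma Delta_le (delta : R) : F (~` `[-1, 1]%classic) = 0%E -> delta <= Delta F ->
  0 <= 1 - delta /\ F (~` `[- (1 - delta), 1 - delta]%classic) = 0%E.
Proof.
move=> F1; rewrite /Delta; set S := [set _ | _ in _] => dS.
have sub1 x : msupp F x -> `|x| <= 1.
  move=> /(_ (~` `[-1, 1]%classic)); rewrite F1 ltxx => h.
  rewrite leNgt; apply/negP => x1.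
  suff : false by [].
  apply: h; first by apply: closed_openC; exact: interval_closed.
  by rewrite /= in_itv /= -ler_norml leNgt x1.
have supS x : msupp F x -> `|x| <= sup S.
  move=> sx; apply: ub_le_sup; last by exists x.
  by exists 1 => _ [y sy <-]; exact: sub1.
(* If the support is empty, the supremum takes the default value 0. *)
have S0 : 0 <= sup S.
  have [[x sx]|/nonemptyPn sE] := pselect (msupp F !=set0).
    exact: le_trans (normr_ge0 x) (supS x sx).
  by rewrite /S sE image_set0 sup0.
split; first lra.
apply: measure_disjoint_msupp; first by apply: measurableC; exact: measurable_itv.
apply/seteqP; split => // x [/= nx sx]; apply: nx; rewrite in_itv /= -ler_norml.
by have := supS x sx; lra.
Qed.

End support.

(** * The covariance estimators *)

Lemma cvg_bounded_seq (R : realType) (x : nat -> R) (l : R) : x @ \oo --> l ->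
  exists B, forall n, `|x n| <= B.
Proof.
move=> xl; have /cvg_ex/cvg_seq_bounded[B [_ h]] : exists l : R, x @ \oo --> l by exists l.
by exists (B + 1) => n; apply: h => //; rewrite ltrDl.
Qed.

Lemma cvg0_bounded_mul (R : realType) (x y : nat -> R) (B : R) :
  (forall n, `|x n| <= B) -> y @ \oo --> 0 -> x n * y n @[n --> \oo] --> 0.
Proof.
move=> xB y0; have B0 : 0 <= B := le_trans (normr_ge0 _) (xB 0%N).
apply: (cvg0_of_sqr_le (y := fun n => (B * y n) ^+ 2)) => [n|].
  by rewrite !exprMn ler_wpM2r ?sqr_ge0// -[x n ^+ 2]real_normK ?num_real// lerXn2r ?nnegrE.
rewrite (_ : 0 = (B * 0) ^+ 2 :> R); last by rewrite mulr0 expr0n.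
by apply: cvg_exprn; exact: cvgMr.
Qed.

Lemma cvg_avg_shift (R : realType) (a : nat -> R) (l : R) h :
  M%:R^-1 * \sum_(t < M) a t @[M --> \oo] --> l ->
  (M + h)%:R^-1 * \sum_(t < M) a t @[M --> \oo] --> l.
Proof.
move=> al.
rewrite (_ : (fun M => _) = (fun M => (1 - h%:R * (M + h)%:R^-1) * (M%:R^-1 * \sum_(t < M) a t))); last first.
  apply/funext => M; case: M => [|M]; first by rewrite !big_ord0 !mulr0.
  have h0 : M.+1%:R + h%:R != 0 :> R by rewrite -natrD pnatr_eq0 addSn.
  have h1 : M.+1%:R != 0 :> R by rewrite pnatr_eq0.
  rewrite mulrA; congr (_ * _); rewrite natrD; move: (M.+1%:R : R) (h%:R : R) h0 h1 => x y h0 h1.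
  by field; rewrite h0 h1.
rewrite -[X in _ --> X]mul1r; apply: cvgM => //.
rewrite -[X in _ --> X]subr0; apply: cvgB; first exact: cvg_cst.
rewrite -(mulr0 (h%:R : R)); apply: cvgMr.
rewrite (cvg_shiftn h (fun n : nat => n%:R^-1 : R)) -(cvg_shiftS (fun n : nat => n%:R^-1 : R)).
exact: cvg_harmonic.
Qed.

(** * Empirical covariances *)

Section empirical_covariance.
Context (R : realType) (T : Type) (xs : nat -> T).
Implicit Types f g : T -> R.

(** Polarization of [emp_acov], the case f = g: coefficients depending on M can be pulled out,
    leaving finitely many sequences that converge. *)
Definition emp_cov M f g (k : int) : R :=
  if (`|k|%N < M)%N then
    M%:R^-1 * \sum_(t < M - `|k|%N)
      ((f (xs t) - emp_mean M f xs) * (g (xs (t + `|k|%N)%N) - emp_mean M g xs))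
  else 0.

Lemma emp_mean_lin M n (u : 'I_n -> R) (f : 'I_n -> T -> R) :
  emp_mean M (fun x => \sum_i u i * f i x) xs = \sum_i u i * emp_mean M (f i) xs.
Proof.
rewrite /emp_mean exchange_big mulr_sumr; apply: eq_bigr => i _ /=.
by rewrite -mulr_sumr mulrCA.
Qed.

Lemma emp_cov_bilin M n (u v : 'I_n -> R) (f : 'I_n -> T -> R) k :
  emp_cov M (fun x => \sum_i u i * f i x) (fun x => \sum_i v i * f i x) k =
  \sum_i \sum_j u i * v j * emp_cov M (f i) (f j) k.
Proof.
rewrite /emp_cov; case: ifP => _; last first.
  by rewrite big1// => i _; rewrite big1// => j _; rewrite mulr0.
transitivity (M%:R^-1 * \sum_(t < M - `|k|%N) \sum_i \sum_j u i * v j *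
    ((f i (xs t) - emp_mean M (f i) xs) * (f j (xs (t + `|k|%N)%N) - emp_mean M (f j) xs))).
  congr (_ * _); apply: eq_bigr => t _; rewrite !emp_mean_lin -!sumrB mulr_suml.
  apply: eq_bigr => i _; rewrite mulr_sumr; apply: eq_bigr => j _; ring.
rewrite exchange_big mulr_sumr; apply: eq_bigr => i _ /=.
rewrite exchange_big mulr_sumr; apply: eq_bigr => j _ /=.
by rewrite -mulr_sumr mulrCA.
Qed.

Lemma emp_acov_ge0 M f : 0 <= emp_acov M f xs 0.
Proof.
rewrite /emp_acov; case: ifP => // _; rewrite mulr_ge0// sumr_ge0// => t _.
by rewrite addn0 -expr2 sqr_ge0.
Qed.

(** By 2|ab| <= a^2 + b^2 in each product; the two resulting sums of squares are an initial and a
    final part of the full one. *)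
Lemma emp_acov_le M f k : `|emp_acov M f xs k| <= emp_acov M f xs 0.
Proof.
have h0 := emp_acov_ge0 M f; move: h0; rewrite {1 3}/emp_acov absz0 subn0.
case: M => [|M] h0; first by rewrite /emp_acov normr0.
rewrite /emp_acov; case: ifP => kM; last by rewrite normr0.
rewrite normrM ger0_norm// ler_wpM2l//.
pose a t := f (xs t) - emp_mean M.+1 f xs; set h := `|k|%N in kM *.
apply: le_trans (ler_norm_sum _ _ _) _.
apply: (@le_trans _ _ (\sum_(t < M.+1 - h) (a t ^+ 2 + a (t + h)%N ^+ 2) / 2)).
  apply: ler_sum => t _; rewrite -/(a t) -/(a (t + h)%N).
  have := sqr_ge0 (a t - a (t + h)%N); have := sqr_ge0 (a t + a (t + h)%N).
  by rewrite sqrrB sqrrD ler_norml => h1 h2; apply/andP; split; lra.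
rewrite -mulr_suml big_split /= ler_pdivrMr// mulr_natr mulr2n.
have E : \sum_(t < M.+1) (f (xs t) - emp_mean M.+1 f xs) * (f (xs (t + 0)%N) - emp_mean M.+1 f xs)
   = \sum_(0 <= t < M.+1) a t ^+ 2.
  by rewrite big_mkord; apply: eq_bigr => t _; rewrite addn0.
rewrite E; apply: lerD.
  rewrite -(big_mkord xpredT (fun t => a t ^+ 2)) [leRHS](@big_cat_nat _ _ _ (M.+1 - h))//= ?leq_subr//.
  by rewrite lerDl sumr_ge0// => t _; exact: sqr_ge0.
rewrite [leRHS](@big_cat_nat _ _ _ h)//=; last exact: ltnW.
have -> : \sum_(h <= i < M.+1) a i ^+ 2 = \sum_(t < M.+1 - h) a (t + h)%N ^+ 2.
  by rewrite -{1}[h]add0n big_addn big_mkord.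
by rewrite lerDr sumr_ge0// => t _; exact: sqr_ge0.
Qed.

(** The sequence vanishes for |k| >= M, so any ratio works with a constant depending on M. This only
    serves to give meaning to sums over lags at each fixed M. *)
Lemma emp_acov_geo c M f : 0 < c < 1 -> exists C, geo c (emp_acov M f xs) C.
Proof.
move=> /andP[c0 c1]; exists (emp_acov M f xs 0 / c ^+ M) => k.
have cM : 0 < c ^+ M by rewrite exprn_gt0.
have [kM|kM] := ltnP `|k|%N M; last first.
  by rewrite /emp_acov ltnNge kM normr0 mulr_ge0 ?exprn_ge0 ?(ltW c0)// divr_ge0 ?(ltW cM)//; exact: emp_acov_ge0.
apply: le_trans (emp_acov_le _ _ _) _; rewrite mulrAC ler_pdivlMr// ler_wpM2l ?emp_acov_ge0//.
by apply: ler_wiXn2l; [exact: ltW|exact: ltW|exact: ltnW].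
Qed.

Lemma cvg_emp_cov f g (k : int) (l lf lg : R) :
  M%:R^-1 * \sum_(t < M) (f (xs t) * g (xs (t + `|k|%N)%N)) @[M --> \oo] --> l ->
  emp_mean M f xs @[M --> \oo] --> lf ->
  emp_mean M g xs @[M --> \oo] --> lg ->
  M%:R^-1 * \sum_(t < M) g (xs (t + `|k|%N)%N) @[M --> \oo] --> lg ->
  emp_cov M f g k @[M --> \oo] --> l - lf * lg.
Proof.
set h := `|k|%N => fg fl gl gl'.
pose n (N : nat) : R := (N + h)%:R^-1.
pose mf N := emp_mean (N + h) f xs; pose mg N := emp_mean (N + h) g xs.
have mfl : mf @ \oo --> lf by rewrite /mf (cvg_shiftn h (fun M => emp_mean M f xs)).
have mgl : mg @ \oo --> lg by rewrite /mg (cvg_shiftn h (fun M => emp_mean M g xs)).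
have one : M%:R^-1 * \sum_(t < M) (1 : R) @[M --> \oo] --> (1 : R).
  rewrite -(cvg_shiftS (fun M => M%:R^-1 * \sum_(t < M) (1 : R))) /=.
  rewrite (_ : (fun M => _) = fun=> 1); first exact: cvg_cst.
  by apply/funext => M; rewrite sumr_const card_ord mulVf// pnatr_eq0.
(* At sample size N + h the sum has exactly N terms; expanding the centred products gives four sums
   of N terms divided by N + h, each convergent. *)
pose G N := n N * (\sum_(t < N) (f (xs t) * g (xs (t + h)%N))) - mg N * (n N * \sum_(t < N) f (xs t))
  - mf N * (n N * \sum_(t < N) g (xs (t + h)%N)) + mf N * mg N * (n N * \sum_(t < N) 1).
have Gl : G @ \oo --> l - lf * lg.
  rewrite (_ : l - lf * lg = l - lg * lf - lf * lg + lf * lg * 1); last by ring.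
  apply: cvgD; first apply: cvgB; first apply: cvgB.
  - exact: (cvg_avg_shift (a := fun t => f (xs t) * g (xs (t + h)%N))).
  - by apply: cvgM => //; exact: (cvg_avg_shift (a := fun t => f (xs t))).
  - by apply: cvgM => //; exact: (cvg_avg_shift (a := fun t => g (xs (t + h)%N))).
  - by apply: cvgM; [exact: cvgM|exact: (cvg_avg_shift (a := fun=> 1))].
(* The shift by h + 1 makes the condition |k| < M hold at every index. *)
rewrite -(cvg_shiftn h.+1) /=; rewrite -(cvg_shiftS G) in Gl.
rewrite (_ : (fun M => _) = (fun M => G M.+1))//; apply/funext => M.
rewrite /emp_cov -/h addnS ltnS leq_addl -addSn addnK /G -/(n _) -/(mf _) -/(mg _).
move: (mf _) (mg _) (n _) => a b c.
have -> : \sum_(t < M.+1) (f (xs t) - a) * (g (xs (t + h)%N) - b) =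
    \sum_(t < M.+1) (f (xs t) * g (xs (t + h)%N)) - b * (\sum_(t < M.+1) f (xs t))
    - a * (\sum_(t < M.+1) g (xs (t + h)%N)) + a * b * (\sum_(t < M.+1) 1).
  by rewrite !mulr_sumr -!sumrB -big_split; apply: eq_bigr => t _ /=; ring.
ring.
Qed.

End empirical_covariance.

Lemma moment_seq_mono (R : realType) (b b' : R) m : 0 <= b -> b <= b' -> b' <= 1 ->
  moment_seq b m -> moment_seq b' m.
Proof.
move=> b0 bb b1 mS; have b01 : 0 <= b <= 1 by rewrite b0 (le_trans bb).
have [me mp mb] := moment_seq_bounds b01 mS.
have m0 : 0 <= m 0 by have := mb 0%N; rewrite expr0 mulr1; apply: le_trans.
apply: moment_seq_of_bounds => //; first exact: le_trans bb.
exists (m 0) => n; apply: le_trans (le_trans (ler_norm _) (mb _)) _.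
by rewrite ler_wpM2l// lerXn2r ?nnegrE// (le_trans b0).
Qed.

Lemma delta_min_le (R : realType) n (delta : 'I_n -> R) i : delta_min delta <= delta i.
Proof. by rewrite /delta_min (bigminD1 i)// ge_min lexx. Qed.

Lemma delta_min_gt0 (R : realType) n (delta : 'I_n -> R) :
  (forall i, 0 < delta i) -> 0 < delta_min delta.
Proof. by move=> h; rewrite /delta_min; elim/big_ind: _ => // x y x0 y0; rewrite lt_min x0. Qed.

Lemma delta_min_le1 (R : realType) n (delta : 'I_n -> R) : delta_min delta <= 1.
Proof.
by rewrite /delta_min; elim/big_rec: _ => // i x _ x1; rewrite ge_min x1 orbT.
Qed.

Lemma sumZ_sum (R : realType) (c : R) I (s : seq I) (a : I -> int -> R) : 0 < c < 1 ->
  (forall i, exists C, geo c (a i) C) ->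
  (exists C, geo c (fun k => \sum_(i <- s) a i k) C) /\
  sumZ (fun k => \sum_(i <- s) a i k) = \sum_(i <- s) sumZ (a i).
Proof.
move=> c01 ga; elim: s => [|i s [[C gC] IH]].
  have E : (fun k : int => \sum_(i <- [::]) a i k) = (fun=> 0).
    by apply/funext => k; rewrite big_nil.
  have g0 : geo c (fun=> 0) 0 by move=> k; rewrite normr0 mul0r.
  rewrite E; split; first by exists 0.
  by rewrite big_nil -[RHS](mul0r (sumZ (fun=> 0))) -(sumZZ c01 0 g0); congr sumZ; apply/funext => k; rewrite mul0r.
have E : (fun k => \sum_(j <- i :: s) a j k) = (fun k => a i k + \sum_(j <- s) a j k).
  by apply/funext => k; rewrite big_cons.
have [D gD] := ga i; rewrite E big_cons -IH; split; first by exists (D + C); exact: geoD.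
exact (sumZD c01 gD gC).
Qed.

Lemma cvg_mx (R : realType) m n (A : nat -> 'M[R]_(m, n)) (B : 'M[R]_(m, n)) :
  (forall i j, A N i j @[N --> \oo] --> B i j) -> A @ \oo --> B.
Proof.
move=> AB; apply/cvg_mx_entourageP => E entE.
have h (p : 'I_m * 'I_n) : \forall N \near \oo, E (B p.1 p.2, A N p.1 p.2).
  by have /cvg_entourageP := AB p.1 p.2; apply.
change (\forall N \near \oo, forall i j, (B i j, A N i j) \in E).
have hE : \forall N \near \oo, forall p : 'I_m * 'I_n, E (B p.1 p.2, A N p.1 p.2).
  exact: filter_forall.
by apply: filterS hE => N hN i j; rewrite inE; exact: (hN (i, j)).
Qed.

Lemma cvg_sum2_0 (R : realType) n (f : nat -> 'I_n -> 'I_n -> R) :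
  (forall i j, f M i j @[M --> \oo] --> 0) -> \sum_i \sum_j f M i j @[M --> \oo] --> 0.
Proof.
move=> f0; rewrite -[X in _ --> X](_ : \sum_(i < n) \sum_(j < n) 0 = 0 :> R).
  by do 2 (apply: cvg_big => [|? _]; first exact: add_continuous); exact: f0.
by rewrite big1// => i _; rewrite big1.
Qed.

Lemma sum_two (R : pzRingType) n (F : 'I_n -> R) i j a b :
  \sum_k (a * (k == i)%:R + b * (k == j)%:R) * F k = a * F i + b * F j.
Proof.
have one c l : \sum_k c * (k == l)%:R * F k = c * F l.
  rewrite (bigD1 l)//= eqxx mulr1 big1 ?addr0// => k /negPf ->.
  by rewrite mulr0 mul0r.
by under eq_bigr do rewrite mulrDl; rewrite big_split /= !one.
Qed.

(** * Convergence of the estimators along one trajectory *)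

Section estimator.
Context d (X : measurableType d) (R : realType) (pi : probability X R) (Q : R.-pker X ~> X).
Hypothesis pi_inv : forall C, measurable C -> pi C = (\int[pi]_y Q y C)%E.
Hypothesis Qpow_sa : forall a f g, L2 pi f -> L2 pi g ->
  Rintegral pi setT (fun y => f y * Qpow Q a g y) = Rintegral pi setT (fun y => Qpow Q a f y * g y).
Hypothesis pimeanQ : forall f, L2 pi f -> pimean pi (Qop Q f) = pimean pi f.
Variables (dim : nat) (g : 'I_dim -> X -> R) (delta : 'I_dim -> R).
Hypothesis Lg : forall i, L2 pi (g i).
Hypothesis delta_gt0 : forall i, 0 < delta i.
Hypothesis delta_le1 : forall i, delta i <= 1.
Hypothesis gS : forall i, moment_seq (1 - delta i) (gamma pi Q (g i) (g i)).
Variable xs : nat -> X.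
Hypothesis cov_cvg : forall i j k,
  emp_cov xs M (g i) (g j) k @[M --> \oo] --> gamma pi Q (g i) (g j) k.

Let dm := delta_min delta.
Let dm0 : 0 < dm. Proof. exact: delta_min_gt0. Qed.
Let dm1 : dm <= 1. Proof. exact: delta_min_le1. Qed.
(** Halving [dm] keeps the ratio above 1 - dm and below 1, and positive even when dm = 1. *)
Let c := 1 - dm / 2.
Let c01 : 0 < c < 1.
Proof. by have := dm0; have := dm1; rewrite /c => h1 h2; apply/andP; split; lra. Qed.
Let cle del : dm <= del -> 1 - del <= c.
Proof. by have := dm0; rewrite /c => h1 h2; lra. Qed.
Let c01' : 0 <= c <= 1. Proof. by case/andP: c01 => /ltW -> /ltW ->. Qed.

Let gam i j := gamma pi Q (g i) (g j).
Let lin (u : 'I_dim -> R) x := \sum_i u i * g i x.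
Let gam_lin u := gamma pi Q (lin u) (lin u).

Let gam_linE u k : gam_lin u k = \sum_i \sum_j u i * u j * gam i j k.
Proof. exact: gamma_bilin. Qed.

Lemma moment_seq_gamma_c i : moment_seq c (gam i i).
Proof.
apply: moment_seq_mono (gS i); first by rewrite subr_ge0.
  by apply: cle; exact: delta_min_le.
by case/andP: c01'.
Qed.

(** Polarization: the autocovariances of g_i + g_j, g_i and g_j are moment sequences, hence
    dominated, and 2 gam i j is the first minus the other two. *)
Lemma gamma_geo i j : exists C, geo c (gam i j) C.
Proof.
pose f (a : 'I_2) := if a == 0 then g i else g j.
have Lf a : L2 pi (f a) by rewrite /f; case: ifP.
have fS a : moment_seq c (gamma pi Q (f a) (f a)).
  by rewrite /f; case: ifP => _; exact: moment_seq_gamma_c.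
have S := gamma_lincomb_moment_seq pi_inv Qpow_sa pimeanQ (u := fun=> 1) c01' Lf (fun a _ => fS a).
have g1 := moment_geo c01' (lexx c) S.
have gi := moment_geo c01' (lexx c) (moment_seq_gamma_c i).
have gj := moment_geo c01' (lexx c) (moment_seq_gamma_c j).
have h := geoZ 2^-1 (geoB (geoB g1 gi) gj); eexists => k.
 apply: le_trans (h k); rewrite le_eqVlt; apply/orP; left; apply/eqP; congr Num.norm.
rewrite (gamma_bilin pi_inv Qpow_sa pimeanQ)// !big_ord_recl !big_ord0 /f /= /gam.
rewrite (gammaC pi_inv Qpow_sa pimeanQ (f := g j) (g := g i))//.
by field.
Qed.

Lemma sigma2_gam_lin u :
  sigma2 (gam_lin u) = \sum_i \sum_j u i * u j * Sigma pi Q g i j.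
Proof.
have gij i j : exists C, geo c (fun k => u i * u j * gam i j k) C.
  by have [C gC] := gamma_geo i j; eexists; exact: geoZ.
have gi i := sumZ_sum (index_enum 'I_dim) c01 (gij i).
rewrite /sigma2 (_ : gam_lin u = fun k => \sum_i \sum_j u i * u j * gam i j k); last first.
  by apply/funext => k; exact: gam_linE.
have [_ ->] := sumZ_sum (index_enum 'I_dim) c01 (fun i => proj1 (gi i)).
apply: eq_bigr => i _; rewrite (proj2 (gi i)); apply: eq_bigr => j _.
by have [C gC] := gamma_geo i j; rewrite (sumZZ c01 _ gC) mxE.
Qed.

(** The coefficients may vary with M within a bound: empirical and true autocovariances are the same
    quadratic form in them, so convergence of the finitely many pairwise covariances makes the
    difference vanish at each lag. *)
Lemma cvg_sigma2_proj del K (u : nat -> 'I_dim -> R) : dm <= del -> del <= 1 ->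
  (forall M i, `|u M i| <= K) -> (forall M i, u M i != 0 -> del <= delta i) ->
  sigma2 (Pi_proj del (emp_acov M (fun x => \sum_i u M i * g i x) xs)) -
    \sum_i \sum_j u M i * u M j * Sigma pi Q g i j @[M --> \oo] --> 0.
Proof.
move=> dmd d1 uK usupp.
pose r M := emp_acov M (lin (u M)) xs.
have rE M k : r M k = \sum_i \sum_j u M i * u M j * emp_cov xs M (g i) (g j) k.
  exact: emp_cov_bilin.
have uu M i j : `|u M i * u M j| <= K * K by rewrite normrM ler_pM.
have /choice[Bf BfP] (p : 'I_dim * 'I_dim) : exists B, forall M, `|emp_cov xs M (g p.1) (g p.2) 0| <= B.
  by have [B hB] := cvg_bounded_seq (@cov_cvg p.1 p.2 0); exists B => M; exact: hB.
have K0 : 0 <= K * K by rewrite -expr2 sqr_ge0.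
pose B := \sum_i \sum_j K * K * (Bf (i, j) + `|gam i j 0|).
have Bf0 p : 0 <= Bf p := le_trans (normr_ge0 _) (BfP p 0%N).
have rB M k : `|r M k| <= B.
  apply: le_trans (emp_acov_le _ _ _ _) _; rewrite -/(r M) rE.
  apply: ler_sum => i _; apply: ler_sum => j _.
  apply: le_trans (ler_norm _) _; rewrite normrM ler_pM//.
  by apply: le_trans (BfP (i, j) M) _; rewrite lerDl.
have gB M : gam_lin (u M) 0 <= B.
  rewrite gam_linE; apply: ler_sum => i _; apply: ler_sum => j _.
  apply: le_trans (ler_norm _) _; rewrite normrM ler_pM// lerDr//.
have gMS M : moment_seq (1 - del) (gam_lin (u M)).
  apply: (gamma_lincomb_moment_seq pi_inv Qpow_sa pimeanQ) => // [|i ui].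
    by rewrite subr_ge0 d1 gerBl (le_trans (ltW dm0)).
  apply: moment_seq_mono (gS i); rewrite ?subr_ge0//; first by rewrite lerD2l lerN2 (usupp M).
  by rewrite gerBl (le_trans (ltW dm0)).
rewrite (_ : (fun M => _) = fun M => sigma2 (Pi_proj del (r M)) - sigma2 (gam_lin (u M))); last first.
  by apply/funext => M; rewrite sigma2_gam_lin.
apply: (@Pi_proj_consistent _ del c B r (fun M => gam_lin (u M))) => //.
- by rewrite subr_ge0 d1 gerBl (le_trans (ltW dm0)).
- exact: cle.
- by move=> M; exact: emp_acov_geo.
move=> k; rewrite (_ : (fun M => _) = fun M => \sum_i \sum_j (u M i * u M j) * (emp_cov xs M (g i) (g j) k - gam i j k)); last first.
  apply/funext => M; rewrite rE gam_linE -sumrB; apply: eq_bigr => i _.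
  by rewrite -sumrB; apply: eq_bigr => j _; rewrite mulrBr.
apply: cvg_sum2_0 => i j; apply: (cvg0_bounded_mul (B := K * K)) => //.
by rewrite -(subrr (gam i j k)); apply: cvgB; [exact: cov_cvg|exact: cvg_cst].
Qed.

Lemma cvg_sigma2_proj_lim del (u : nat -> 'I_dim -> R) (v : 'I_dim -> R) :
  dm <= del -> del <= 1 ->
  (forall i, u M i @[M --> \oo] --> v i) -> (forall M i, u M i != 0 -> del <= delta i) ->
  sigma2 (Pi_proj del (emp_acov M (fun x => \sum_i u M i * g i x) xs)) @[M --> \oo] -->
    \sum_i \sum_j v i * v j * Sigma pi Q g i j.
Proof.
move=> dmd d1 uv usupp.
have /choice[K KP] i : exists K, forall M, `|u M i| <= K := cvg_bounded_seq (uv i).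
have uK M i : `|u M i| <= \sum_i K i.
  apply: le_trans (KP i M) _; rewrite (bigD1 i)//= lerDl sumr_ge0// => j _.
  exact: le_trans (normr_ge0 _) (KP j 0%N).
have h := cvg_sigma2_proj dmd d1 uK usupp.
have h2 : \sum_i \sum_j u M i * u M j * Sigma pi Q g i j @[M --> \oo] -->
    \sum_i \sum_j v i * v j * Sigma pi Q g i j.
  apply: cvg_big => [|i _]; first exact: add_continuous.
  apply: cvg_big => [|j _]; first exact: add_continuous.
  by apply: cvgMl; apply: cvgM.
rewrite -[X in _ --> X]add0r.
rewrite (_ : (fun M => _) = fun M => (sigma2 (Pi_proj del
    (emp_acov M (fun x => \sum_i u M i * g i x) xs)) -
  \sum_i \sum_j u M i * u M j * Sigma pi Q g i j) +
  \sum_i \sum_j u M i * u M j * Sigma pi Q g i j); first exact: cvgD.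
by apply/funext => M; rewrite subrK.
Qed.

Hypothesis var_gt0 : forall i, 0 < gam i i 0.
Local Notation S := (Sigma pi Q g).

Lemma Sigma_sym i j : S i j = S j i.
Proof.
rewrite !mxE; congr sumZ; apply/funext => k.
exact: (gammaC pi_inv Qpow_sa pimeanQ).
Qed.

Lemma cvg_Sigma_pw_diag i :
  sigma2 (Pi_proj (delta i) (emp_acov M (g i) xs)) @[M --> \oo] --> S i i.
Proof.
pose u a : R := 1 * (a == i)%:R + 0 * (a == i)%:R.
have gE : g i = fun x => \sum_a u a * g a x.
  by apply/funext => x; rewrite sum_two mul1r mul0r addr0.
have uE : \sum_a \sum_b u a * u b * S a b = S i i.
  transitivity (\sum_a u a * \sum_b u b * S a b).
    by apply: eq_bigr => a _; rewrite mulr_sumr; apply: eq_bigr => b _; rewrite mulrA.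
  by rewrite !sum_two !mul1r !mul0r !addr0.
rewrite -uE [g i]gE.
apply: (cvg_sigma2_proj_lim (u := fun=> u)) => //.
- exact: delta_min_le.
- by move=> a; exact: cvg_cst.
- by move=> _ a; rewrite /u mul1r mul0r addr0; case: (eqVneq a i) => [->//|_]; rewrite eqxx.
Qed.

Lemma cvg_Sigma_pw_off i j : Sigma_pw_off delta g M xs i j @[M --> \oo] --> S i j.
Proof.
pose s M a := Num.sqrt (emp_acov M (g a) xs 0).
pose s' a := Num.sqrt (gam a a 0).
have s's a : s M a @[M --> \oo] --> s' a.
  apply: (continuous_cvg _ (@sqrt_continuous R _)); exact: cov_cvg.
have s'0 a : s' a != 0 by rewrite gt_eqF// sqrtr_gt0.
pose u e M a : R := (s M i)^-1 * (a == i)%:R + e * (s M j)^-1 * (a == j)%:R.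
pose v e a : R := (s' i)^-1 * (a == i)%:R + e * (s' j)^-1 * (a == j)%:R.
(* e = 1 and e = -1 give the sum and the difference. The coefficients 1/s_i and 1/s_j are random but
   converge, the limiting variances being positive. In the difference of the two limits the diagonal
   terms cancel and 4 S i j / (s' i s' j) remains. *)
have h e : sigma2 (Pi_proj (Num.min (delta i) (delta j))
      (emp_acov M (fun x => \sum_a u e M a * g a x) xs)) @[M --> \oo] -->
    (s' i) ^- 2 * S i i + 2 * e * ((s' i)^-1 * (s' j)^-1 * S i j) + e ^+ 2 * (s' j) ^- 2 * S j j.
  have <- : \sum_a \sum_b v e a * v e b * S a b = (s' i) ^- 2 * S i i + 2 * e * ((s' i)^-1 * (s' j)^-1 * S i j) + e ^+ 2 * (s' j) ^- 2 * S j j.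
    transitivity (\sum_a v e a * \sum_b v e b * S a b).
      by apply: eq_bigr => a _; rewrite mulr_sumr; apply: eq_bigr => b _; rewrite mulrA.
    rewrite !sum_two (Sigma_sym j i); move: (S i i) (S i j) (S j j) (s'0 i) (s'0 j) => x y z h1 h2.
    by field; rewrite h1 h2.
  apply: cvg_sigma2_proj_lim.
  - by rewrite le_min !delta_min_le.
  - by rewrite ge_min delta_le1.
  - move=> a; apply: cvgD; apply: cvgMl; first exact: cvgV.
    by apply: cvgMr; exact: cvgV.
  - move=> M a; rewrite /u ge_min.
    have [->|ai] := eqVneq a i; first by rewrite lexx.
    have [->|aj] := eqVneq a j; first by rewrite lexx orbT.
    by rewrite !mulr0 addr0 eqxx.
rewrite (_ : S i j = s' i * s' j / 4 * (((s' i) ^- 2 * S i i + 2 * 1 * ((s' i)^-1 * (s' j)^-1 * S i j) + 1 ^+ 2 * (s' j) ^- 2 * S j j) -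
  ((s' i) ^- 2 * S i i + 2 * -1 * ((s' i)^-1 * (s' j)^-1 * S i j) + (-1) ^+ 2 * (s' j) ^- 2 * S j j))); last first.
  move: (S i i) (S i j) (S j j) (s'0 i) (s'0 j) => x y z h1 h2.
  by field; rewrite h1 h2.
have uE1 M : (fun x => g i x / s M i + g j x / s M j) = (fun x => \sum_a u 1 M a * g a x).
  by apply/funext => x; rewrite sum_two mul1r ![_^-1 * _]mulrC.
have uE2 M : (fun x => g i x / s M i - g j x / s M j) = (fun x => \sum_a u (-1) M a * g a x).
  by apply/funext => x; rewrite sum_two mulN1r mulNr ![_^-1 * _]mulrC.
rewrite (_ : (fun M => _) = fun M => s M i * s M j / 4 *
   (sigma2 (Pi_proj (Num.min (delta i) (delta j)) (emp_acov M (fun x => \sum_a u 1 M a * g a x) xs)) -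
    sigma2 (Pi_proj (Num.min (delta i) (delta j)) (emp_acov M (fun x => \sum_a u (-1) M a * g a x) xs)))).
  by apply: cvgM; [apply: cvgMl; exact: cvgM|exact: cvgB].
by apply/funext => M; rewrite /Sigma_pw_off -/(s M i) -/(s M j) uE1 uE2.
Qed.

Lemma cvg_Sigma_pw i j : Sigma_pw delta g M xs i j @[M --> \oo] --> S i j.
Proof.
under eq_fun do rewrite mxE.
case: eqVneq => [->|_]; first exact: cvg_Sigma_pw_diag.
case: (i < j)%N; first exact: cvg_Sigma_pw_off.
by rewrite Sigma_sym; exact: cvg_Sigma_pw_off.
Qed.

Lemma cvg_Sigma_psd (U : nat -> 'M[R]_dim) :
  (forall M, orth_eigenbasis (Sigma_pw delta g M xs) (U M)) ->
  Sigma_psd delta g M xs (U M) @[M --> \oo] --> S.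
Proof.
move=> HU; apply: cvg_mx => i j.
have U1 M a b : `|U M a b| <= 1.
  have [/matrixP/(_ a a) UU _] := HU M.
  rewrite -(ler_pXn2r (n := 2))// ?nnegrE// expr1n real_normK ?num_real//.
  move: UU; rewrite !mxE eqxx mulr1n => <-; rewrite (bigD1 b)//= mxE -expr2 lerDl sumr_ge0// => k _.
  by rewrite mxE -expr2 sqr_ge0.
have UU1 M a b a' b' : `|U M a b * U M a' b'| <= 1 by rewrite normrM mulr_ile1.
pose lam M a := sigma2 (Pi_proj dm (emp_acov M (fun x => \sum_k U M k a * g k x) xs)).
(* The error seen in the moving eigenbasis; as the entries of U are bounded by 1, entrywise
   convergence of [E] to 0 carries over to U E U^T. *)
pose E M : 'M[R]_dim := diag_mx (\row_a lam M a) - (U M)^T *m S *m U M.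
have psdE M : Sigma_psd delta g M xs (U M) = S + U M *m E M *m (U M)^T.
  have [UU _] := HU M.
  rewrite /E mulmxBr mulmxBl !mulmxA UU mul1mx -(mulmxA S) UU mulmx1.
  by rewrite addrC subrK.
have quad M (A : 'M[R]_dim) a b : ((U M)^T *m A *m U M) a b = \sum_k \sum_l U M k a * U M l b * A k l.
  rewrite mxE exchange_big /=; apply: eq_bigr => l _; rewrite mxE mulr_suml.
  by apply: eq_bigr => k _; rewrite mxE mulrAC.
(* On the diagonal, consistency is applied to the combination whose coefficients are an eigenvector.
   Off the diagonal U^T Sigma_pw U vanishes, so the entry is that of U^T (Sigma_pw - S) U. *)
have E0 a b : E M a b @[M --> \oo] --> 0.
  have [->|ab] := eqVneq a b.
    rewrite (_ : (fun M => _) = fun M => lam M b - \sum_k \sum_l U M k b * U M l b * S k l).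
      by apply: (cvg_sigma2_proj (K := 1)) => // M k _; exact: delta_min_le.
    by apply/funext => M; rewrite mxE -quad !mxE eqxx mulr1n.
  rewrite (_ : (fun M => _) = fun M => \sum_k \sum_l (U M k a * U M l b) * (Sigma_pw delta g M xs k l - S k l)).
    apply: cvg_sum2_0 => k l; apply: (cvg0_bounded_mul (B := 1)) => //.
    by rewrite -(subrr (S k l)); apply: cvgB; [exact: cvg_Sigma_pw|exact: cvg_cst].
  apply/funext => M; have [UU /(_ b)[l hl]] := HU M.
  transitivity (((U M)^T *m (Sigma_pw delta g M xs - S) *m U M) a b); last first.
    by rewrite quad; apply: eq_bigr => k _; apply: eq_bigr => m _; rewrite !mxE.
  have Z : ((U M)^T *m Sigma_pw delta g M xs *m U M) a b = 0.
    rewrite -mulmxA mxE; transitivity (l * ((U M)^T *m U M) a b); last first.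
      by rewrite (mulmx1C UU) mxE (negPf ab) mulr0.
    rewrite mxE mulr_sumr; apply: eq_bigr => k _; rewrite mulrCA; congr (_ * _).
    have /matrixP/(_ k 0) := hl; rewrite mxE => h.
    transitivity (\sum_m Sigma_pw delta g M xs k m * U M m b); first by rewrite mxE.
    transitivity (\sum_m Sigma_pw delta g M xs k m * col b (U M) m 0).
      by apply: eq_bigr => m _; rewrite [col b (U M) m 0]mxE.
    by rewrite h !mxE.
  have sub (A B : 'M[R]_dim) : (A - B) a b = A a b - B a b by rewrite !mxE.
  by rewrite mulmxBr mulmxBl /E !sub Z [diag_mx _ a b]mxE (negPf ab).
rewrite (_ : (fun M => _) = fun M => S i j + \sum_b \sum_a (U M i a * U M j b) * E M a b); last first.
  apply/funext => M; rewrite psdE mxE; congr (_ + _); rewrite mxE; apply: eq_bigr => b _.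
  by rewrite mxE mulr_suml; apply: eq_bigr => a _; rewrite !mxE mulrAC.
rewrite -[X in _ --> X]addr0; apply: cvgD; first exact: cvg_cst.
by apply: cvg_sum2_0 => b a; exact: (cvg0_bounded_mul (B := 1)).
Qed.

End estimator.

(* rho is not assumed to be nonnegative; if rho < 0 the hypotheses force K = 0 *)
Lemma cvg_geometric_bound (R : realType) (K rho : R) : 0 <= K -> rho < 1 ->
  (forall n, 0 <= K * rho ^+ n) -> K * rho ^+ n @[n --> \oo] --> 0.
Proof.
move=> K0 rho1 h; have [rho0|rho0] := leP 0 rho.
  by rewrite -(mulr0 K); apply: cvgMr; apply: cvg_expr; rewrite ger0_norm.
have K00 : K = 0.
  apply/le_anti; rewrite K0 andbT; have := h 1%N; rewrite expr1.
  by rewrite nmulr_lge0.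
by rewrite K00; under eq_fun do rewrite mul0r; exact: cvg_cst.
Qed.

Lemma ae_distribution d1 d2 (T1 : measurableType d1) (T2 : measurableType d2) (R : realType)
    (P : probability T1 R) (f : {mfun T1 >-> T2}) (A : T2 -> Prop) :
  {ae distribution P f, forall y, A y} -> {ae P, forall x, A (f x)}.
Proof.
move=> [N [mN N0 AN]]; exists (f @^-1` N); split => //.
  by rewrite -[_ @^-1` _]setTI; exact: measurable_funPT.
by move=> x /= nA; apply: AN.
Qed.

(** * Transfer to the given chain *)

Section chain.
Context d (X : measurableType d) (R : realType) (Q : R.-pker X ~> X) (pi : probability X R).
Hypothesis rev : reversible pi Q.
Variables (rho : R) (Mfun : X -> R).
Hypothesis rho1 : rho < 1.
Hypothesis Mfun_ge0 : forall y, 0 <= Mfun y.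
Hypothesis tv_le : forall y n, (tv_dist (kiter Q n y) pi <= (Mfun y * rho ^+ n)%:E)%E.

Lemma kiter_dist n y C : measurable C ->
  `|fine (kiter Q n y C) - fine (pi C)| <= Mfun y * rho ^+ n.
Proof.
move=> mC; rewrite -lee_fin; apply: le_trans (tv_le y n).
apply: ereal_sup_ubound; exists C => //.
have fk : kiter Q n y C \is a fin_num by exact: kiter_fin.
have fp : pi C \is a fin_num by exact: fin_num_measure.
by rewrite -[in LHS](fineK fk) -[in LHS](fineK fp).
Qed.

Lemma cvg_tv_bound y : Mfun y * rho ^+ n @[n --> \oo] --> 0.
Proof.
apply: cvg_geometric_bound => // n.
exact: le_trans (normr_ge0 _) (kiter_dist n y (@measurableT _ X)).
Qed.

Lemma kiter_cvg_pi y C : measurable C -> fine (kiter Q n y C) @[n --> \oo] --> fine (pi C).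
Proof.
move=> mC; apply/cvgrPdist_le => e e0.
have /cvgrPdist_le/(_ e e0) := cvg_tv_bound y; apply: filterS => n; rewrite sub0r normrN => h.
by rewrite distrC; apply: le_trans (kiter_dist n y mC) _; apply: le_trans (ler_norm _) h.
Qed.

Variables (x : X) (dO : measure_display) (Omega : measurableType dO).
Variables (P : probability Omega R) (Xs : nat -> Omega -> X).
Hypothesis HX : is_markov_chain Q x P Xs.

Let Phi (w : Omega) : path X := fun t => Xs t w.
Let mPhi : measurable_fun setT Phi.
Proof. by have [mX _] := HX; apply: measurable_to_path => n; exact: mX. Qed.
Let fPhi : {mfun Omega >-> path X} := mfun_Sub (mem_set mPhi).

Lemma law_rect n As : (forall i, measurable (As i)) ->
  distribution P fPhi (rect As n) =
    ((\1_(As 0%N) x)%:E * fdd_tail Q n (fun i => As i.+1) x)%E.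
Proof. by move=> mA; have [_ /(_ n As mA) <-] := HX. Qed.

(** The statements concern [pi] and [Q] alone, but are read off from the stationary path law
    obtained from the given chain. *)
Lemma reversible_chain :
  (forall a f g, L2 pi f -> L2 pi g -> Rintegral pi setT (fun y => f y * Qpow Q a g y) =
     Rintegral pi setT (fun y => Qpow Q a f y * g y)) /\
  (forall f, L2 pi f -> pimean pi (Qop Q f) = pimean pi f).
Proof.
have [L [e e0 eL]] := exists_stationary law_rect (cvg_tv_bound x) (fun n C => @kiter_dist n x C).
split; first exact: (Qpow_selfadj law_rect kiter_cvg_pi e0 eL rev).
exact: (pimean_Qop law_rect kiter_cvg_pi e0 eL rev).
Qed.

Variables (dim : nat) (g : 'I_dim -> X -> R).
Hypothesis Lg : forall i, L2 pi (g i).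

Lemma ae_emp_cov : {ae P, forall w, forall i j k,
  emp_cov (fun t => Xs t w) M (g i) (g j) k @[M --> \oo] --> gamma pi Q (g i) (g j) k}.
Proof.
have [L [e e0 eL]] := exists_stationary law_rect (cvg_tv_bound x) (fun n C => @kiter_dist n x C).
have inv := reversible_inv rev.
have [sa pm] := reversible_chain.
(* [None] stands for the constant 1, so that the law for pairs yields products, means and means of
   shifted terms at once. Pairs of indices and lags are countably many, hence share a null set. *)
pose f (o : option 'I_dim) : X -> R := if o is Some i then g i else cst 1.
have Lf o : L2 pi (f o) by case: o => [i|] //=; exact: (L2_cst (pi1 pi)).
have : {ae P, forall w, forall p : option 'I_dim * option 'I_dim, forall k : nat,
    M%:R^-1 * \sum_(t < M) (f p.1 (Xs t w) * f p.2 (Xs (t + k)%N w)) @[M --> \oo] -->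
    Rintegral pi setT (fun y => f p.1 y * Qpow Q k (f p.2) y)}.
  apply: filter_forall => p; apply: ae_foralln => k.
  exact: (ae_distribution (strong_law_pair law_rect kiter_cvg_pi e0 eL rev k (Lf p.1) (Lf p.2))).
apply: filterS => w h i j k.
rewrite (gammaE inv sa pm)// /cov (pimean_Qpow inv pm)//.
have mean a : emp_mean M (g a) (fun t => Xs t w) @[M --> \oo] --> pimean pi (g a).
  have := h (Some a, None) 0%N => /=.
  rewrite /pimean; under [X in _ --> X -> _]eq_Rintegral do rewrite mulr1.
  by under eq_fun do under eq_bigr do rewrite mulr1.
apply: cvg_emp_cov => //; first exact: (h (Some i, Some j)).
have := h (None, Some j) `|k|%N => /=.
rewrite -[in X in _ -> X](pimean_Qpow inv pm `|k|%N (Lg j)) /pimean.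
under [X in _ --> X -> _]eq_Rintegral do rewrite mul1r.
by under eq_fun do under eq_bigr do rewrite mul1r.
Qed.

End chain.

Lemma cov_varpi d (X : measurableType d) (R : realType) (pi : probability X R) (f : X -> R) :
  L2 pi f -> cov pi f f = varpi pi f.
Proof.
move=> Lf; rewrite /cov /varpi; set c := pimean pi f.
have Lc : L2 pi (cst c) by exact: (L2_cst (pi1 pi)).
have i1 := L2_integrable (pi1 pi) Lf.
have i2 : pi.-integrable setT (EFin \o (fun x => c ^+ 2 - 2 * c * f x)).
  apply: (L2_integrable (pi1 pi)); apply: L2B; first exact: (L2_cst (pi1 pi) (c ^+ 2)).
  exact: L2Z.
transitivity (Rintegral pi setT (fun x => f x * f x + (c ^+ 2 - 2 * c * f x))); last first.
  by apply: eq_Rintegral => x _; ring.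
rewrite RintegralD//; last exact: L2M.
rewrite RintegralB//; last 2 first.
- exact: (L2_integrable (pi1 pi) (L2_cst (pi1 pi) (c ^+ 2))).
- exact: (L2_integrable (pi1 pi) (L2Z (2 * c) Lf)).
rewrite RintegralZl// Rintegral_cst// [X in fine X](pi1 pi) mulr1 -/(pimean pi f) -/c; ring.
Qed.

Theorem theorem3 (R : realType) (T : completePseudoMetricType R)
  (Hpolish : polish_metric T)
  (pi : probability (Borel T) R) (Q : R.-pker (Borel T) ~> (Borel T))
  (A1 : psi_irr_aperiodic_pos_harris Q)
  (A2 : reversible pi Q)
  (A3 : exists (rho : R) (Mfun : Borel T -> R),
      rho < 1 /\ (forall x, 0 <= Mfun x) /\
      forall (x : Borel T) (n : nat),
        (tv_dist (kiter Q n x) pi <= (Mfun x * rho ^+ n)%:E)%E)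
  (dim : nat) (g : 'I_dim -> Borel T -> R)
  (Hgmeas : forall j, measurable_fun setT (g j))
  (B1 : forall j, pi.-integrable setT (fun x => ((g j x) ^+ 2)%:E))
  (Hvar : forall j, 0 < varpi pi (g j))
  (delta : 'I_dim -> R)
  (Hdelta : forall i, 0 < delta i /\ delta i <= Delta (spectral_measure pi Q (g i)))
  (x : Borel T)
  (dO : measure_display) (Omega : measurableType dO) (P : probability Omega R)
  (Xs : nat -> Omega -> Borel T) (HX : is_markov_chain Q x P Xs)
  (U : nat -> Omega -> 'M[R]_dim)
  (HU : forall (M : nat) (w : Omega),
      orth_eigenbasis (Sigma_pw delta g M (fun t => Xs t w)) (U M w)) :
  {ae P, forall w,
    (fun M : nat => Sigma_psd delta g M (fun t => Xs t w) (U M w)) @ \oo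
      --> Sigma pi Q g}.
Proof.
have [rho [Mfun [rho1 [Mfun_ge0 tv_le]]]] := A3.
have Lg j : L2 pi (g j) by split.
have inv := reversible_inv A2.
have [sa pm] := reversible_chain A2 rho1 Mfun_ge0 tv_le HX.
have [gS delta1] : (forall i, moment_seq (1 - delta i) (gamma pi Q (g i) (g i))) /\
    (forall i, delta i <= 1).
  (* The chosen spectral measure does represent the autocovariance, so the bound on [delta i]
     confines it to [-(1 - delta i), 1 - delta i] and forces delta i <= 1. *)
  have DP i := spectral_measureP inv sa pm (Lg i).
  split=> i; have [F1 FE] := DP i; have [_ /(Delta_le F1)[d1 F0]] := Hdelta i.
    by exists (spectral_measure pi Q (g i)).
  by rewrite -subr_ge0.
apply: filterS (ae_emp_cov A2 rho1 Mfun_ge0 tv_le HX Lg) => w cvg_w.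
apply: (cvg_Sigma_psd inv sa pm Lg _ delta1 gS cvg_w) => // [i|i].
  by have [] := Hdelta i.
rewrite /= (gammaE inv sa pm)// cov_varpi//.
Qed.
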